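(* Let $X_{it}=\sigma_{it}Z_{it}$, $i,t\ge 1$, be the stochastic volatility model described in the context, and let $\mathbf X=\mathbf X_n=(X_{it})_{i=1,\ldots,p;\,t=1,\ldots,n}$, $\mathbf S=\mathbf X\mathbf X'$, and $\mathbf Y=\mathbf A^{1/2}\mathbf X$, so that $\mathbf Y\mathbf Y'=\mathbf A^{1/2}\mathbf S\mathbf A^{1/2}$. Assume the following. (1) $p=p_n\to\infty$ is an integer sequence of the form $p_n=n^{\beta}\ell(n)$, $n\ge 1$, where $\ell$ is a slowly varying function and $\beta\in(0,1]$. (2) For some $\alpha\in(0,2)\cup(2,4)$, constants $q_+,q_-\ge 0$ with $q_++q_-=1$ and a slowly varying function $L$, one has $\mathbb P(Z>x)\sim q_+L(x)x^{-\alpha}$ and $\mathbb P(Z<-x)\sim q_-L(x)x^{-\alpha}$ as $x\to\infty$; moreover $\mathbb E[Z]=0$ if $\mathbb E[|Z|]<\infty$. (3) $\mathbb E[\sigma^r]<\infty$ for all $r>0$. (4) $\mathbf A=\mathbf A_n$ is a sequence of deterministic, (symmetric) positive definite $p\times p$ matrices with uniformly bounded spectra, i.e. $\sup_n\|\mathbf A_n\|_2<\infty$. (5) $(\mathbf A_n)$ is nearly banded: there exists an integer sequence $k=k_p\to\infty$ with $k_p^3=o(p)$ such that $\lim_{n\to\infty}P_n(\mathbf A_n,k)=0$, where $P_n$ is defined in the context. (6) The rows of $(\sigma_{it})_{i,t\ge1}$ are iid, strictly stationary ergodic sequences; moreover, they are strongly mixing with rate function $(\alpha_j)$ satisfying $\alpha_j\le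 c\,j^{-a}$ for some constants $c>0$ and $a>1$. Then, as $n\to\infty$: (i) If $\alpha\in(0,2)$, $$a_{np}^{-2}\max_{i=1,\ldots,p}\big|\lambda_i(\mathbf A^{1/2}\mathbf S\mathbf A^{1/2})-\lambda_i(\operatorname{diag}(\mathbf S)\operatorname{diag}(\mathbf A))\big|\stackrel{\mathbb P}{\rightarrow}0.$$ (ii) If $\alpha\in(2,4)$, then with $c_n=n\,\mathbb E[X^2]$, $$a_{np}^{-2}\max_{i=1,\ldots,p}\big|\lambda_i(\mathbf A^{1/2}(\mathbf S-c_n\mathbf I)\mathbf A^{1/2})-\lambda_i(\operatorname{diag}(\mathbf S-c_n\mathbf I)\operatorname{diag}(\mathbf A))\big|\stackrel{\mathbb P}{\rightarrow}0.$$
   Context: Stochastic volatility model: $(Z_{it})_{i,t\ge1}$ is a field of iid real random variables, $(\sigma_{it})_{i,t\ge 1}$ is a strictly stationary random field of non-negative random variables, the fields $(\sigma_{it})$ and $(Z_{it})$ are independent, and $X_{it}=\sigma_{it}Z_{it}$. $X,\sigma,Z$ denote generic elements of the respective fields. $(a_k)$ is a sequence of positive numbers with $k\,\mathbb P(|Z|>a_k)\to 1$ as $k\to\infty$, and $a_{np}$ is its element with index $k=np$, $p=p_n$. $\mathbf A^{1/2}$ is the symmetric positive definite square root of $\mathbf A$; $\mathbf I$ is the $p\times p$ identity matrix; $\|\mathbf C\|_2$ is the spectral norm; $\operatorname{diag}(\mathbf C)$ is the diagonal matrix with the same diagonal as $\mathbf C$; $\lambda_1(\mathbf C)\ge\cdots\ge\lambda_p(\mathbf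 C)$ are the ordered eigenvalues of a real symmetric $p\times p$ matrix $\mathbf C$. Definition of $P_n$: for $1\le k\le p$ let $\Pi_{k,p}=\{\mathbf a=(a_1,\ldots,a_k)\in\{1,\ldots,p\}^k: a_1<\cdots<a_k\}$. For $\mathbf A=(A_{ij})\in\mathbb R^{p\times p}$ and $\mathbf a\in\Pi_{k,p}$ let $J_{k,p}(\mathbf a,\mathbf A)=1$ if $\sum_{i=1}^k\sum_{j=1;\,|j-a_i|>k}^p|A_{a_i,j}|>0$ and $J_{k,p}(\mathbf a,\mathbf A)=0$ otherwise. Then $P_n(\mathbf A,k)=\binom pk^{-1}\sum_{\mathbf a\in\Pi_{k,p}}J_{k,p}(\mathbf a,\mathbf A)$. *)

(* Defs.v *)
(* MathComp and MathComp-Analysis. *)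
From HB Require Import structures.
From mathcomp Require Import all_boot all_order all_algebra.
From mathcomp Require Import complex.
From mathcomp Require Import all_classical all_reals all_analysis.

Set Implicit Arguments.
Unset Strict Implicit.
Unset Printing Implicit Defensive.

Import Order.TTheory GRing.Theory Num.Theory.
Import numFieldNormedType.Exports.

Local Open Scope classical_set_scope.
Local Open Scope ring_scope.

(* A random field indexed by i, t >= 1 is represented by a function of a pair
   (i, t) of natural numbers counted from 0. *)

Section Probability.
Context (R : realType).

Definition sigma_gen (U I : Type) (X : I -> U -> R) (J : set I) :
    set (set U) :=
  <<s [set E | exists i (B : set R),
        [/\ J i, measurable B & E = X i @^-1` B]] >>.

(* The product sigma-algebra of R^I *)
Definition path_sigma (I : Type) : set (set (I -> R)) :=
  sigma_gen (fun i (x : I -> R) => x i) setT.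

Context d (T : measurableType d) (P : probability T R).

Definition independent (F G : set (set T)) : Prop :=
  forall A B, F A -> G B -> P (A `&` B) = (P A * P B)%E.

Definition mutually_independent (I : eqType) (F : I -> set (set T)) : Prop :=
  forall (s : seq I) (E : I -> set T), uniq s ->
    (forall i, i \in s -> F i (E i)) ->
    P (\big[setI/setT]_(i <- s) E i) = (\prod_(i <- s) P (E i))%E.

Definition same_distribution (X Y : {RV P >-> R}) : Prop :=
  forall B : set R, measurable B -> P (X @^-1` B) = P (Y @^-1` B).

Definition same_law (I : Type) (X Y : I -> {RV P >-> R}) : Prop :=
  forall B, path_sigma B ->
    P [set w | B (fun i => X i w)] = P [set w | B (fun i => Y i w)].

Definition iid (I : eqType) (X : I -> {RV P >-> R}) : Prop :=
  mutually_independent (fun i => sigma_gen (fun j => X j : T -> R) [set i]) /\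
  forall i j, same_distribution (X i) (X j).

Definition iid_rows (X : nat * nat -> {RV P >-> R}) : Prop :=
  mutually_independent
    (fun i => sigma_gen (fun it => X it : T -> R) [set it | it.1 = i]) /\
  forall i j, same_law (fun t => X (i, t)) (fun t => X (j, t)).

Definition independent_fields (I J : Type)
    (X : I -> {RV P >-> R}) (Y : J -> {RV P >-> R}) : Prop :=
  independent (sigma_gen (fun i => X i : T -> R) setT)
              (sigma_gen (fun j => Y j : T -> R) setT).

Definition stationary_field (X : nat * nat -> {RV P >-> R}) : Prop :=
  forall h k, same_law X (fun it => X ((it.1 + h)%N, (it.2 + k)%N)).

Definition stationary_sequence (Y : nat -> {RV P >-> R}) : Prop :=
  forall h, same_law Y (fun t => Y (t + h)%N).

(* Ergodicity of a (one-sided) stationary sequence: the shift-invariant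
   events have probability 0 or 1. *)
Definition ergodic_sequence (Y : nat -> {RV P >-> R}) : Prop :=
  forall B : set (nat -> R), path_sigma B ->
    [set x : nat -> R | B (fun t => x t.+1)] = B ->
    P [set w | B (fun t => Y t w)] = 0%E \/
    P [set w | B (fun t => Y t w)] = 1%E.

(* alpha_j = sup_m sup { |P(A n B) - P(A) P(B)| :
     A in sigma(Y_t, t <= m), B in sigma(Y_t, t >= m + j) } *)
Definition mixing_coef (Y : nat -> {RV P >-> R}) (j : nat) : R :=
  sup [set r | exists m A B,
    [/\ sigma_gen (fun t => Y t : T -> R) [set t | (t <= m)%N] A,
        sigma_gen (fun t => Y t : T -> R) [set t | (m + j <= t)%N] B &
        r = `|fine (P (A `&` B)) - fine (P A) * fine (P B)| ]].

Definition cvg_in_probability_to0 (Y : nat -> T -> R) : Prop :=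
  forall eps : R, 0 < eps ->
    P [set w | eps < `|Y n w|] @[n --> \oo] --> 0%E.

End Probability.

Section SlowVariation.
Context (R : realType).

Definition slowly_varying (L : R -> R) : Prop :=
  [/\ exists x0 : R, measurable_fun `]x0, +oo[ L,
      \forall x \near +oo, 0 < L x &
      forall c, 0 < c -> L (c * x) / L x @[x --> +oo] --> (1 : R)].

(* P(Y > x) ~ q L(x) x^{-alpha}, where for q = 0 this means
   P(Y > x) = o(L(x) x^{-alpha}) *)
Definition right_tail d (T : measurableType d) (P : probability T R)
    (Y : T -> R) (q : R) (L : R -> R) (alpha : R) : Prop :=
  fine (P [set w | x < Y w]) / (L x * x `^ (- alpha)) @[x --> +oo] --> q.

End SlowVariation.

Section Matrices.
Context (R : realType).

Definition posdefmx (m : nat) (C : 'M[R]_m) : Prop :=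
  C^T = C /\ forall v : 'cV[R]_m, v != 0 -> 0 < (v^T *m C *m v) 0 0.

(* The symmetric positive definite square root of a positive definite matrix
   (see sqrtmxP); the default value 0 is only used for other matrices. *)
Definition sqrtmx (m : nat) (C : 'M[R]_m) : 'M[R]_m :=
  xget 0 [set B : 'M[R]_m | posdefmx B /\ B *m B = C].

(* The eigenvalues of a matrix with split characteristic polynomial, e.g. a
   symmetric one (see eigenvaluesP), repeated according to multiplicity and in
   nonincreasing order; the default value [::] is only used for other matrices. *)
Definition eigenvalues (m : nat) (C : 'M[R]_m) : seq R :=
  xget [::] [set s : seq R |
    sorted >=%R s /\ char_poly C = \prod_(x <- s) ('X - x%:P)].

(* lambda C i is the (i+1)-st largest eigenvalue. *)
Definition lambda (m : nat) (C : 'M[R]_m) (i : nat) : R :=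
  nth 0 (eigenvalues C) i.

Definition diag_part (m : nat) (C : 'M[R]_m) : 'M[R]_m :=
  diag_mx (\row_i C i i).

Definition l2norm (m : nat) (v : 'cV[R]_m) : R :=
  Num.sqrt (\sum_i v i 0 ^+ 2).

Definition spectral_norm (m : nat) (C : 'M[R]_m) : R :=
  sup [set r | exists2 v : 'cV[R]_m, l2norm v <= 1 & r = l2norm (C *m v)].

(* `|j - tnth a i|%N is the absolute difference in int, not a truncated one. *)
Definition offband_indicator (q k : nat) (a : k.-tuple 'I_q) (C : 'M[R]_q) : R :=
  if 0 < \sum_(i < k) \sum_(j < q | (k < `|j - tnth a i|)%N) `|C (tnth a i) j|
  then 1 else 0.

Definition offband_frac (q : nat) (C : 'M[R]_q) (k : nat) : R :=
  ('C(q, k)%:R)^-1 *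
  \sum_(a : k.-tuple 'I_q | sorted ltn [seq val x | x <- a])
     offband_indicator a C.

Definition nearly_banded (p : nat -> nat) (A : forall n, 'M[R]_(p n)) : Prop :=
  exists k : nat -> nat,
    [/\ k q @[q --> \oo] --> \oo,
        (k q ^ 3)%N%:R / q%:R @[q --> \oo] --> (0 : R) &
        offband_frac (A n) (k (p n)) @[n --> \oo] --> (0 : R)].

Definition max_eigen_gap (m : nat) (B C : 'M[R]_m) : R :=
  \big[Num.max/0]_(i < m) `|lambda B i - lambda C i|.

End Matrices.

(* Existence of the ordered eigenvalues and of the square root. *)

Lemma spectral_symmx (R : realType) (m : nat) (A : 'M[R]_m) : A^T = A ->
  exists (U : 'M[complex R]_m) (e : 'rV[R]_m), U \in unitmx /\
    map_mx (@real_complex_def R (Phant R)) A = invmx U *m diag_mx (map_mx (@real_complex_def R (Phant R)) e) *m U.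
Proof.
move=> sA.
set M := map_mx _ A.
have hM : M \is hermitianmx m false Num.conj.
  apply: realsym_hermsym.
    apply/is_hermitianmxP; rewrite expr0 scale1r map_mx_id //.
    by rewrite /M map_trmx sA.
  by apply/mxOverP => i j; rewrite mxE complex_real.
have nM := hermitian_normalmx hM.
have /mxOverP rM := hermitian_spectral_diag_real hM.
have /orthomx_spectralP eM := nM.
exists (spectralmx M), (map_mx (fun z => complex.Re z) (spectral_diag M)); split.
  exact: spectral_unit.
suff -> : map_mx (@real_complex_def R (Phant R)) (map_mx (fun z => complex.Re z) (spectral_diag M)) = spectral_diag M by [].
by apply/matrixP => i j; rewrite !mxE RRe_real.
Qed.

Lemma symmx_split (R : realType) (m : nat) (A : 'M[R]_m) : A^T = A ->
  exists s : seq R, char_poly A = \prod_(x <- s) ('X - x%:P).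
Proof.
case/spectral_symmx => U [e [Uu eA]].
exists [seq e 0 i | i <- enum 'I_m].
pose f := @real_complex_def R (Phant R).
apply: (@map_poly_inj _ _ f); rewrite map_char_poly /= eA.
rewrite rmorph_prod /= big_map big_enum /=.
have -> : char_poly (invmx U *m diag_mx (map_mx f e) *m U) = char_poly (diag_mx (map_mx f e)).
  rewrite /char_poly /char_poly_mx !map_mxM /=.
  set W := map_mx _ U; set V := map_mx _ (invmx U); set D := map_mx _ _.
  have VW : V *m W = 1%:M by rewrite -map_mxM mulVmx // map_mx1.
  have -> : 'X%:M - V *m D *m W = V *m ('X%:M - D) *m W.
    by rewrite mulmxBr mulmxBl mul_mx_scalar -scalemxAl VW scalemx1.
  by rewrite !det_mulmx mulrC mulrA -det_mulmx mulmx1C // det1 mul1r.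
rewrite char_poly_trig ?diag_mx_is_trig //; apply: eq_bigr => i _.
by rewrite rmorphB /= map_polyX map_polyC /= !mxE eqxx mulr1n.
Qed.

Lemma eigenvaluesP (R : realType) (m : nat) (A : 'M[R]_m) : A^T = A ->
  sorted >=%R (eigenvalues A) /\
  char_poly A = \prod_(x <- eigenvalues A) ('X - x%:P).
Proof.
case/symmx_split => s es; rewrite /eigenvalues.
apply: (@xgetPex _ [::] [set s : seq R |
    sorted >=%R s /\ char_poly A = \prod_(x <- s) ('X - x%:P)]).
exists (sort >=%R s); split; first by apply: sort_sorted => x y; exact: le_total.
by rewrite es; apply: perm_big; rewrite perm_sym perm_sort.
Qed.

Lemma interpol (R : fieldType) (f : R -> R) (s : seq R) :
  uniq s -> exists q : {poly R}, forall x, x \in s -> q.[x] = f x.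
Proof.
elim: s => [|x s IH] /=; first by move=> _; exists 0.
case/andP => xs /IH [q hq].
pose g := \prod_(y <- s) ('X - y%:P).
exists (q + ((f x - q.[x]) / g.[x]) *: g) => y; rewrite inE !hornerE.
have gx : g.[x] != 0 by rewrite -[_ == 0]/(root g x) root_prod_XsubC.
case/predU1P => [->|ys]; first by rewrite divfK // addrC subrK.
have /eqP -> : root g y by rewrite root_prod_XsubC.
by rewrite mulr0 addr0 hq.
Qed.

Lemma tr_mulmx_ge0 (R : realType) (m : nat) (v : 'cV[R]_m) :
  v != 0 -> 0 < (v^T *m v) 0 0.
Proof.
move=> v0; rewrite mxE lt_neqAle sumr_ge0 ?andbT; last first.
  by move=> i _; rewrite mxE -expr2 sqr_ge0.
apply: contra v0 => /eqP /esym h; apply/eqP/colP => i.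
have h0 (j : 'I_m) : true -> 0 <= v^T 0 j * v j 0.
  by move=> _; rewrite mxE -expr2 sqr_ge0.
have /(_ i isT) := psumr_eq0P h0 h; rewrite !mxE -expr2 => hh.
by apply/eqP; rewrite -sqrf_eq0 hh.
Qed.

Lemma tr_horner_mx (R : comNzRingType) (m : nat) (A : 'M[R]_m.+1) q :
  A^T = A -> (horner_mx A q)^T = horner_mx A q.
Proof.
move=> sA; elim/poly_ind: q => [|q c IH]; first by rewrite rmorph0 trmx0.
rewrite rmorphD rmorphM /= horner_mx_X horner_mx_C !linearD /= trmx_mul IH sA.
by rewrite tr_scalar_mx (comm_mx_horner q (erefl : comm_mx A A)).
Qed.

Lemma sqrtmxP (R : realType) (m : nat) (A : 'M[R]_m) : posdefmx A ->
  posdefmx (sqrtmx A) /\ sqrtmx A *m sqrtmx A = A.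
Proof.
move=> pA; apply: (@xgetPex _ 0 [set B : 'M[R]_m | posdefmx B /\ B *m B = A]).
case: m A pA => [|m] A [sA pA].
  by exists A; split=> //; apply/matrixP => -[].
have [U [e [Uu eA]]] := spectral_symmx sA.
pose f := @real_complex_def R (Phant R).
pose g x : R := Num.sqrt (Num.sqrt x).
have [r hr] := interpol g (undup_uniq [seq e 0 i | i <- enum 'I_m.+1]).
have egt0 i : 0 < e 0 i.
  have : eigenvalue A (e 0 i).
    rewrite eigenvalue_root_char -(fmorph_root f) map_char_poly /= eA.
    rewrite -eigenvalue_root_char; apply/eigenvalueP.
    exists (row i U); last first.
      apply: contraTneq Uu => h; rewrite unitmxE unitfE (expand_det_row _ i) negbK big1 //.
      by move=> j _; move/rowP: h => /(_ j); rewrite !mxE => ->; rewrite mul0r.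
    by rewrite !mulmxA -row_mul mulmxV // row1 -rowE row_diag_mx -scalemxAl -rowE mxE.
  case/eigenvalueP => v hv v0.
  have v0' : v^T != 0 by rewrite -trmx0 (inj_eq trmx_inj).
  have := pA _ v0'; rewrite trmxK hv -scalemxAl mxE.
  by rewrite pmulr_lgt0 //; have := tr_mulmx_ge0 v0'; rewrite trmxK.
pose D := horner_mx A r.
have sD : D^T = D by exact: tr_horner_mx.
have D4 : D *m D *m (D *m D) = A.
  suff : horner_mx A (r * r * (r * r) - 'X) = 0.
    by rewrite rmorphB /= !rmorphM /= horner_mx_X => /eqP; rewrite subr_eq0 => /eqP.
  apply: (@map_mx_inj _ _ f); rewrite map_horner_mx map_mx0 /= eA.
  rewrite horner_mx_uconjC // horner_mx_diag.
  set E := map_mx _ _; suff -> : E = 0 by rewrite linear0 mulmx0 mul0mx.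
  apply/rowP => i; rewrite !mxE horner_map /= !hornerE hr; last first.
    by rewrite mem_undup map_f // mem_enum.
  have h : g (e 0 i) * g (e 0 i) = Num.sqrt (e 0 i).
    by rewrite -expr2 sqr_sqrtr // sqrtr_ge0.
  rewrite [X in X - _](_ : _ = e 0 i) ?subrr ?rmorph0 //.
  rewrite -[LHS]/(g (e 0 i) * g (e 0 i) * g (e 0 i) * g (e 0 i)) -mulrA h -expr2.
  by rewrite sqr_sqrtr // ltW.
exists (D *m D); split=> //; split; first by rewrite trmx_mul sD.
move=> v v0; rewrite -{1}sD.
have -> : v^T *m (D^T *m D) *m v = (D *m v)^T *m (D *m v) by rewrite trmx_mul !mulmxA.
apply: tr_mulmx_ge0; apply: contraTneq (pA _ v0) => h.
by rewrite -D4 -!mulmxA h !mulmx0 mxE ltxx.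
Qed.

Section Model.
Context (R : realType) d (T : measurableType d) (P : probability T R).
Context (sigma Z : nat * nat -> {RV P >-> R}).

Definition sv_field (it : nat * nat) (w : T) : R := sigma it w * Z it w.

Definition data_matrix (p n : nat) (w : T) : 'M[R]_(p, n) :=
  \matrix_(i < p, t < n) sv_field (val i, val t) w.

Definition sample_cov (p n : nat) (w : T) : 'M[R]_p :=
  data_matrix p n w *m (data_matrix p n w)^T.

End Model.

(* Main.v *)
From HB Require Import structures.
Require Import Defs.
From mathcomp Require Import all_boot all_order all_fingroup all_algebra.
From mathcomp Require Import complex zify ring lra.
From mathcomp Require Import all_classical all_reals all_analysis.
From mathcomp Require Import measurable_realfun.
Set Implicit Arguments.
Unset Strict Implicit.
Unset Printing Implicit Defensive.
Import Order.TTheory GRing.Theory Num.Theory.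
Import numFieldNormedType.Exports.
Local Open Scope classical_set_scope.
Local Open Scope ring_scope.

(** The matrix [S] is nearly diagonal, and [A] has so few off-diagonal entries
    that it cannot mix the few large diagonal entries of [S].

    Let [c = 0] when [alpha < 2] and let [c] be the mean of a diagonal entry of
    [S] when [alpha > 2]; write [S - c I = W + diag h] with [W] the off-diagonal
    part, and [N = n p].  Three facts are needed.

    (a) The quadratic form of [W] is at most [eps a_N^2], outside an event of
    small probability.

    (b) Each [h_i] exceeds [eps a_N^2] in absolute value with probability
    [O(1 / p)].

    (c) Only [o(p^2)] off-diagonal entries of [A] differ from zero.

    Distinct rows are independent, so by (b) and (c) a union bound shows that,
    outside an event of small probability, no nonzero entry [A_ij] with [i] and
    [j] distinct links two large entries [h_i] and [h_j].  On what remains the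
    argument is deterministic (max_eigen_gap_bound).  By Weyl's inequality,
    removing [W] and the small entries of [h] moves the eigenvalues by
    [O(eps a_N^2)].  Let [k] be the vector of the large entries of [h] and [Q]
    the projection onto its support.  The characteristic polynomial of a
    product of two matrices does not depend on their order, so
    [A^(1/2) (diag k) A^(1/2)] has the characteristic polynomial of
    [(diag k) A Q], which is [(diag k) (diag A)]: the two spectra coincide.

    For (a) with [alpha < 2], the noise is truncated at a multiple of [a_N], and
    the Frobenius norm of [W] is controlled by second moments
    (frob_cross_moment).  For [alpha > 2] this is not enough: this norm is then
    of order [p n^(1/2)], which may exceed [a_N^2].  The noise is split at a level slightly below [a_N].  Mixed terms and the part
    above this level are again handled by second moments.  For the bounded part
    [M], Cauchy--Schwarz bounds the quadratic form by the trace of a high power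
    of [M] (qform_trace), and the expected trace is estimated by counting closed
    walks (trace_moment): given the volatility the noise is centred and
    independent, so each edge of a contributing walk is repeated; the volatility
    enters through its moments only (sigma_prod).

    For (b), truncation at [a_N] and Karamata's bound [E |Z|^m 1(|Z| <= x)
    = O(x^m P(|Z| > x))] for [m > alpha] give the order [n / N = 1 / p] for the
    noise.  With [alpha > 2] there remains the sum of the centred squared
    volatilities along a row, whose variance is bounded by means of the mixing
    rate, after capping (mixing_variance), and the bias of the truncation, which
    is negligible since [p] grows at least like a power of [N].  The tails enter
    only through the comparison of [P(|Z| > 2 x)] with [P(|Z| > x)], and the
    bounds on [p] come from the uniform convergence theorem for slowly varying
    functions (uniform_translation).

    For (c), a random set of [k] indices contains a given index with probability
    [k / p], so the fraction of sets meeting the rows with nonzero entries far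
    from the diagonal is at least the proportion of such rows (hitting_sets).

    Probabilities of events about eigenvalues make sense because the ordered
    eigenvalues depend on a symmetric matrix in a Lipschitz way, and are
    therefore measurable (measurable_lambda). *)

(** * Eigenvalues of real symmetric matrices *)

Section QuadraticForms.
Context (R : realType).
Implicit Types m : nat.

Definition dotc m (u v : 'cV[R]_m) : R := \sum_i u i 0 * v i 0.
Definition qform m (B : 'M[R]_m) (v : 'cV[R]_m) : R := dotc v (B *m v).

Lemma qformE m (B : 'M[R]_m) v : qform B v = (v^T *m B *m v) 0 0.
Proof.
by rewrite -mulmxA [RHS]mxE; apply: eq_bigr => i _; rewrite [v^T _ _]mxE.
Qed.

Lemma dotcE m (u v : 'cV[R]_m) : dotc u v = (u^T *m v) 0 0.
Proof. by rewrite [RHS]mxE; apply: eq_bigr => i _; rewrite mxE. Qed.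

Lemma dotcC m (u v : 'cV[R]_m) : dotc u v = dotc v u.
Proof. by apply: eq_bigr => i _; rewrite mulrC. Qed.

Lemma dotcDr m (u v w : 'cV[R]_m) : dotc u (v + w) = dotc u v + dotc u w.
Proof. by rewrite -big_split; apply: eq_bigr => i _; rewrite mxE mulrDr. Qed.

Lemma dotcZr m (u v : 'cV[R]_m) a : dotc u (a *: v) = a * dotc u v.
Proof. by rewrite mulr_sumr; apply: eq_bigr => i _; rewrite mxE mulrCA. Qed.

Lemma dotc_ge0 m (v : 'cV[R]_m) : 0 <= dotc v v.
Proof. by apply: sumr_ge0 => i _; rewrite -expr2 sqr_ge0. Qed.

Lemma dotc_mull m n (B : 'M[R]_(m, n)) u v : dotc (B *m u) v = dotc u (B^T *m v).
Proof. by rewrite !dotcE trmx_mul mulmxA. Qed.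

Lemma qformD m (B C : 'M[R]_m) v : qform (B + C) v = qform B v + qform C v.
Proof. by rewrite /qform mulmxDl dotcDr. Qed.

Lemma qformZ m a (B : 'M[R]_m) v : qform (a *: B) v = a * qform B v.
Proof. by rewrite /qform -scalemxAl dotcZr. Qed.

Lemma qformN m (B : 'M[R]_m) v : qform (- B) v = - qform B v.
Proof. by rewrite -scaleN1r qformZ mulN1r. Qed.

Lemma qformB m (B C : 'M[R]_m) v : qform (B - C) v = qform B v - qform C v.
Proof. by rewrite qformD qformN. Qed.

Lemma cauchy_schwarz m (u v : 'cV[R]_m) :
  dotc u v ^+ 2 <= dotc u u * dotc v v.
Proof.
have [v0|v0] := eqVneq (dotc v v) 0.
  have vi0 i : v i 0 = 0.
    have h0 (j : 'I_m) : true -> 0 <= v j 0 * v j 0.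
      by move=> _; rewrite -expr2 sqr_ge0.
    by have /(_ i isT)/eqP := psumr_eq0P h0 v0; rewrite mulf_eq0 orbb => /eqP.
  by rewrite v0 mulr0 /dotc big1 ?expr0n // => i _; rewrite vi0 mulr0.
have vgt0 : 0 < dotc v v by rewrite lt_neqAle eq_sym v0 dotc_ge0.
have := dotc_ge0 (dotc v v *: u + (- dotc u v) *: v).
rewrite !dotcDr !(dotcC (_ + _)) !dotcDr !dotcZr !(dotcC (_ *: _)) !dotcZr.
rewrite (dotcC v u); set a := dotc u u; set b := dotc u v; set c := dotc v v.
have -> : c * (c * a) + - b * (c * b) + (c * (- b * b) + - b * (- b * c)) =
   c * (a * c - b ^+ 2) by ring.
by rewrite pmulr_rge0 // subr_ge0.
Qed.

Lemma qform_sandwich m (Q W : 'M[R]_m) v : Q^T = Q ->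
  qform (Q *m W *m Q) v = qform W (Q *m v).
Proof. by move=> sQ; rewrite /qform dotc_mull sQ !mulmxA. Qed.

End QuadraticForms.

Section CharPoly.

(** Both products are Schur complements of the same block matrix. *)
Lemma char_poly_mulmxC (F : fieldType) m (B C : 'M[F]_m) :
  char_poly (B *m C) = char_poly (C *m B).
Proof.
rewrite /char_poly /char_poly_mx !map_mxM /=.
set b := map_mx _ B; set c := map_mx _ C.
pose M : 'M[{poly F}]_(m + m) := block_mx 'X%:M b c 1%:M.
have e1 : \det M = \det ('X%:M - b *m c).
  have -> : \det ('X%:M - b *m c) =
      \det (M *m block_mx 1%:M 0 (- c) 1%:M).
    rewrite /M mulmx_block !mulmx1 !mulmx0 !mul1mx mulmxN !add0r subrr.
    by rewrite det_ublock det1 mulr1.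
  by rewrite det_mulmx det_lblock !det1 !mulr1.
have e2 : 'X ^+ m * \det M = 'X ^+ m * \det ('X%:M - c *m b).
  have -> : 'X ^+ m * \det M = \det (block_mx 1%:M 0 (- c) 'X%:M *m M).
    by rewrite det_mulmx det_lblock det1 mul1r det_scalar.
  rewrite /M mulmx_block !mul1mx !mul0mx !addr0 mulmx1 !mulNmx.
  rewrite mul_mx_scalar mul_scalar_mx addNr det_ublock det_scalar.
  by rewrite [- _ + _]addrC.
have nz : 'X ^+ m != 0 :> {poly F} by rewrite expf_neq0 // polyX_eq0.
by rewrite -e1; apply: (mulfI nz); rewrite e2.
Qed.

End CharPoly.

Section Weyl.
Context (R : realType).
Implicit Types m : nat.

Lemma eigenvalues_char_poly m (B C : 'M[R]_m) :
  char_poly B = char_poly C -> eigenvalues B = eigenvalues C.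
Proof. by move=> e; rewrite /eigenvalues e. Qed.

Lemma size_eigenvalues m (B : 'M[R]_m) : B^T = B -> size (eigenvalues B) = m.
Proof.
case/eigenvaluesP => _ /(congr1 (fun q : {poly R} => size q)).
by rewrite size_char_poly size_prod_XsubC => -[].
Qed.

Local Notation cplx := (@real_complex_def R (Phant R)).
Local Notation "M ^t*" := (map_mx Num.conj M^T) : ring_scope.

(** With the eigenvalues in decreasing order, the [i]-th one separates the
    Rayleigh quotients of the first eigenvectors from those of the last ones. *)
Lemma sorted_spectral m (B : 'M[R]_m) : B^T = B ->
  exists U : 'M[complex R]_m, U *m U^t* = 1%:M /\
    map_mx cplx B = U^t* *m diag_mx (\row_i cplx (lambda B i)) *m U.
Proof.
move=> sB; have [_ cB] := eigenvaluesP sB.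
set M := map_mx _ B.
have hM : M \is hermitianmx m false Num.conj.
  apply: realsym_hermsym.
    apply/is_hermitianmxP; rewrite expr0 scale1r map_mx_id //.
    by rewrite /M map_trmx sB.
  by apply/mxOverP => i j; rewrite mxE complex_real.
have /mxOverP rM := hermitian_spectral_diag_real hM.
have /orthomx_spectralP eM := hermitian_normalmx hM.
have uV := spectral_unitarymx M; set V := spectralmx M in uV eM.
pose e i := complex.Re (spectral_diag M 0 i).
have ee : spectral_diag M = \row_i cplx (e i).
  by apply/rowP => i; rewrite mxE /e /= RRe_real.
rewrite ee invmx_unitary // in eM.
have /unitarymxP VV := uV.
have cM : char_poly B = \prod_(x <- [seq e i | i <- enum 'I_m]) ('X - x%:P).
  apply: (@map_poly_inj _ _ cplx); rewrite map_char_poly /= -/M eM.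
  rewrite -mulmxA char_poly_mulmxC -mulmxA VV mulmx1.
  rewrite rmorph_prod /= big_map big_enum /=.
  rewrite char_poly_trig ?diag_mx_is_trig //; apply: eq_bigr => i _.
  by rewrite rmorphB /= map_polyX map_polyC /= !mxE eqxx mulr1n.
have /tuple_permP [s es] : perm_eq (eigenvalues B) [tuple e i | i < m].
  by apply: prod_XsubC_eq; rewrite -cB cM.
exists (row_perm s V); split.
  apply/matrixP => i j; have /matrixP/(_ (s i) (s j)) := VV.
  rewrite mxE [_%:M _ _]mxE (inj_eq (@perm_inj _ s)) => h.
  rewrite mxE [_%:M _ _]mxE -h.
  by apply: eq_bigr => k _; rewrite !mxE.
rewrite eM !mul_mx_diag; apply/matrixP => i j; rewrite [LHS]mxE [RHS]mxE.
rewrite (reindex_inj (@perm_inj _ s)) /=; apply: eq_bigr => k _; rewrite !mxE.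
by rewrite /lambda es -[nth _ _ _]tnth_nth !tnth_mktuple.
Qed.

Lemma sorted_lambda m (B : 'M[R]_m) i j : B^T = B ->
  (i <= j)%N -> (j < m)%N -> lambda B j <= lambda B i.
Proof.
move=> sB ij jm; have [so _] := eigenvaluesP sB; have sz := size_eigenvalues sB.
have tr : transitive (>=%R : rel R) by move=> x y z /= xy yz; exact: le_trans yz xy.
apply: (sorted_leq_nth tr (fun x => lexx x) 0 so) => //; rewrite inE sz //.
exact: leq_ltn_trans jm.
Qed.

Lemma conj_form_real m (B : 'M[R]_m) (x : 'rV[complex R]_m) :
  B^T = B ->
  (x *m map_mx cplx B *m x^t*) 0 0 =
    cplx (qform B (\col_i complex.Re (x 0 i)) + qform B (\col_i complex.Im (x 0 i))).
Proof.
move=> sB; rewrite /qform /dotc -mulmxA mxE.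
have e i : (map_mx cplx B *m x^t*) i 0 =
  cplx ((B *m (\col_i complex.Re (x 0 i))) i 0) -
  'i%C * cplx ((B *m (\col_i complex.Im (x 0 i))) i 0).
  rewrite !mxE !rmorph_sum mulr_sumr -sumrB; apply: eq_bigr => j _.
  rewrite !mxE !rmorphM /= mulrCA -mulrBr; congr (_ * _).
  by case: (x 0 j) => a b; simpc.
pose u i := (B *m (\col_i complex.Re (x 0 i))) i 0.
pose v i := (B *m (\col_i complex.Im (x 0 i))) i 0.
have sym : \sum_i complex.Im (x 0 i) * u i = \sum_i complex.Re (x 0 i) * v i.
  pose a : 'cV[R]_m := \col_i complex.Re (x 0 i).
  pose b : 'cV[R]_m := \col_i complex.Im (x 0 i).
  have -> : \sum_i complex.Im (x 0 i) * u i = dotc b (B *m a).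
    by apply: eq_bigr => i _; rewrite [b i 0]mxE.
  have -> : \sum_i complex.Re (x 0 i) * v i = dotc a (B *m b).
    by apply: eq_bigr => i _; rewrite [a i 0]mxE.
  by rewrite dotcC dotc_mull sB.
transitivity (\sum_i (cplx (complex.Re (x 0 i) * u i + complex.Im (x 0 i) * v i)
   + 'i%C * cplx (complex.Im (x 0 i) * u i - complex.Re (x 0 i) * v i))).
  apply: eq_bigr => i _; rewrite e -/(u i) -/(v i).
  case: (x 0 i) => a b /=; apply/eqP; rewrite eq_complex /=.
  by apply/andP; split; apply/eqP; ring.
rewrite big_split /= -mulr_sumr -!rmorph_sum /= sumrB sym subrr rmorph0 mulr0 addr0.
rewrite big_split /=; congr (cplx (_ + _)); apply: eq_bigr => i _; by rewrite [in RHS]mxE.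
Qed.

(** A nonzero vector orthogonal to the eigenvectors of [C] before the i-th one
    and to those of [B] after it exists, since these are m - 1 linear
    conditions; its two Rayleigh quotients separate the i-th eigenvalues. *)
Lemma weyl m (B C : 'M[R]_m) tau : B^T = B -> C^T = C ->
  (forall v, qform (B - C) v <= tau * dotc v v) ->
  forall i, (i < m)%N -> lambda B i <= lambda C i + tau.
Proof.
move=> sB sC hBC k km; pose i0 := Ordinal km.
have [U [UU eU]] := sorted_spectral sB; have [V [VV eV]] := sorted_spectral sC.
have UU' := mulmx1C UU; have VV' := mulmx1C VV.
pose K : 'M[complex R]_m :=
  \matrix_(i, j) (if (j < k)%N then V^t* i j else if (k < j)%N then U^t* i j else 0).
have /eqP/det0P [x x0 xK] : \det K = 0.
  rewrite (expand_det_col _ i0) big1 // => i _.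
  by rewrite mxE /= ltnn mul0r.
have yU (j : 'I_m) : (k < j)%N -> (x *m U^t*) 0 j = 0.
  move=> kj; have /rowP/(_ j) := xK; rewrite !mxE => h; rewrite -[RHS]h.
  apply: eq_bigr => i _; rewrite [K _ _]mxE ltnNge (ltnW kj) /= kj.
  by [].
have yV (j : 'I_m) : (j < k)%N -> (x *m V^t*) 0 j = 0.
  move=> kj; have /rowP/(_ j) := xK; rewrite !mxE => h; rewrite -[RHS]h.
  by apply: eq_bigr => i _; rewrite [K _ _]mxE kj.
pose wt (W : 'M[complex R]_m) i := complex.Re (`|(x *m W^t*) 0 i| ^+ 2).
have wt0 W i : 0 <= wt W i.
  by rewrite /wt -lecR RRe_real ?exprn_ge0 // realX // normr_real.
have form (W : 'M[complex R]_m) D (e : 'I_m -> R) :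
    D = W^t* *m diag_mx (\row_i cplx (e i)) *m W ->
    (x *m D *m x^t*) 0 0 = cplx (\sum_i e i * wt W i).
  move=> ->; set y := x *m W^t*.
  have -> : x *m (W^t* *m diag_mx (\row_i cplx (e i)) *m W) *m x^t* =
      (y *m diag_mx (\row_i cplx (e i))) *m y^t*.
    rewrite /y trmx_mul map_mxM -map_trmx !mulmxA; congr (_ *m _ *m _).
    by apply/matrixP => i j; rewrite !mxE; exact/esym/conjCK.
  rewrite mxE rmorph_sum; apply: eq_bigr => i _.
  rewrite mul_mx_diag mxE [(\row_i _) _ _]mxE [map_mx _ _ _ _]mxE [y^T _ _]mxE.
  rewrite mulrAC -normCK mulrC rmorphM /=.
  by rewrite /wt -/y RRe_real // realX // normr_real.
pose re : 'cV[R]_m := \col_i complex.Re (x 0 i).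
pose im : 'cV[R]_m := \col_i complex.Im (x 0 i).
pose X := dotc re re + dotc im im.
have cI : injective cplx by move=> u v [].
have total W : W^t* *m W = 1%:M -> \sum_i wt W i = X.
  move=> WW; apply: cI; have /form : map_mx cplx 1%:M = W^t* *m diag_mx (\row_i cplx 1) *m W.
    rewrite map_mx1 (_ : \row_i cplx 1 = const_mx 1) ?diag_const_mx ?mulmx1 //.
    by apply/rowP => i; rewrite !mxE.
  rewrite conj_form_real ?trmx1 // /qform !mul1mx => ->.
  by congr cplx; apply: eq_bigr => i _; rewrite mul1r.
have X0 : 0 < X.
  rewrite lt_neqAle addr_ge0 ?dotc_ge0 // andbT; apply: contra x0 => /eqP/esym/eqP.
  rewrite paddr_eq0 ?dotc_ge0 // => /andP[/eqP hre /eqP him].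
  have z (v : 'cV[R]_m) i : dotc v v = 0 -> v i 0 = 0.
    have h0 (j : 'I_m) : true -> 0 <= v j 0 * v j 0 by rewrite -expr2 sqr_ge0.
    by move/(psumr_eq0P h0) => /(_ i isT)/eqP; rewrite mulf_eq0 orbb => /eqP.
  apply/eqP/rowP => i; have := z re i hre; have := z im i him; rewrite !mxE.
  by case: (x 0 i) => a b /= -> ->.
have hB : lambda B k * X <= qform B re + qform B im.
  have := form U _ _ eU; rewrite conj_form_real // => /cI ->.
  rewrite -(total U) // mulr_sumr; apply: ler_sum => i _.
  have [ki|ik] := ltnP k i; first by rewrite /wt yU // normr0 expr0n /= !mulr0.
  by rewrite ler_wpM2r // sorted_lambda.
have hC : qform C re + qform C im <= lambda C k * X.
  have := form V _ _ eV; rewrite conj_form_real // => /cI ->.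
  rewrite -(total V) // mulr_sumr; apply: ler_sum => i _.
  have [ik|ki] := ltnP i k; first by rewrite /wt yV // normr0 expr0n /= !mulr0.
  by rewrite ler_wpM2r // sorted_lambda.
rewrite -(ler_pM2r X0); apply: (le_trans hB).
have := lerD (hBC re) (hBC im); rewrite !qformB -mulrDr -/X; lra.
Qed.

Lemma weyl_dist m (B C : 'M[R]_m) tau : B^T = B -> C^T = C ->
  (forall v, `|qform (B - C) v| <= tau * dotc v v) ->
  forall i, (i < m)%N -> `|lambda B i - lambda C i| <= tau.
Proof.
move=> sB sC h i im; rewrite ler_distl; apply/andP; split; last first.
  by apply: weyl => // v; apply: le_trans (h v); rewrite ler_norm.
rewrite lerBlDr; apply: weyl => // v; apply: le_trans (h v).
by rewrite -opprB qformN; rewrite -normrN ler_norm.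
Qed.

End Weyl.

Section NormBounds.
Context (R : realType).
Implicit Types m : nat.

Lemma dotc_eq0 m (v : 'cV[R]_m) : dotc v v = 0 -> v = 0.
Proof.
move=> v0; apply/colP => i.
have h0 (j : 'I_m) : true -> 0 <= v j 0 * v j 0 by rewrite -expr2 sqr_ge0.
by have /(_ i isT)/eqP := psumr_eq0P h0 v0; rewrite mulf_eq0 orbb mxE => /eqP.
Qed.

Lemma dotc_mulmx_le m n (B : 'M[R]_(m, n)) v :
  dotc (B *m v) (B *m v) <= (\sum_i \sum_j B i j ^+ 2) * dotc v v.
Proof.
rewrite mulr_suml; apply: ler_sum => i _.
have -> : (B *m v) i 0 = dotc (row i B)^T v.
  by rewrite mxE; apply: eq_bigr => j _; rewrite !mxE.
rewrite -expr2; apply: le_trans (cauchy_schwarz _ _) _.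
apply: ler_wpM2r; first exact: dotc_ge0.
by apply: ler_sum => j _; rewrite !mxE expr2.
Qed.

Lemma qform_frobenius m (W : 'M[R]_m) tau : 0 <= tau ->
  \sum_i \sum_j W i j ^+ 2 <= tau ^+ 2 ->
  forall v, `|qform W v| <= tau * dotc v v.
Proof.
move=> t0 h v; rewrite -(ler_pXn2r (n:=2)) ?nnegrE ?mulr_ge0 ?dotc_ge0 //.
rewrite -normrX ger0_norm ?sqr_ge0 //; apply: le_trans (cauchy_schwarz _ _) _.
rewrite exprMn [dotc v v ^+ 2]expr2 mulrA mulrC ler_wpM2r ?dotc_ge0 //.
by apply: le_trans (dotc_mulmx_le _ _) _; rewrite ler_wpM2r ?dotc_ge0.
Qed.

Lemma spectral_norm_qform m (A : 'M[R]_m) M :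
  spectral_norm A <= M -> forall v, qform A v <= M * dotc v v.
Proof.
move=> hM v; have [v0|v0] := eqVneq (dotc v v) 0.
  by rewrite (dotc_eq0 v0) /qform /dotc !big1 ?mulr0 // => i _; rewrite mxE mul0r.
have d0 : 0 < dotc v v by rewrite lt_neqAle eq_sym v0 dotc_ge0.
pose c := (Num.sqrt (dotc v v))^-1; pose u := c *: v.
have c2 : c ^+ 2 * dotc v v = 1.
  by rewrite /c exprVn sqr_sqrtr ?dotc_ge0 // mulVf.
have du : dotc u u = 1 by rewrite dotcZr dotcC dotcZr mulrA -expr2.
have l2 (w : 'cV[R]_m) : l2norm w = Num.sqrt (dotc w w).
  by congr Num.sqrt; apply: eq_bigr => i _; rewrite expr2.
have Au : l2norm (A *m u) <= M.
  apply: le_trans hM; apply: sup_upper_bound; last first.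
    by exists u => //; rewrite l2 du sqrtr1.
  split; first by exists (l2norm (A *m u)), u => //; rewrite l2 du sqrtr1.
  exists (Num.sqrt (\sum_i \sum_j A i j ^+ 2)) => _ [w hw ->].
  rewrite l2 ler_wsqrtr //; apply: le_trans (dotc_mulmx_le _ _) _.
  rewrite ler_piMr //; first by apply: sumr_ge0 => i _; apply: sumr_ge0 => j _; exact: sqr_ge0.
  by move: hw; rewrite l2 -{1}sqrtr1 ler_sqrt.
have M0 : 0 <= M by apply: le_trans Au; exact: sqrtr_ge0.
have qu : qform A u <= M.
  apply: le_trans (ler_norm _) _; rewrite -(ler_pXn2r (n:=2)) ?nnegrE //.
  rewrite -normrX ger0_norm ?sqr_ge0 //; apply: le_trans (cauchy_schwarz _ _) _.
  rewrite du mul1r -[X in X <= _]sqr_sqrtr ?dotc_ge0 // -l2.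
  by rewrite ler_pXn2r // nnegrE sqrtr_ge0.
have e : qform A u = c ^+ 2 * qform A v.
  by rewrite /qform -scalemxAr dotcZr dotcC dotcZr dotcC mulrA -expr2.
have c0 : 0 < c ^+ 2 by rewrite exprn_gt0 // invr_gt0 sqrtr_gt0.
by rewrite -(ler_pM2l c0) -e mulrCA c2 mulr1.
Qed.

Lemma posdef_qform_ge0 m (A : 'M[R]_m) v : posdefmx A -> 0 <= qform A v.
Proof.
move=> [_ pA]; have [->|/pA] := eqVneq v 0; last by rewrite qformE => /ltW.
by rewrite /qform /dotc big1 // => i _; rewrite mxE mul0r.
Qed.

Lemma posdef_diag_bound m (A : 'M[R]_m) M i :
  posdefmx A -> spectral_norm A <= M -> 0 <= A i i <= M.
Proof.
move=> pA hM; have := spectral_norm_qform hM (delta_mx i 0).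
have := posdef_qform_ge0 (delta_mx i 0) pA.
have -> : qform A (delta_mx i 0) = A i i.
  rewrite /qform /dotc (bigD1 i) //= big1 ?addr0.
    by rewrite -colE !mxE !eqxx mul1r.
  by move=> j /negbTE ji; rewrite mxE ji mul0r.
have -> : dotc (delta_mx i 0) (delta_mx i 0) = 1 :> R.
  rewrite /dotc (bigD1 i) //= big1 ?addr0; first by rewrite !mxE !eqxx mul1r.
  by move=> j /negbTE ji; rewrite mxE ji mul0r.
by rewrite mulr1 => -> ->.
Qed.

Lemma qform_diag m (h : 'rV[R]_m) v : qform (diag_mx h) v = \sum_i h 0 i * v i 0 ^+ 2.
Proof.
by apply: eq_bigr => i _; rewrite mul_diag_mx mxE mulrCA expr2.
Qed.

Lemma qform_diag_bound m (h : 'rV[R]_m) tau :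
  (forall i, `|h 0 i| <= tau) -> forall v, `|qform (diag_mx h) v| <= tau * dotc v v.
Proof.
move=> ht v; rewrite qform_diag; apply: le_trans (ler_norm_sum _ _ _) _.
rewrite mulr_sumr; apply: ler_sum => i _.
by rewrite -expr2 normrM [`|_ ^+ 2|]ger0_norm ?sqr_ge0 // ler_wpM2r ?sqr_ge0.
Qed.

Lemma qform_sqrtmx m (A W : 'M[R]_m) M tau :
  posdefmx A -> spectral_norm A <= M -> 0 <= tau ->
  (forall v, `|qform W v| <= tau * dotc v v) ->
  forall v, `|qform (sqrtmx A *m W *m sqrtmx A) v| <= M * tau * dotc v v.
Proof.
move=> pA hM t0 hW v; have [[sQ _] QQ] := sqrtmxP pA.
rewrite qform_sandwich //; apply: le_trans (hW _) _.
rewrite dotc_mull sQ mulmxA QQ -/(qform A v) [M * tau]mulrC -mulrA ler_wpM2l //.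
exact: spectral_norm_qform.
Qed.

(** Once the small entries of [h] are dropped, the support of [h] meets no
    nonzero off-diagonal entry of [A], and cycling the projection onto this
    support through the characteristic polynomial removes them all. *)
Lemma char_poly_sparse_diag m (A : 'M[R]_m) (h : 'rV[R]_m) : posdefmx A ->
  (forall i j, i != j -> A i j != 0 -> h 0 i = 0 \/ h 0 j = 0) ->
  char_poly (sqrtmx A *m diag_mx h *m sqrtmx A) =
  char_poly (diag_mx h *m diag_part A).
Proof.
move=> pA hA; have [_ QQ] := sqrtmxP pA.
pose P : 'M[R]_m := diag_mx (\row_i (h 0 i != 0)%:R).
have Ph : P *m diag_mx h = diag_mx h.
  rewrite mulmx_diag; congr diag_mx; apply/rowP => i; rewrite !mxE.
  by case: eqVneq => [->|]; rewrite ?mulr0 ?mul1r.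
rewrite -mulmxA char_poly_mulmxC -mulmxA QQ -{1}Ph -mulmxA char_poly_mulmxC.
congr char_poly; rewrite mul_mx_diag mul_diag_mx mulmx_diag.
apply/matrixP => i j; rewrite !mxE.
have [<-|ij] := eqVneq i j; first by rewrite mulr1n; case: eqVneq => [->|]; rewrite ?mul0r ?mulr1.
rewrite mulr0n; have [->|Aij] := eqVneq (A i j) 0; first by rewrite mulr0 mul0r.
by have [->|->] := hA _ _ ij Aij; rewrite ?mul0r // eqxx mulr0.
Qed.

Lemma bigmax_le m (F : 'I_m -> R) c : 0 <= c -> (forall i, F i <= c) ->
  \big[Num.max/0]_(i < m) F i <= c.
Proof. by move=> c0 hF; elim/big_ind: _ => // x y; rewrite ge_max => -> ->. Qed.

(** Deterministic core: the off-diagonal part [W] and the small entries of [h]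
    are perturbations handled by Weyl's inequality, and the large entries of
    [h] contribute exactly the eigenvalues of [diag h * diag A]. *)
Lemma max_eigen_gap_bound m (A W : 'M[R]_m) (h : 'rV[R]_m) M tau tau' :
  posdefmx A -> spectral_norm A <= M -> W^T = W -> 0 <= tau -> 0 <= tau' -> 0 <= M ->
  (forall v, `|qform W v| <= tau * dotc v v) ->
  (forall i j, i != j -> A i j != 0 -> `|h 0 i| <= tau' \/ `|h 0 j| <= tau') ->
  max_eigen_gap (sqrtmx A *m (W + diag_mx h) *m sqrtmx A)
                (diag_mx h *m diag_part A) <= M * (tau + tau' *+ 2).
Proof.
move=> pA hM sW t0 t0' M0 hW hA; have [[sQ _] QQ] := sqrtmxP pA.
pose ht : 'rV[R]_m := \row_i (if `|h 0 i| <= tau' then 0 else h 0 i).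
pose hr : 'rV[R]_m := \row_i (if `|h 0 i| <= tau' then h 0 i else 0).
have hE : h = ht + hr.
  by apply/rowP => i; rewrite !mxE; case: ifP; rewrite ?addr0 ?add0r.
have hrb i : `|hr 0 i| <= tau' by rewrite mxE; case: ifP; rewrite ?normr0.
have tp : char_poly (sqrtmx A *m diag_mx ht *m sqrtmx A) =
    char_poly (diag_mx ht *m diag_part A).
  apply: char_poly_sparse_diag => // i j ij Aij.
  by have [hi|hj] := hA i j ij Aij; rewrite !mxE ?hi ?hj; [left|right].
have symS (D : 'M[R]_m) : D^T = D -> (sqrtmx A *m D *m sqrtmx A)^T = sqrtmx A *m D *m sqrtmx A.
  by move=> sD; rewrite !trmx_mul sQ sD mulmxA.
have symD (k : 'rV[R]_m) : (diag_mx k *m diag_part A)^T = diag_mx k *m diag_part A.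
  by rewrite /diag_part mulmx_diag tr_diag_mx.
apply: bigmax_le => [|i]; first by rewrite mulr_ge0 // addr_ge0 // mulrn_wge0.
set l1 := lambda _ i; set l2 := lambda _ i.
pose lt1 := lambda (sqrtmx A *m diag_mx ht *m sqrtmx A) i.
pose lt2 := lambda (diag_mx ht *m diag_part A) i.
have e12 : lt1 = lt2 by rewrite /lt1 /lt2 /lambda (eigenvalues_char_poly tp).
have d1 : `|l1 - lt1| <= M * (tau + tau').
  apply: weyl_dist; [|by apply: symS; exact: tr_diag_mx|move=> v|exact: ltn_ord].
    by apply: symS; rewrite linearD /= tr_diag_mx sW.
  rewrite -mulmxBl -mulmxBr hE [diag_mx (_ + _)]linearD /= addrCA [_ + (_ + _)]addrC addrK.
  apply: (qform_sqrtmx pA hM (addr_ge0 t0 t0')) => w.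
  rewrite qformD mulrDl; apply: le_trans (ler_normD _ _) _.
  by apply: (lerD (hW w)); exact: (qform_diag_bound hrb).
have d2 : `|l2 - lt2| <= M * tau'.
  apply: weyl_dist; [exact: symD|exact: symD|move=> v|exact: ltn_ord].
  rewrite -mulmxBl hE [diag_mx (_ + _)]linearD /= addrC addKr /diag_part mulmx_diag.
  apply: qform_diag_bound => j; rewrite mxE normrM mulrC [(\row_i A i i) _ _]mxE.
  have /andP[Aj0 AjM] := posdef_diag_bound j pA hM.
  by apply: (ler_pM (normr_ge0 _) (normr_ge0 _) _ (hrb j)); rewrite ger0_norm.
have -> : l1 - l2 = (l1 - lt1) - (l2 - lt2) by rewrite e12; ring.
apply: le_trans (ler_normB _ _) _; apply: le_trans (lerD d1 d2) _.
by rewrite -mulrDr mulr2n addrA.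
Qed.

Lemma max_eigen_gap_ge0 m (B C : 'M[R]_m) : 0 <= max_eigen_gap B C.
Proof. by rewrite /max_eigen_gap; elim/big_ind: _ => // x y hx hy; rewrite le_max hx. Qed.

(** Ring powers only exist on square matrices of size [m.+1]. *)
Definition mxpow m (M : 'M[R]_m) k : 'M[R]_m := iter k (mulmx M) 1%:M.

Lemma mxpowD m (M : 'M[R]_m) k l : mxpow M (k + l) = mxpow M k *m mxpow M l.
Proof.
elim: k => [|k IH]; first by rewrite mul1mx.
by rewrite addSn /mxpow !iterS -!/(mxpow _ _) IH mulmxA.
Qed.

Lemma tr_mxpow m (M : 'M[R]_m) k : M^T = M -> (mxpow M k)^T = mxpow M k.
Proof.
move=> sM; elim: k => [|k IH]; first exact: trmx1.
have e : mxpow M k.+1 = mxpow M k *m M.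
  by rewrite -addn1 mxpowD {2}/mxpow /= mulmx1.
by rewrite [in LHS]e trmx_mul IH sM.
Qed.

(** Iterating Cauchy--Schwarz on [dotc v (M^k v)] bounds a quadratic form by
    the trace of a high power, without diagonalizing. *)
Lemma qform_trace m (M : 'M[R]_m) j tau : M^T = M -> 0 <= tau ->
  \tr (mxpow M (2 ^ j.+1)) <= tau ^+ (2 ^ j.+1) ->
  forall v, `|qform M v| <= tau * dotc v v.
Proof.
move=> sM t0 hT v; pose c k := dotc v (mxpow M k *m v); pose d := dotc v v.
have d0 : 0 <= d := dotc_ge0 v.
have mM k u w : dotc (mxpow M k *m u) w = dotc u (mxpow M k *m w).
  by rewrite dotc_mull tr_mxpow.
have cs k : c k ^+ 2 <= d * c (k + k)%N.
  apply: le_trans (cauchy_schwarz _ _) _.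
  by rewrite mM mulmxA -mxpowD.
have it l : `|c 1%N| ^+ (2 ^ l) <= d ^+ (2 ^ l).-1 * `|c (2 ^ l)%N|.
  elim: l => [|l IH]; first by rewrite expn0 expr1 expr0 mul1r.
  have := expn_gt0 2 l; rewrite expnS mul2n -addnn; move: IH; set q := (2 ^ l)%N.
  move=> IH; rewrite lt0n => q0.
  have : (`|c 1%N| ^+ q) ^+ 2 <= (d ^+ q.-1 * `|c q|) ^+ 2.
    by rewrite ler_pXn2r // nnegrE ?exprn_ge0 // mulr_ge0 // exprn_ge0.
  rewrite -exprM muln2 -addnn => /le_trans; apply.
  rewrite exprMn -normrX [X in _ * X]ger0_norm ?sqr_ge0 //.
  apply: (@le_trans _ _ ((d ^+ q.-1) ^+ 2 * (d * c (q + q)%N))).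
    by rewrite ler_wpM2l // exprn_ge0 // exprn_ge0.
  rewrite mulrA -exprM -exprSr.
  have -> : ((q.-1 * 2).+1 = (q + q).-1)%N.
    by case: (q) q0 => // k _; rewrite muln2 -addnn /= addnS.
  by rewrite ler_wpM2l ?ler_norm // exprn_ge0.
have top : c (2 ^ j.+1)%N <= d * \tr (mxpow M (2 ^ j.+1)).
  rewrite expnS mul2n -addnn /c mxpowD -mulmxA -mM.
  apply: le_trans (dotc_mulmx_le _ _) _; rewrite mulrC ler_wpM2l //.
  rewrite le_eqVlt; apply/orP; left; apply/eqP; apply: eq_bigr => i _.
  rewrite mxE; apply: eq_bigr => k _; rewrite expr2; congr (_ * _).
  by rewrite -[in LHS](tr_mxpow _ sM) mxE.
have ctop : 0 <= c (2 ^ j.+1)%N.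
  by rewrite expnS mul2n -addnn /c mxpowD -mulmxA -mM dotc_ge0.
have c1 : qform M v = c 1%N by rewrite /c /mxpow /= mulmx1.
rewrite c1 -(ler_pXn2r (n := 2 ^ j.+1)) ?expn_gt0 ?nnegrE ?mulr_ge0 //.
apply: le_trans (it _) _; rewrite ger0_norm //.
apply: (@le_trans _ _ (d ^+ (2 ^ j.+1).-1 * (d * tau ^+ (2 ^ j.+1)))).
  rewrite ler_wpM2l ?exprn_ge0 //; apply: le_trans top _.
  by rewrite ler_wpM2l.
by rewrite mulrA -exprSr prednK ?expn_gt0 // mulrC -exprMn.
Qed.

End NormBounds.

(** * Measurability of the eigenvalue gap *)

Section Measurability.
Context (R : realType).

Lemma lambda_lipschitz m (B C : 'M[R]_m) i : B^T = B -> C^T = C -> (i < m)%N ->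
  `|lambda B i - lambda C i| <= \sum_k \sum_l `|B k l - C k l|.
Proof.
move=> sB sC im; apply: weyl_dist => // v; apply: qform_frobenius.
  by apply: sumr_ge0 => k _; apply: sumr_ge0.
have sq (I : finType) (F G : I -> R) : (forall i, 0 <= F i) -> (forall i, 0 <= G i) ->
    (forall i, G i <= F i ^+ 2) -> \sum_i G i <= (\sum_i F i) ^+ 2.
  move=> F0 G0 GF; have S0 : 0 <= \sum_i F i by apply: sumr_ge0.
  rewrite expr2 mulr_suml; apply: ler_sum => j _; apply: (le_trans (GF j)).
  by rewrite expr2 ler_wpM2l // (bigD1 j) //= lerDl sumr_ge0.
apply: (sq) => [k|k|k]; first by apply: sumr_ge0.
  by apply: sumr_ge0 => l _; exact: sqr_ge0.
apply: (sq) => [l|l|l] //; first exact: sqr_ge0.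
by rewrite !mxE -normrX ler_norm.
Qed.

Context d (T : measurableType d).

(** A function of a matrix that is Lipschitz in the entries is the supremum of
    countably many functions built from its values at rational matrices. *)
Lemma measurable_lipschitz_mx m n (g : 'M[R]_(m, n) -> R) (M : T -> 'M[R]_(m, n)) :
  (forall B C, `|g B - g C| <= \sum_k \sum_l `|B k l - C k l|) ->
  (forall k l, measurable_fun setT (fun w => M w k l)) ->
  measurable_fun setT (fun w => g (M w)).
Proof.
move=> gL mM mT; apply: (measurability _ (RGenOInfty.measurableE R)) => // _ [_ [x ->] <-].
rewrite setTI.
pose l1 (Q : 'M[rat]_(m, n)) w := \sum_k \sum_l `|M w k l - ratr (Q k l)|.
pose F (c : nat) : set T :=
  match @unpickle ('M[rat]_(m, n) * rat)%type c with
  | Some (Q, r) => [set w | l1 Q w < ratr r /\ x + ratr r < g (map_mx ratr Q)]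
  | None => set0 end.
have -> : (fun w => g (M w)) @^-1` `]x, +oo[%classic = \bigcup_c F c.
  apply/seteqP; split => w /=; rewrite in_itv /= andbT; last first.
    case=> c _; rewrite /F; case: unpickle => // -[Q r] [h1 h2].
    have := gL (map_mx ratr Q) (M w); rewrite ler_distl => /andP[_].
    move=> /(le_trans (ltW h2)).
    have -> : \sum_k \sum_l `|(map_mx ratr Q) k l - M w k l| = l1 Q w.
      by apply: eq_bigr => k _; apply: eq_bigr => l _; rewrite mxE distrC.
    have := gL (map_mx ratr Q) (M w); rewrite ler_distl => /andP[_].
    have -> : \sum_k \sum_l `|(map_mx ratr Q) k l - M w k l| = l1 Q w.
      by apply: eq_bigr => k _; apply: eq_bigr => l _; rewrite mxE distrC.
    by move: h1 h2; lra.
  move=> xg; pose e := (g (M w) - x) / 2.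
  have e0 : 0 < e by rewrite divr_gt0 // subr_gt0.
  have [r /= rI] : exists r : rat, ratr r \in `]0, e[ by exact: rat_in_itvoo.
  move: rI; rewrite in_itv /= => /andP[r0 re].
  pose eta := (ratr r : R) / (m * n).+1%:R.
  have eta0 : 0 < eta by rewrite divr_gt0.
  have hQ kl : exists q : rat, `|M w kl.1 kl.2 - ratr q| < eta.
    have [q] : exists q : rat, ratr q \in `]M w kl.1 kl.2 - eta, M w kl.1 kl.2 + eta[.
      by apply: rat_in_itvoo; lra.
    rewrite in_itv /= => h; exists q; rewrite ltr_distlC //.
  have [q hq] := choice hQ.
  pose Q : 'M[rat]_(m, n) := \matrix_(k, l) q (k, l).
  have hl : l1 Q w < ratr r.
    apply: (@le_lt_trans _ _ (\sum_(k < m) \sum_(l < n) eta)).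
      by apply: ler_sum => k _; apply: ler_sum => l _; rewrite mxE ltW // (hq (k, l)).
    rewrite !sumr_const !card_ord -mulrnA mulnC -mulr_natr /eta mulrAC.
    by rewrite ltr_pdivrMr // ltr_pM2l // ltr_nat ltnS.
  exists (pickle (Q, r)) => //; rewrite /F pickleK; split => //.
  have := gL (map_mx ratr Q) (M w).
  have -> : \sum_k \sum_l `|(map_mx ratr Q) k l - M w k l| = l1 Q w.
    by apply: eq_bigr => k _; apply: eq_bigr => l _; rewrite mxE distrC.
  rewrite ler_distl => /andP[+ _]; move: hl re; rewrite /e; lra.
apply: bigcupT_measurable => c; rewrite /F; case: unpickle => [[Q r]|] //.
have [h|h] := pselect (x + ratr r < g (map_mx ratr Q)); last first.
  rewrite (_ : [set w | _] = set0) //.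
  by apply/seteqP; split => w //= -[].
rewrite (_ : [set w | _] = (l1 Q) @^-1` `]-oo, ratr r[%classic); last first.
  by apply/seteqP; split => w /=; rewrite in_itv /=; [case|].
rewrite -[X in measurable X]setTI.
have : measurable_fun setT (l1 Q); last by apply => //; exact: measurable_itv.
apply: measurable_sum => k; apply: measurable_sum => l.
apply: measurableT_comp => //; apply: measurable_funB => //.
Qed.

(** Eigenvalues are meaningful on symmetric matrices only; composing with the
    symmetrization gives a function that is Lipschitz everywhere. *)
Lemma measurable_lambda m (M : T -> 'M[R]_m) i : (i < m)%N ->
  (forall w, (M w)^T = M w) ->
  (forall k l, measurable_fun setT (fun w => M w k l)) ->
  measurable_fun setT (fun w => lambda (M w) i).
Proof.
move=> im sM mM; pose s (C : 'M[R]_m) := 2^-1 *: (C + C^T).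
have ss C : (s C)^T = s C by rewrite /s linearZ /= linearD /= trmxK addrC.
have e w : M w = s (M w).
  by rewrite /s sM -[M w + M w]mulr2n -[M w *+ 2]scaler_nat scalerA mulVf ?scale1r ?pnatr_eq0.
rewrite (_ : (fun w => _) = fun w => lambda (s (M w)) i); last first.
  by apply/funext => w; rewrite -e.
apply: (measurable_lipschitz_mx (g := fun C => lambda (s C) i)) => // B C.
apply: le_trans (lambda_lipschitz _ _ im) _; rewrite ?ss //.
have -> : \sum_k \sum_l `|B k l - C k l| =
    \sum_k \sum_l 2^-1 * (`|B k l - C k l| + `|B l k - C l k|).
  rewrite [in RHS](eq_bigr (fun k => 2^-1 * \sum_l `|B k l - C k l| +
     2^-1 * \sum_l `|B l k - C l k|)); last first.
    by move=> k _; rewrite -mulr_sumr big_split mulrDr.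
  rewrite big_split -!mulr_sumr /= [X in _ + _ * X]exchange_big /=.
  by rewrite -mulrDl -[X in X + X]div1r -splitr mul1r.
apply: ler_sum => k _; apply: ler_sum => l _; rewrite !mxE.
rewrite -mulrBr normrM ger0_norm ?invr_ge0 // ler_wpM2l ?invr_ge0 //.
by apply: le_trans (ler_normD _ _); rewrite [X in `|X|](_ : _ = B k l - C k l + (B l k - C l k)) //; ring.
Qed.

Lemma measurable_max_eigen_gap m (M N : T -> 'M[R]_m) :
  (forall w, (M w)^T = M w) -> (forall w, (N w)^T = N w) ->
  (forall k l, measurable_fun setT (fun w => M w k l)) ->
  (forall k l, measurable_fun setT (fun w => N w k l)) ->
  measurable_fun setT (fun w => max_eigen_gap (M w) (N w)).
Proof.
move=> sM sN mM mN.
rewrite /max_eigen_gap.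
elim: (index_enum 'I_m) => [|i s IH].
  by rewrite (_ : (fun w => _) = cst 0) //; apply/funext => w; rewrite big_nil.
rewrite (_ : (fun w => _) = (fun w => Num.max `|lambda (M w) i - lambda (N w) i|
   (\big[Num.max/0]_(j <- s) `|lambda (M w) j - lambda (N w) j|))).
  apply: measurable_maxr => //; apply: measurableT_comp => //.
  by apply: measurable_funB; apply: measurable_lambda.
by apply/funext => w; rewrite big_cons.
Qed.

Lemma measurable_mulmx m n k (M : T -> 'M[R]_(m, n)) (N : T -> 'M[R]_(n, k)) :
  (forall i j, measurable_fun setT (fun w => M w i j)) ->
  (forall i j, measurable_fun setT (fun w => N w i j)) ->
  forall i j, measurable_fun setT (fun w => (M w *m N w) i j).
Proof.
move=> mM mN i j; rewrite (_ : (fun w => _) = fun w => \sum_l M w i l * N w l j).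
  by apply: measurable_sum => l; exact: measurable_funM.
by apply/funext => w; rewrite mxE.
Qed.

End Measurability.

(** * Expectations and independence *)

Section Expectation.
Context (R : realType) d (T : measurableType d) (P : probability T R).
Implicit Types (f g : T -> R).

Definition integ f := P.-integrable setT (EFin \o f).
Definition Ex f : R := \int[P]_x f x.

Lemma integ_measurable f : integ f -> measurable_fun setT f.
Proof. by move=> /integrableP[/measurable_EFinP]. Qed.

Lemma Ex_EFin f : integ f -> (\int[P]_x (f x)%:E)%E = (Ex f)%:E.
Proof. by move=> hf; rewrite /Ex /Rintegral fineK // integrable_fin_num. Qed.

Lemma integ_le f g : measurable_fun setT f -> integ g ->
  (forall w, `|f w| <= `|g w|) -> integ f.
Proof.
move=> mf ig h; apply: le_integrable ig => //; first exact/measurable_EFinP.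
by move=> w _ /=; rewrite lee_fin h.
Qed.

Lemma integ_cst c : integ (fun=> c).
Proof. exact: finite_measure_integrable_cst. Qed.

Lemma integ_bounded f c : measurable_fun setT f -> (forall w, `|f w| <= c) -> integ f.
Proof.
move=> mf h; apply: (integ_le mf (integ_cst c)) => w.
by apply: le_trans (h w) _; exact: ler_norm.
Qed.

Lemma integD f g : integ f -> integ g -> integ (fun w => f w + g w).
Proof. by move=> hf hg; have := integrableD measurableT hf hg. Qed.

Lemma integZ c f : integ f -> integ (fun w => c * f w).
Proof. by move=> hf; have := integrableZl measurableT c hf. Qed.

Lemma integB f g : integ f -> integ g -> integ (fun w => f w - g w).
Proof. by move=> hf hg; have := integrableB measurableT hf hg. Qed.

Lemma integ_sum I (s : seq I) (Q : pred I) (h : I -> T -> R) :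
  (forall i, Q i -> integ (h i)) -> integ (fun w => \sum_(i <- s | Q i) h i w).
Proof.
move=> hi; rewrite /integ (_ : _ \o _ = fun w => (\sum_(i <- s | Q i) (h i w)%:E)%E).
  by apply: integrable_sum => // i Qi; exact: hi.
by apply/funext => w /=; rewrite sumEFin.
Qed.

Lemma integ_norm f : integ f -> integ (fun w => `|f w|).
Proof. by move=> hf; have := integrable_norm hf. Qed.

Lemma ExD f g : integ f -> integ g -> Ex (fun w => f w + g w) = Ex f + Ex g.
Proof. by move=> hf hg; exact: RintegralD. Qed.

Lemma ExB f g : integ f -> integ g -> Ex (fun w => f w - g w) = Ex f - Ex g.
Proof. by move=> hf hg; exact: RintegralB. Qed.

Lemma ExZ c f : integ f -> Ex (fun w => c * f w) = c * Ex f.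
Proof. by move=> hf; exact: RintegralZl. Qed.

Lemma Ex_cst c : Ex (fun=> c) = c.
Proof. by rewrite /Ex Rintegral_cst //= probability_setT mulr1. Qed.

Lemma Ex_sum I (s : seq I) (Q : pred I) (h : I -> T -> R) :
  (forall i, Q i -> integ (h i)) ->
  Ex (fun w => \sum_(i <- s | Q i) h i w) = \sum_(i <- s | Q i) Ex (h i).
Proof.
move=> hi; elim: s => [|i s IH].
  rewrite big_nil (_ : (fun w => _) = cst 0) ?Ex_cst //.
  by apply/funext => w; rewrite big_nil.
rewrite big_cons -IH; case: ifPn => Qi.
  rewrite -ExD; [|exact: hi|exact: integ_sum].
  by congr Ex; apply/funext => w; rewrite big_cons Qi.
by congr Ex; apply/funext => w; rewrite big_cons (negbTE Qi).
Qed.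

Lemma le_Ex f g : integ f -> integ g -> (forall w, f w <= g w) -> Ex f <= Ex g.
Proof. by move=> hf hg h; exact: le_Rintegral. Qed.

Lemma Ex_ge0 f : (forall w, 0 <= f w) -> 0 <= Ex f.
Proof. by move=> h; exact: Rintegral_ge0. Qed.

Lemma norm_Ex f : integ f -> `|Ex f| <= Ex (fun w => `|f w|).
Proof. by move=> hf; exact: le_normr_Rintegral. Qed.

Lemma Ex_eq f g : (forall w, f w = g w) -> Ex f = Ex g.
Proof. by move=> h; congr Ex; apply/funext. Qed.

Lemma Ex_indic A : measurable A -> Ex \1_A = fine (P A).
Proof. by move=> mA; rewrite /Ex /Rintegral integral_indic // setIT. Qed.

Lemma integ_indic A : measurable A -> integ (\1_A : T -> R).
Proof.
move=> mA; apply: (@integ_bounded _ 1); first exact: measurable_indic.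
by move=> w; rewrite indicE; case: (_ \in _); rewrite ?normr0 ?normr1.
Qed.

Lemma markov_Ex f c : integ f -> (forall w, 0 <= f w) -> 0 < c ->
  (P [set w | (c <= f w)%R] <= (Ex f / c)%:E)%E.
Proof.
move=> hf f0 c0; have mf := integ_measurable hf.
have mA : measurable [set w | (c <= f w)%R].
  by rewrite -[X in measurable X]setTI; exact: measurable_fun_ler.
rewrite -[X in (X <= _)%E]fineK ?fin_num_measure // lee_fin ler_pdivlMr // mulrC.
rewrite -Ex_indic // -ExZ; last exact: integ_indic.
apply: le_Ex => [|//|w]; first exact/integZ/integ_indic.
rewrite indicE; case: (boolP (w \in _)) => [|_]; last by rewrite mulr0.
by rewrite inE /= mulr1.
Qed.

Lemma markov_Ex_lt f c : integ f -> (forall w, 0 <= f w) -> 0 < c ->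
  (P [set w | (c < f w)%R] <= (Ex f / c)%:E)%E.
Proof.
move=> hf f0 c0; apply: le_trans (markov_Ex hf f0 c0).
have mf := integ_measurable hf.
apply: le_measure; rewrite ?inE.
- by rewrite -[X in measurable X]setTI; exact: measurable_fun_ltr.
- by rewrite -[X in measurable X]setTI; exact: measurable_fun_ler.
- by move=> w /ltW.
Qed.

Lemma measurable_gt f c : measurable_fun setT f -> measurable [set w | c < f w].
Proof. by move=> mf; rewrite -[X in measurable X]setTI; exact: measurable_fun_ltr. Qed.

End Expectation.

Section Independence.
Context (R : realType) d (T : measurableType d) (P : probability T R).

(** As functions of [A], both sides are finite measures that agree on a
    pi-system. *)
Lemma indep_pi_system (G : set (set T)) (B : set T) :
  setI_closed G -> G `<=` measurable -> measurable B ->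
  (forall A, G A -> P (A `&` B) = (P A * P B)%E) ->
  forall A, <<s G >> A -> P (A `&` B) = (P A * P B)%E.
Proof.
move=> GI Gm mB GB A sA.
have fB : P B \is a fin_num by exact: fin_num_measure.
pose G' := G `|` [set setT].
have G'm : G' `<=` measurable by move=> X [/Gm//|->]; exact: measurableT.
have G'I : setI_closed G'.
  move=> X Y [GX|->] [GY|->]; rewrite ?setTI ?setIT.
  - by left; exact: GI.
  - by left.
  - by left.
  - by right.
have PB0 : 0 <= fine (P B) by exact: fine_ge0.
have e A' : (P A' * P B)%E = mscale (NngNum PB0) P A'.
  by rewrite /mscale /= fineK // muleC.
rewrite e; apply: (g_sigma_algebra_measure_unique G' G'm (fun=> setT) _ _
   (mrestr P mB) (mscale (NngNum PB0) P) G'I).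
- by move=> _; right.
- by rewrite bigcup_const.
- move=> A' [/GB h|->]; first exact: etrans h (e _).
  apply: (etrans _ (e _)); rewrite probability_setT mul1e.
  by rewrite -[in RHS](setTI B).
- move=> _; apply: (@le_lt_trans _ _ (P B)); last by rewrite -ge0_fin_numE.
  by rewrite -[X in (_ <= P X)%E](setTI B).
- by move: sA; apply: sub_smallest2r; [exact: smallest_sigma_algebra|move=> X GX; left].
Qed.

Lemma sigma_gen_measurable (I : Type) (X : I -> {RV P >-> R}) J :
  sigma_gen (fun i => X i : T -> R) J `<=` measurable.
Proof.
apply: smallest_sub; first exact: sigma_algebra_measurable.
by move=> _ [i [B [_ mB ->]]]; rewrite -[X in measurable X]setTI; exact: measurable_funPT.
Qed.

Lemma sigma_genI (U I : Type) (X : I -> U -> R) (J : set I) :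
  setI_closed (sigma_gen X J).
Proof.
have sa := smallest_sigma_algebra setT
  [set E | exists i (B : set R), [/\ J i, measurable B & E = X i @^-1` B]].
by have /sigma_algebraP[] := sa.
Qed.

Lemma sigma_genT (U I : Type) (X : I -> U -> R) (J : set I) : sigma_gen X J setT.
Proof.
have sa := smallest_sigma_algebra setT
  [set E | exists i (B : set R), [/\ J i, measurable B & E = X i @^-1` B]].
by have /sigma_algebraP[] := sa.
Qed.

End Independence.

Section Grouping.
Context (R : realType) d (T : measurableType d) (P : probability T R).

Lemma sigma_sub_measurable (G : set (set T)) : G `<=` measurable -> <<s G >> `<=` measurable.
Proof. by apply: smallest_sub; exact: sigma_algebra_measurable. Qed.

(** The pi-lambda argument is applied to one factor at a time. *)
Lemma independent_generated (G H : set (set T)) :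
  setI_closed G -> setI_closed H -> G `<=` measurable -> H `<=` measurable ->
  (forall A B, G A -> H B -> P (A `&` B) = (P A * P B)%E) ->
  independent P <<s G >> <<s H >>.
Proof.
move=> GI HI Gm Hm GH A B sA sB.
rewrite setIC muleC; apply: (indep_pi_system HI Hm _ _ sB) => [|C HC].
  exact: (sigma_sub_measurable Gm).
rewrite setIC muleC; apply: (indep_pi_system GI Gm _ _ sA) => [|D GD]; first exact: Hm.
exact: GH.
Qed.

Lemma independent_sub (F G F' G' : set (set T)) : F' `<=` F -> G' `<=` G ->
  independent P F G -> independent P F' G'.
Proof. by move=> hF hG h A B /hF FA /hG GB; exact: h. Qed.

Context (I : eqType).
Implicit Types (s : seq I) (E : I -> set T) (F : I -> set (set T)) (J K : set I).

Lemma bigsetI_seq s E : \big[setI/setT]_(i <- s) E i = [set w | forall i, i \in s -> E i w].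
Proof.
elim: s => [|i s IH]; first by rewrite big_nil; apply/seteqP; split.
rewrite big_cons IH; apply/seteqP; split => w /=.
  by case=> Ei h j; rewrite inE => /predU1P[->|]//; exact: h.
move=> h; split; first by apply: h; rewrite inE eqxx.
by move=> j js; apply: h; rewrite inE js orbT.
Qed.

(** A pi-system generating the joint sigma-algebra of the [F i], [i] in [J]. *)
Definition cylinders F J : set (set T) := [set A | exists s E, uniq s /\
  (forall i, i \in s -> J i /\ F i (E i)) /\ A = \big[setI/setT]_(i <- s) E i].

Lemma cylinders_setI F J : (forall i, setI_closed (F i)) -> (forall i, F i setT) ->
  setI_closed (cylinders F J).
Proof.
move=> FI FT _ _ [s [E [us [hs ->]]]] [s' [E' [us' [hs' ->]]]].
exists (undup (s ++ s')), (fun i => (if i \in s then E i else setT) `&`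
  (if i \in s' then E' i else setT)); split; first exact: undup_uniq.
split.
  move=> i; rewrite mem_undup mem_cat => h; split.
    by case/orP: h => [/hs[]|/hs'[]].
  by apply: FI; [case: ifP => [/hs[]|_]//|case: ifP => [/hs'[]|_]//].
rewrite !bigsetI_seq; apply/seteqP; split => w /=.
  case=> h h' i _; split; first by case: ifP => // /h.
  by case: ifP => // /h'.
move=> h; split => i si.
  have := h i; rewrite mem_undup mem_cat si => /(_ isT)[] //.
by have := h i; rewrite mem_undup mem_cat si orbT => /(_ isT)[].
Qed.

Lemma cylinders_measurable F J : (forall i, F i `<=` measurable) ->
  cylinders F J `<=` measurable.
Proof.
move=> Fm _ [s [E [_ [h ->]]]]; elim: s h => [|i s IH] h.
  by rewrite big_nil; exact: measurableT.
rewrite big_cons; apply: measurableI.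
  by apply: (Fm i); case: (h i _) => //; rewrite inE eqxx.
by apply: IH => j js; apply: h; rewrite inE js orbT.
Qed.

(** On cylinders this is the product rule for the concatenation of two disjoint
    lists of indices. *)
Lemma independent_groups F J K : (forall i, setI_closed (F i)) ->
  (forall i, F i setT) -> (forall i, F i `<=` measurable) ->
  mutually_independent P F -> (forall i, J i -> K i -> False) ->
  independent P <<s cylinders F J >> <<s cylinders F K >>.
Proof.
move=> FI FT Fm Find JK.
apply: independent_generated; try exact: cylinders_setI; try exact: cylinders_measurable.
move=> _ _ [s [E [us [hs ->]]]] [s' [E' [us' [hs' ->]]]].
pose E'' i := if i \in s then E i else E' i.
have dis i : i \in s' -> i \notin s.
  by move=> /hs'[Ki _]; apply/negP => /hs[Ji _]; exact: JK Ji Ki.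
have e1 : \big[setI/setT]_(i <- s) E i = \big[setI/setT]_(i <- s) E'' i.
  by apply: eq_big_seq => i si; rewrite /E'' si.
have e2 : \big[setI/setT]_(i <- s') E' i = \big[setI/setT]_(i <- s') E'' i.
  by apply: eq_big_seq => i si; rewrite /E'' (negbTE (dis _ si)).
have m1 i : i \in s -> F i (E'' i) by move=> si; rewrite /E'' si; case: (hs i si).
have m2 i : i \in s' -> F i (E'' i).
  by move=> si; rewrite /E'' (negbTE (dis _ si)); case: (hs' i si).
rewrite e1 e2 -big_cat /= !Find // ?big_cat //.
  by rewrite cat_uniq us us' andbT /= -all_predC; apply/allP => i /dis.
by move=> i; rewrite mem_cat => /orP[/m1|/m2].
Qed.

End Grouping.

Section ProductExpectation.
Context (R : realType) d (T : measurableType d) (P : probability T R).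
Local Notation Ex := (Ex P).
Local Notation integ := (integ P).

(** Stated through preimages, so that functions on [T] need not be retyped over
    [g_sigma_algebraType G]. *)
Definition gmeas (G : set (set T)) (U : T -> R) :=
  forall B : set R, measurable B -> <<s G >> (U @^-1` B).

Lemma gmeasP G U : gmeas G U <->
  measurable_fun [set: g_sigma_algebraType G] (U : g_sigma_algebraType G -> R).
Proof.
split => [h _ B mB|h B mB]; first by rewrite setTI; exact: h.
by have := h measurableT B mB; rewrite setTI.
Qed.

Lemma gmeas_measurable G U : G `<=` measurable -> gmeas G U -> measurable_fun setT U.
Proof. by move=> Gm h _ B mB; rewrite setTI; apply: (sigma_sub_measurable Gm); exact: h. Qed.

(** The pair of two independent variables has the product law, so Fubini's
    theorem factors the expectation of their product. *)
Lemma independent_Ex G H U V : G `<=` measurable -> H `<=` measurable ->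
  independent P <<s G >> <<s H >> -> gmeas G U -> gmeas H V ->
  integ U -> integ V ->
  integ (fun w => U w * V w) /\ Ex (fun w => U w * V w) = Ex U * Ex V.
Proof.
move=> Gm Hm ind gU gV iU iV.
have mU := gmeas_measurable Gm gU; have mV := gmeas_measurable Hm gV.
pose U' : {mfun T >-> R} := HB.pack U (isMeasurableFun.Build _ _ _ _ U mU).
pose V' : {mfun T >-> R} := HB.pack V (isMeasurableFun.Build _ _ _ _ V mV).
pose m1 : probability R R := distribution P U'.
pose m2 : probability R R := distribution P V'.
have mUV : measurable_fun setT (fun w => (U w, V w)) by exact: measurable_fun_pair.
pose UV : {mfun T >-> (R * R)%type} :=
  HB.pack (fun w => (U w, V w)) (isMeasurableFun.Build _ _ _ _ _ mUV).
pose m' : probability (R * R)%type R := distribution P UV.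
have em : forall X : set (R * R), measurable X -> (m1 \x m2)%E X = m' X.
  apply: product_measure_unique => A B mA mB.
  exact: (ind (U @^-1` A) (V @^-1` B) (gU _ mA) (gV _ mB)).
pose f (z : R * R) := (z.1 * z.2)%:E.
have mf : measurable_fun setT f.
  by apply/measurable_EFinP; apply: measurable_funM => //.
have fubin (g1 g2 : R -> R) : measurable_fun setT g1 -> measurable_fun setT g2 ->
    (forall x, 0 <= g1 x) -> (forall x, 0 <= g2 x) ->
    (\int[m1 \x m2]_z (g1 z.1 * g2 z.2)%:E = \int[m1]_x (g1 x)%:E * \int[m2]_y (g2 y)%:E)%E.
  move=> mg1 mg2 g10 g20; rewrite fubini_tonelli1 /=; last 2 first.
    apply/measurable_EFinP; apply: measurable_funM.
      exact: measurableT_comp mg1 measurable_fst.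
    exact: measurableT_comp mg2 measurable_snd.
    by move=> z; rewrite lee_fin mulr_ge0.
  rewrite /fubini_F /=.
  under eq_integral => x _.
    under eq_integral do rewrite EFinM.
    rewrite ge0_integralZl //; last 3 first.
      exact/measurable_EFinP.
      by move=> y _; rewrite lee_fin.
      by rewrite lee_fin.
    over.
  rewrite ge0_integralZr //; first exact/measurable_EFinP.
    by move=> x _; rewrite lee_fin.
  by apply: integral_ge0 => y _; rewrite lee_fin.
have absfin (W : {mfun T >-> R}) : integ W ->
    (\int[distribution P W]_x `|x|%:E < +oo)%E.
  move=> iW; rewrite (@ge0_integral_distribution _ _ _ _ _ P W (fun x : R => (`|x|)%:E)) //; last first.
    by apply/measurable_EFinP; exact: normr_measurable.
  by have /integrableP[_] : P.-integrable setT (EFin \o W) by [].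
have absE : (\int[m1 \x m2]_z `|f z| = \int[m1]_x `|x|%:E * \int[m2]_y `|y|%:E)%E.
  rewrite -fubin //.
  by apply: eq_integral => z _; rewrite /f abse_EFin normrM.
have if12 : (m1 \x m2)%E.-integrable setT f.
  apply/integrableP; split => //; rewrite absE lte_mul_pinfty //.
  - by apply: integral_ge0 => x _; rewrite lee_fin.
  - rewrite ge0_fin_numE; first exact: (absfin U').
    by apply: integral_ge0 => x _; rewrite lee_fin.
  - exact: (absfin V').
have toP (g : R * R -> \bar R) : measurable_fun setT g -> (forall z, 0 <= g z)%E ->
    (\int[P]_w g (U w, V w) = \int[m1 \x m2]_z g z)%E.
  move=> mg g0; rewrite (eq_measure_integral m'); last by move=> X mX _; exact: em.
  by rewrite /m' ge0_integral_distribution.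
have iUV : integ (fun w => U w * V w).
  apply/integrableP; split; first exact/measurable_EFinP/measurable_funM.
  have /integrableP[_] := if12; rewrite -toP //.
  exact: measurableT_comp.
have iid1 : m1.-integrable setT EFin.
  by apply/integrableP; split; [exact: EFin_measurable|exact: (absfin U')].
have iid2 : m2.-integrable setT EFin.
  by apply/integrableP; split; [exact: EFin_measurable|exact: (absfin V')].
have Eint (W : {mfun T >-> R}) : integ W ->
    (\int[distribution P W]_x x%:E)%E = (Ex W)%:E.
  by move=> iW; rewrite -Ex_EFin // integral_distribution.
split => //; apply: EFin_inj; rewrite -Ex_EFin // EFinM.
have -> : (\int[P]_w (U w * V w)%:E = \int[m1 \x m2]_z f z)%E.
  rewrite (eq_measure_integral m'); last by move=> X mX _; exact: em.
  by rewrite /m' integral_distribution.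
rewrite -integral12_prod_meas1 // /fubini_F /f /=.
under eq_integral => x _.
  under eq_integral do rewrite EFinM.
  rewrite integralZl //; over.
have /= -> := Eint V' iV.
by rewrite integralZr //; have /= -> := Eint U' iU.
Qed.

End ProductExpectation.

Section SameDistribution.
Context (R : realType) d (T : measurableType d) (P : probability T R).
Local Notation Ex := (Ex P).
Local Notation integ := (integ P).

Lemma same_distribution_Ex (X Y : {RV P >-> R}) (g : R -> R) :
  same_distribution X Y -> measurable_fun setT g ->
  integ (fun w => g (X w)) ->
  integ (fun w => g (Y w)) /\ Ex (fun w => g (Y w)) = Ex (fun w => g (X w)).
Proof.
move=> XY mg iX.
have mgY (W : {RV P >-> R}) : measurable_fun setT (EFin \o (fun w => g (W w))).
  by apply/measurable_EFinP; exact: measurableT_comp.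
have mge : measurable_fun setT (EFin \o g) by exact/measurable_EFinP.
have e (A : set R) : measurable A -> distribution P X A = distribution P Y A.
  by move=> mA; exact: XY.
have iY : integ (fun w => g (Y w)).
  apply/integrableP; split => //.
  have /integrableP[_] := iX.
  rewrite -(@ge0_integral_distribution _ _ _ _ _ P Y (fun x => `|(g x)%:E|%E)) //; last exact: measurableT_comp.
  rewrite -(@ge0_integral_distribution _ _ _ _ _ P X (fun x => `|(g x)%:E|%E)) //; last exact: measurableT_comp.
  by rewrite (eq_measure_integral (distribution P Y)) // => A mA _; exact: e.
split => //; apply: EFin_inj; rewrite -!Ex_EFin //.
rewrite -(@integral_distribution _ _ _ _ _ P Y (EFin \o g)) //.
rewrite -(@integral_distribution _ _ _ _ _ P X (EFin \o g)) //.
by apply: eq_measure_integral => A mA _; exact/esym/e.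
Qed.

End SameDistribution.

Section Fields.
Context (R : realType) d (T : measurableType d) (P : probability T R).
Local Notation Ex := (Ex P).
Local Notation integ := (integ P).

Definition sgen (I : Type) (X : I -> {RV P >-> R}) (J : set I) : set (set T) :=
  [set E | exists i (B : set R), [/\ J i, measurable B & E = X i @^-1` B]].

Lemma sgen_measurable (I : Type) (X : I -> {RV P >-> R}) J : sgen X J `<=` measurable.
Proof.
move=> _ [i [B [_ mB ->]]]; rewrite -[X in measurable X]setTI.
exact: measurable_funPT.
Qed.

Lemma sgen_sub (I : Type) (X : I -> {RV P >-> R}) (J K : set I) : J `<=` K ->
  <<s sgen X J >> `<=` <<s sgen X K >>.
Proof.
move=> JK; apply: sub_smallest2r; first exact: smallest_sigma_algebra.
by move=> _ [i [B [/JK Ki mB ->]]]; exists i, B.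
Qed.

Lemma gmeas_coord (I : Type) (X : I -> {RV P >-> R}) (J : set I) i : J i ->
  gmeas (sgen X J) (X i).
Proof. by move=> Ji B mB; apply: sub_sigma_algebra; exists i, B. Qed.

Lemma gmeas_comp (G : set (set T)) (U : T -> R) (g : R -> R) :
  measurable_fun setT g -> gmeas G U -> gmeas G (fun w => g (U w)).
Proof.
move=> mg hU B mB; have := hU (g @^-1` B); apply.
by rewrite -[X in measurable X]setTI; exact: mg.
Qed.

Lemma gmeas_prod (I : eqType) (G : set (set T)) (s : seq I) (U : I -> T -> R) :
  (forall i, i \in s -> gmeas G (U i)) -> gmeas G (fun w => \prod_(i <- s) U i w).
Proof. by move=> h; apply/gmeasP; apply: measurable_prod => i /h /gmeasP. Qed.

Lemma gmeas_sum (I : Type) (G : set (set T)) (s : seq I) (U : I -> T -> R) :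
  (forall i, gmeas G (U i)) -> gmeas G (fun w => \sum_(i <- s) U i w).
Proof. by move=> h; apply/gmeasP; apply: measurable_sum => i; exact/gmeasP. Qed.

Lemma gmeasM (G : set (set T)) (U V : T -> R) :
  gmeas G U -> gmeas G V -> gmeas G (fun w => U w * V w).
Proof. by move=> /gmeasP hU /gmeasP hV; apply/gmeasP; exact: measurable_funM. Qed.

Context (sigma Z : nat * nat -> {RV P >-> R}).
Hypothesis hZ : iid Z.
Hypothesis hindep : independent_fields sigma Z.
Hypothesis hstat : stationary_field sigma.

Lemma iid_groups (J K : set (nat * nat)) : (forall e, J e -> K e -> False) ->
  independent P <<s sgen Z J >> <<s sgen Z K >>.
Proof.
case: hZ => mi _ JK.
have sub (L : set (nat * nat)) : <<s sgen Z L >> `<=`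
    <<s cylinders (fun i => sigma_gen (fun j => Z j : T -> R) [set i]) L >>.
  apply: sub_smallest2r; first exact: smallest_sigma_algebra.
  move=> _ [i [B [Li mB ->]]].
  exists [:: i], (fun=> Z i @^-1` B); split => //; split; last by rewrite big_seq1.
  move=> j; rewrite inE => /eqP ->; split => //; apply: sub_sigma_algebra.
  by exists i, B.
apply: (independent_sub (@sub J) (@sub K)); apply: independent_groups => //.
- by move=> i; exact: sigma_genI.
- by move=> i; exact: sigma_genT.
- by move=> i; exact: sigma_gen_measurable.
Qed.

Lemma Ex_prod_Z (s : seq (nat * nat)) (g : nat * nat -> R -> R) : uniq s ->
  (forall e, measurable_fun setT (g e)) ->
  (forall e, e \in s -> integ (fun w => g e (Z e w))) ->
  integ (fun w => \prod_(e <- s) g e (Z e w)) /\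
  Ex (fun w => \prod_(e <- s) g e (Z e w)) = \prod_(e <- s) Ex (fun w => g e (Z e w)).
Proof.
move=> us mg; elim: s us => [_ _|e s IH /= /andP[es us] ig].
  rewrite big_nil (_ : (fun w => _) = cst 1); first by split; [exact: integ_cst|exact: Ex_cst].
  by apply/funext => w; rewrite big_nil.
have [i2 e2] := IH us (fun f fs => ig f (mem_behead (s := e :: s) fs)).
have i1 := ig e (mem_head e s).
rewrite big_cons -e2.
rewrite (_ : (fun w => _) = fun w => g e (Z e w) * \prod_(f <- s) g f (Z f w)); last first.
  by apply/funext => w; rewrite big_cons.
apply: (@independent_Ex _ _ _ _ (sgen Z [set e]) (sgen Z [set f | f \in s])) => //.
- exact: sgen_measurable.
- exact: sgen_measurable.
- by apply: iid_groups => f /= ->; exact/negP.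
- by apply: gmeas_comp => //; exact: gmeas_coord.
- by apply: gmeas_prod => f fs; apply: gmeas_comp => //; exact: gmeas_coord.
Qed.

Lemma Z_same_distribution e : same_distribution (Z (0%N, 0%N)) (Z e).
Proof. by case: hZ => _; exact. Qed.

Lemma sigma_same_distribution e : same_distribution (sigma (0%N, 0%N)) (sigma e).
Proof.
case: e => i t B mB.
have := hstat i t; move=> /(_ [set x | B (x (0%N, 0%N))]) h.
apply: h; apply: sub_sigma_algebra.
by exists (0%N, 0%N), B; split.
Qed.

(** All moment computations below reduce to this factorization, which combines
    the independence of the two fields with that of the noise variables. *)
Lemma Ex_sigma_prod_Z (W : T -> R) (s : seq (nat * nat)) (g : nat * nat -> R -> R) :
  gmeas (sgen sigma setT) W -> integ W -> uniq s ->
  (forall e, measurable_fun setT (g e)) ->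
  (forall e, e \in s -> integ (fun w => g e (Z (0%N, 0%N) w))) ->
  integ (fun w => W w * \prod_(e <- s) g e (Z e w)) /\
  Ex (fun w => W w * \prod_(e <- s) g e (Z e w)) =
    Ex W * \prod_(e <- s) Ex (fun w => g e (Z (0%N, 0%N) w)).
Proof.
move=> gW iW us mg ig.
have ie e : e \in s -> integ (fun w => g e (Z e w)).
  by move=> es; case: (same_distribution_Ex (Z_same_distribution e) (mg e) (ig e es)).
have [i2 e2] := Ex_prod_Z us mg ie.
have [i3 e3] : integ (fun w => W w * \prod_(e <- s) g e (Z e w)) /\
    Ex (fun w => W w * \prod_(e <- s) g e (Z e w)) =
    Ex W * Ex (fun w => \prod_(e <- s) g e (Z e w)).
  apply: (@independent_Ex _ _ _ _ (sgen sigma setT) (sgen Z setT)) => //.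
  - exact: sgen_measurable.
  - exact: sgen_measurable.
  - by apply: gmeas_prod => e _; apply: gmeas_comp => //; exact: gmeas_coord.
split => //; rewrite e3 e2; congr (_ * _).
apply: eq_big_seq => e es.
by case: (same_distribution_Ex (Z_same_distribution e) (mg e) (ig e es)).
Qed.

(** A pi-system generating the joint sigma-algebra of the [i]-th rows of both
    fields. *)
Definition row_events i : set (set T) :=
  [set E | exists A B, [/\ <<s sgen sigma [set it | it.1 = i] >> A,
                           <<s sgen Z [set it | it.1 = i] >> B & E = A `&` B]].

Lemma row_events_measurable i : row_events i `<=` measurable.
Proof.
move=> _ [A [B [hA hB ->]]]; apply: measurableI.
  by apply: (sigma_sub_measurable _ hA); exact: sgen_measurable.
by apply: (sigma_sub_measurable _ hB); exact: sgen_measurable.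
Qed.

Lemma row_events_setI i : setI_closed (row_events i).
Proof.
move=> _ _ [A [B [hA hB ->]]] [A' [B' [hA' hB' ->]]].
exists (A `&` A'), (B `&` B'); split; last by rewrite setIACA.
  exact: (sigma_genI (X := fun i => sigma i : T -> R)).
exact: (sigma_genI (X := fun i => Z i : T -> R)).
Qed.

Lemma gmeas_row_sigma i t : gmeas (row_events i) (sigma (i, t)).
Proof.
move=> B mB; apply: sub_sigma_algebra; exists (sigma (i, t) @^-1` B), setT.
split; [exact: gmeas_coord|exact: (@sigma_genT R T _ (fun i => Z i : T -> R) [set it | it.1 = i])|by rewrite setIT].
Qed.

Lemma gmeas_row_Z i t : gmeas (row_events i) (Z (i, t)).
Proof.
move=> B mB; apply: sub_sigma_algebra; exists setT, (Z (i, t) @^-1` B).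
split; [exact: (@sigma_genT R T _ (fun i => sigma i : T -> R) [set it | it.1 = i])|exact: gmeas_coord|by rewrite setTI].
Qed.

(** Two rows involve four events: the rows within each field are independent,
    and so are the two fields. *)
Lemma independent_rows i j : iid_rows sigma -> i != j ->
  independent P <<s row_events i >> <<s row_events j >>.
Proof.
move=> [hrow _] ij; apply: independent_generated; try exact: row_events_setI;
  try exact: row_events_measurable.
move=> _ _ [A [B [hA hB ->]]] [A' [B' [hA' hB' ->]]].
have AA : P (A `&` A') = (P A * P A')%E.
  have := hrow [:: i; j] (fun k => if k == i then A else A').
  rewrite !big_cons !big_nil eqxx eq_sym (negbTE ij) setIT mule1; apply.
    by rewrite /= inE ij.
  move=> k; rewrite !inE => /orP[] /eqP ->; first by rewrite eqxx.
  by rewrite eq_sym (negbTE ij).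
have BB : P (B `&` B') = (P B * P B')%E.
  by apply: iid_groups hB hB' => e /= -> ije; rewrite ije eqxx in ij.
have big1 k C : <<s sgen sigma [set it | it.1 = k] >> C -> <<s sgen sigma setT >> C.
  exact: sgen_sub.
have big2 k C : <<s sgen Z [set it | it.1 = k] >> C -> <<s sgen Z setT >> C.
  exact: sgen_sub.
rewrite setIACA hindep; last 2 first.
- by apply: (sigma_genI (X := fun i => sigma i : T -> R)); [exact: big1 hA|exact: big1 hA'].
- by apply: (sigma_genI (X := fun i => Z i : T -> R)); [exact: big2 hB|exact: big2 hB'].
rewrite AA BB (hindep (big1 _ _ hA) (big2 _ _ hB)) (hindep (big1 _ _ hA') (big2 _ _ hB')).
by rewrite muleACA.
Qed.

Lemma independent_rows_prob i j (U V : T -> R) x : iid_rows sigma -> i != j ->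
  gmeas (row_events i) U -> gmeas (row_events j) V ->
  P ([set w | (x < U w)%R] `&` [set w | (x < V w)%R]) =
  (P [set w | (x < U w)%R] * P [set w | (x < V w)%R])%E.
Proof.
move=> hr ij gU gV; apply: (independent_rows hr ij).
  have -> : [set w | (x < U w)%R] = U @^-1` `]x, +oo[%classic.
    by apply/seteqP; split => w /=; rewrite in_itv /= andbT.
  by apply: gU; exact: measurable_itv.
have -> : [set w | (x < V w)%R] = V @^-1` `]x, +oo[%classic.
  by apply/seteqP; split => w /=; rewrite in_itv /= andbT.
by apply: gV; exact: measurable_itv.
Qed.

End Fields.

(** * Regularly varying tails *)

Section RegularVariation.
Context (R : realType).

(** Regular variation is only used to compare [x] with [2 * x]; estimates are
    then propagated along dyadic scales. *)
Lemma dyadic_ind (Q : R -> Prop) (x0 : R) : 0 < x0 ->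
  (forall x, x0 <= x <= 2 * x0 -> Q x) ->
  (forall x, x0 <= x -> Q x -> Q (2 * x)) -> forall x, x0 <= x -> Q x.
Proof.
move=> x00 base step.
have main n : forall x, x0 <= x -> x <= 2 ^+ n * x0 -> Q x.
  elim: n => [|n IH] x x0x xn.
    by apply: base; rewrite x0x /=; move: xn x0x x00; rewrite expr0; lra.
  have [h|h] := leP x (2 * x0); first by apply: base; rewrite x0x h.
  have -> : x = 2 * (x / 2) by field.
  apply: step; first by lra.
  by apply: IH; [lra|rewrite ler_pdivrMr // mulrAC -exprSr].
move=> x x0x; pose n := (Num.truncn (x / x0)).+1.
apply: (main n) => //; rewrite -ler_pdivrMr //.
apply: (@le_trans _ _ n%:R); first by apply/ltW/truncnS_gt.
by rewrite -natrX ler_nat ltnW // ltn_expl.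
Qed.

Lemma powR2N_lt1 (a : R) : 0 < a -> 2 `^ (- a) < 1 :> R.
Proof.
move=> a0; rewrite /powR pnatr_eq0 /= -[X in _ < X]expR0 ltr_expR mulNr.
by rewrite oppr_lt0 mulr_gt0 // ln_gt0 // ltr1n.
Qed.

Context (G : R -> R) (alpha : R).
Hypothesis Gpos : forall x, 0 < G x.
Hypothesis Gmon : forall x y, x <= y -> G y <= G x.
Hypothesis G2 : G (2 * x) / G x @[x --> +oo] --> 2 `^ (- alpha).

(** Potter's bounds across one dyadic scale. *)
Lemma potter delta : 0 < delta -> exists2 x0 : R, 1 <= x0 &
  forall x, x0 <= x -> 2 `^ (- (alpha + delta)) * G x <= G (2 * x) /\
                       G (2 * x) <= 2 `^ (- (alpha - delta)) * G x.
Proof.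
move=> d0.
have h1 : 2 `^ (- (alpha + delta)) < 2 `^ (- alpha) :> R.
  by rewrite /powR pnatr_eq0 /= ltr_expR ltr_pM2r ?ln_gt0 ?ltr1n //; lra.
have h2 : 2 `^ (- alpha) < 2 `^ (- (alpha - delta)) :> R.
  by rewrite /powR pnatr_eq0 /= ltr_expR ltr_pM2r ?ln_gt0 ?ltr1n //; lra.
have := G2; move=> /cvgrPdist_lt H.
pose e : R := Num.min (2 `^ (- alpha) - 2 `^ (- (alpha + delta)))
                  (2 `^ (- (alpha - delta)) - 2 `^ (- alpha)).
have e0 : 0 < e by rewrite lt_min !subr_gt0 h1 h2.
have [M [_ hM]] := H _ e0.
exists (Num.max 1 (M + 1)); first by rewrite le_max lexx.
move=> x; rewrite ge_max => /andP[x1 xM].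
have Mx : M < x by lra.
have /= := hM x Mx; rewrite lt_min !ltr_norml => /andP[/andP[h3 h4] /andP[h5 h6]].
have Gx := Gpos x.
have -> : G (2 * x) = G (2 * x) / G x * G x by rewrite divfK // gt_eqF.
rewrite !ler_pM2r //.
by split; lra.
Qed.

Lemma powR2M (x a : R) : 0 <= x -> (2 * x) `^ a = 2 `^ a * x `^ a.
Proof. by move=> x0; rewrite powRM. Qed.

Lemma tail_lower delta : 0 < delta -> 0 < alpha -> exists c x0 : R,
  [/\ 0 < c, 1 <= x0 & forall x, x0 <= x -> c * x `^ (- (alpha + delta)) <= G x].
Proof.
move=> d0 a0; have [x0 x01 hp] := potter d0.
have x00 : 0 < x0 by lra.
exists (G (2 * x0) * x0 `^ (alpha + delta)), x0; split => //.
  by rewrite mulr_gt0 // powR_gt0.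
apply: (dyadic_ind x00) => [x /andP[h1 h2]|x h IH].
  apply: (@le_trans _ _ (G (2 * x0))); last exact: Gmon.
  rewrite -mulrA ler_piMr //; first exact: ltW.
  rewrite powRN ler_pdivrMr ?powR_gt0 ?mul1r //; last by lra.
  by apply: ge0_ler_powR; rewrite ?nnegrE; lra.
have [h1 _] := hp x h; apply: le_trans h1.
rewrite powR2M; last by lra.
by rewrite mulrCA ler_wpM2l // powR_ge0.
Qed.

Lemma tail_upper delta : 0 < delta < alpha -> exists c x0 : R,
  [/\ 0 < c, 1 <= x0 & forall x, x0 <= x -> G x <= c * x `^ (- (alpha - delta))].
Proof.
move=> /andP[d0 da]; have [x0 x01 hp] := potter d0.
have x00 : 0 < x0 by lra.
exists (G x0 * (2 * x0) `^ (alpha - delta)), x0; split => //.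
  by rewrite mulr_gt0 // powR_gt0 //; lra.
apply: (dyadic_ind x00) => [x /andP[h1 h2]|x h IH].
  apply: (@le_trans _ _ (G x0)); first exact: Gmon.
  rewrite -mulrA ler_peMr //; first exact: ltW.
  rewrite powRN ler_pdivlMr ?powR_gt0 ?mul1r //; last by lra.
  by apply: ge0_ler_powR; rewrite ?nnegrE; lra.
have [_ h1] := hp x h; apply: (le_trans h1).
rewrite [(2 * x) `^ _]powR2M; last by lra.
by rewrite [X in _ <= X]mulrCA ler_wpM2l // powR_ge0.
Qed.

(** Karamata's bound for truncated moments, by induction over dyadic scales. *)
Lemma karamata (F : R -> R) m : alpha < m ->
  (forall x, 0 <= x -> F x <= x `^ m) ->
  (forall x, 0 <= x -> F (2 * x) <= F x + (2 * x) `^ m * G x) ->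
  exists c x0 : R, [/\ 0 < c, 1 <= x0 & forall x, x0 <= x -> F x <= c * (x `^ m * G x)].
Proof.
move=> am Fb Fs; pose delta := (m - alpha) / 2; have d0 : 0 < delta by rewrite /delta; lra.
have [x0 x01 hp] := potter d0.
have x00 : 0 < x0 by lra.
pose th : R := 2 `^ (- delta).
have th1 : th < 1 by exact: powR2N_lt1.
have th0 : 0 < th by rewrite powR_gt0.
(* [c] must exceed both the bound on the first dyadic block and the fixed
   point of [c |-> (c + 2^m) * th]. *)
pose c : R := 1 + (G (2 * x0))^-1 + 2 `^ m * th / (1 - th).
have G0 := Gpos (2 * x0).
have c1 : (G (2 * x0))^-1 <= c.
  by rewrite /c addrAC lerDr addr_ge0 // divr_ge0 ?mulr_ge0 ?powR_ge0 //; lra.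
have c0 : 0 < c by apply: lt_le_trans c1; rewrite invr_gt0.
have c2 : (c + 2 `^ m) * th <= c.
  have h : 2 `^ m * th / (1 - th) <= c.
    by rewrite /c lerDr addr_ge0 // invr_ge0 ltW.
  move: h; rewrite ler_pdivrMr; last by lra.
  by rewrite [(c + _) * th]mulrDl mulrBr mulr1; lra.
exists c, x0; split => //.
apply: (dyadic_ind x00) => [x /andP[h1 h2]|x h IH].
  have x0' : 0 <= x by lra.
  apply: (le_trans (Fb x x0')); rewrite mulrCA ler_peMr ?powR_ge0 //.
  rewrite -ler_pdivrMr // mul1r; apply: le_trans c1.
  by rewrite lef_pV2 ?posrE //; exact: Gmon.
have x0' : 0 <= x by lra.
have [h1 _] := hp x h.
apply: (le_trans (Fs x x0')); rewrite powR2M //.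
apply: (@le_trans _ _ ((c + 2 `^ m) * (x `^ m * G x))).
  by rewrite mulrDl mulrA [X in _ <= _ + X]mulrA lerD2r -mulrA.
have e : 2 `^ (- (alpha + delta)) = th^-1 * 2 `^ (- m) :> R.
  rewrite /th -powRN opprK -powRD; last by rewrite pnatr_eq0 implybT.
  by congr (_ `^ _); rewrite /delta; field.
have h3 : G x <= th * 2 `^ m * G (2 * x).
  apply: le_trans (ler_wpM2l _ h1); last by rewrite mulr_ge0 ?powR_ge0 // ltW.
  have m0 : 2 `^ m != 0 :> R by rewrite gt_eqF // powR_gt0.
  have t0 : th != 0 by rewrite gt_eqF.
  rewrite e powRN le_eqVlt; apply/orP; left; apply/eqP; field.
  by rewrite m0 t0.
apply: (@le_trans _ _ ((c + 2 `^ m) * (x `^ m * (th * 2 `^ m * G (2 * x))))).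
  rewrite ler_wpM2l //; first by rewrite addr_ge0 ?powR_ge0 // ltW.
  by rewrite ler_wpM2l // powR_ge0.
have -> : (c + 2 `^ m) * (x `^ m * (th * 2 `^ m * G (2 * x))) =
   (c + 2 `^ m) * th * (2 `^ m * x `^ m * G (2 * x)) by ring.
by rewrite ler_wpM2r // !mulr_ge0 ?powR_ge0 // ltW.
Qed.

(** For exponents below [alpha] the dyadic increments of the truncated moment
    form a convergent geometric series. *)
Lemma moment_bound (F : R -> R) s : 0 < s < alpha ->
  (forall x, 0 <= x -> F x <= x `^ s) ->
  (forall x, 0 <= x -> F (2 * x) <= F x + (2 * x) `^ s * G x) ->
  exists c x0 : R, forall x, x0 <= x -> F x <= c.
Proof.
move=> /andP[s0 sa] Fb Fs; pose eta := (alpha - s) / 2.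
have e0 : 0 < eta by rewrite /eta; lra.
have [|C [x0 [C0 x01 hC]]] := @tail_upper eta; first by rewrite /eta; lra.
have x00 : 0 < x0 by lra.
pose th : R := 2 `^ (- eta).
have th1 : th < 1 by exact: powR2N_lt1.
(* [B * x^(- eta)] is the part of the geometric series above the scale [x] *)
pose B := 2 `^ s * C / (1 - th).
have B0 : 0 <= B by rewrite divr_ge0 ?mulr_ge0 ?powR_ge0 //; [exact: ltW|lra].
pose K := (2 * x0) `^ s + B.
suff h : forall x, x0 <= x -> F x <= K - B * x `^ (- eta).
  exists K, x0 => x hx; apply: le_trans (h x hx) _.
  by rewrite gerBl mulr_ge0 // powR_ge0.
apply: (dyadic_ind x00) => [x /andP[h1 h2]|x h IH].
  have x0' : 0 <= x by lra.
  apply: (le_trans (Fb x x0')); rewrite /K -addrA; apply: ler_wpDr.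
    rewrite subr_ge0 ler_piMr // powRN invf_le1 ?powR_gt0 //; last by lra.
    by rewrite (_ : 1 = 1 `^ eta); last (by rewrite powR1); apply: ge0_ler_powR; rewrite ?nnegrE; lra.
  by apply: ge0_ler_powR; rewrite ?nnegrE; lra.
have x0' : 0 <= x by lra.
apply: (le_trans (Fs x x0')).
have h3 : (2 * x) `^ s * G x <= 2 `^ s * C * x `^ (- eta).
  rewrite powR2M // -!mulrA ler_wpM2l ?powR_ge0 //.
  apply: (@le_trans _ _ (x `^ s * (C * x `^ (- (alpha - eta))))).
    by rewrite ler_wpM2l ?powR_ge0 // hC.
  rewrite mulrCA ler_wpM2l //; first exact: ltW.
  rewrite -powRD; last by rewrite [x == 0]gt_eqF ?implybT //; apply: lt_le_trans x00 h.
  by rewrite le_eqVlt; apply/orP; left; apply/eqP; congr (_ `^ _); rewrite /eta; field.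
apply: (le_trans (lerD IH h3)); rewrite powR2M // -/th.
have e : 2 `^ s * C = B * (1 - th) by rewrite /B divfK // subr_eq0 gt_eqF.
by rewrite e; move: (x `^ (- eta)) => y; nra.
Qed.

End RegularVariation.

(** * Slowly varying functions *)

Section UniformConvergence.
Context (R : realType).
Local Notation mu := (@lebesgue_measure R).

Lemma lebesgue_measure_translate (a : R) (A : set R) : measurable A ->
  mu ((fun x => x + a) @^-1` A) = mu A.
Proof.
move=> mA; have mf : measurable_fun [set: measurableTypeR R]
    (fun x : measurableTypeR R => (x + a) : measurableTypeR R).
  exact: (@measurable_funD _ _ R setT id (cst a)).
pose tr : {mfun (measurableTypeR R) >-> (measurableTypeR R)} :=
  HB.pack (fun x : measurableTypeR R => (x + a) : measurableTypeR R)
    (isMeasurableFun.Build _ _ _ _ _ mf).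
rewrite -[LHS]/(pushforward mu tr A).
apply/esym; apply: (lebesgue_measure_unique (mu := pushforward mu tr)) => //.
move=> _ [[u v] _ <-] /=.
have -> : pushforward mu tr `]u, v]%classic = mu `]u - a, v - a]%classic.
  by congr (mu _); apply/seteqP; split => x /=; rewrite !in_itv /= ltrBlDr lerBrDr.
rewrite !lebesgue_measure_itv /= !lte_fin ltrD2r -!EFinD; case: ifP => // _.
by congr EFin; ring.
Qed.

(** The uniform convergence theorem, in additive form: along sequences, the
    good translations fill up most of an interval, so two of them meet. *)
Lemma uniform_translation (h : R -> R) : measurable_fun setT h ->
  (forall u e, 0 < e -> exists Y : R, forall y, Y <= y -> `|h (y + u) - h y| <= e) ->
  forall e, 0 < e -> exists Y : R, forall y u, Y <= y -> 0 <= u <= 1 ->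
    `|h (y + u) - h y| <= e.
Proof.
move=> mh hu e e0; apply/not_existsP => nY.
have bad n : exists yu : R * R, [/\ n%:R <= yu.1, 0 <= yu.2 <= 1 &
    e < `|h (yu.1 + yu.2) - h yu.1| ].
  have /existsNP[y /existsNP[u]] := nY n%:R.
  move=> /not_implyP[ny /not_implyP[u01 /negP]]; rewrite -ltNge => he.
  by exists (y, u).
have [s hs] := choice bad.
pose V (z : nat -> R) n : set R := `[0, 3]%classic `&`
  \bigcap_(m in [set m | (n <= m)%N]) [set x | `|h (z m + x) - h (z m)| <= e / 3].
have mV z n : measurable (V z n).
  apply: measurableI; first exact: measurable_itv.
  apply: bigcap_measurable => [|m _]; first by exists n => /=.
  have mg : measurable_fun setT (fun x => `|h (z m + x) - h (z m)|).
    apply: measurableT_comp => //; apply: measurable_funB => //.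
    by apply: measurableT_comp => //; exact: measurable_funD.
  have -> : [set x | `|h (z m + x) - h (z m)| <= e / 3] =
      setT `&` (fun x => `|h (z m + x) - h (z m)|) @^-1` `]-oo, e / 3]%classic.
    by rewrite setTI; apply/seteqP; split => x /=; rewrite in_itv.
  by apply: mg => //; exact: measurable_itv.
have big (z : nat -> R) : (forall n, n%:R <= z n) -> \forall n \near \oo, ((5 / 2)%:E < mu (V z n))%E.
  move=> zn.
  have UV : \bigcup_n V z n = `[0, 3]%classic.
    apply/seteqP; split => [x [n _ []]//|x x03].
    have [Y hY] := hu x (e / 3) ltac:(by rewrite divr_gt0).
    exists (Num.truncn `|Y|).+1 => //; split => // m /= nm; apply: hY.
    apply: le_trans (ler_norm _) _; apply: le_trans (zn m).
    by apply: ltW; apply: lt_le_trans (truncnS_gt _) _; rewrite ler_nat.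
  have cV : mu \o V z @ \oo --> mu (\bigcup_n V z n).
    apply: nondecreasing_cvg_mu; [by move=> n; exact: mV|by rewrite UV; exact: measurable_itv|].
    move=> m n mn; apply/subsetPset => x [x03 hx]; split => // k /= nk.
    by apply: hx => /=; exact: leq_trans nk.
  rewrite UV lebesgue_measure_itv /= lte_fin ltr0n /= -EFinD subr0 in cV.
  have : open [set x : \bar R | ((5 / 2)%:E < x)%E] by exact: open_ereal_gt_ereal.
  by move=> o; apply: (cV [set x : \bar R | ((5 / 2)%:E < x)%E]); apply: open_nbhs_nbhs; split => //=; rewrite lte_fin; lra.
have h1 := big (fun n => (s n).1) (fun n => let: And3 a _ _ := hs n in a).
have h2 := big (fun n => (s n).1 + (s n).2) (fun n => let: And3 a b _ := hs n in
  ltac:(by apply: ler_wpDr a; case/andP: b)).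
have [n _ /(_ n (leqnn n))[]] := filterI h1 h2.
set A := V _ n; set B := V _ n => hA hB.
have [yn /andP[u0 u1] gap] := hs n; set y := (s n).1 in A yn gap hA *.
set u := (s n).2 in u0 u1 gap.
pose B' := (fun x => x + - u) @^-1` B.
have mB' : mu B' = mu B by apply: lebesgue_measure_translate; exact: mV.
have meet : A `&` B' !=set0.
  apply/set0P/negP => /eqP AB.
  have sub : A `|` B' `<=` `[0, 4]%classic.
    move=> x [[]|[]] /=; rewrite !in_itv /=; lra.
  have mB'' : measurable B'.
    rewrite /B' -[X in measurable X]setTI; apply: measurable_funD => //; exact: mV.
  have : (mu (A `|` B') <= mu `[0%R, 4%R]%classic)%E.
    apply: le_measure => //; rewrite inE; last exact: measurable_itv.
    by apply: measurableU => //; exact: mV.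
  rewrite measureU //; last exact: mV.
  rewrite lebesgue_measure_itv /= lte_fin ltr0n /= -EFinD subr0 mB' => hm.
  have := lt_le_trans (lteD hA hB) hm; rewrite -EFinD lte_fin; lra.
have [x [[_ hx] [_ hx']]] := meet.
have := hx n (leqnn n); have := hx' n (leqnn n) => /=; rewrite -/y -/u.
have -> : y + u + (x - u) = y + x by ring.
move: gap; rewrite ltNge => /negP g k1 k2; apply: g.
have -> : h (y + u) - h y = (h (y + x) - h y) - (h (y + x) - h (y + u)) by ring.
apply: le_trans (ler_normB _ _) _; lra.
Qed.

End UniformConvergence.

Section SlowlyVarying.
Context (R : realType).

Lemma pinfty_ge (Q : R -> Prop) : (\forall x \near +oo, Q x) ->
  exists M : R, forall x, M <= x -> Q x.
Proof.
move=> [M [_ hM]]; exists (M + 1) => x Mx; apply: hM.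
by apply: lt_le_trans Mx; rewrite ltrDl.
Qed.

(** Uniformity over [c] in [1, 2] is the additive theorem for the function
    [y |-> ln (ell (exp y))]. *)
Lemma slowly_varying_local (ell : R -> R) delta : slowly_varying ell -> 0 < delta ->
  exists2 x0 : R, 1 <= x0 & forall x c, x0 <= x -> 1 <= c <= 2 ->
    [/\ 0 < ell x, ell (c * x) <= 2 `^ delta * ell x & ell x <= 2 `^ delta * ell (c * x)].
Proof.
move=> [[x1 mell] /pinfty_ge[x2 pell] hell] d0.
pose ell' := ell \_ `]x1, +oo[%classic.
have mell' : measurable_fun setT ell'.
  by apply/(measurable_restrictT _ _).1 => //; exact: measurable_itv.
have ellE x : x1 < x -> ell' x = ell x.
  by move=> xx; rewrite /ell' patchE mem_set //= in_itv /= xx.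
pose h y := ln (ell' (expR y)).
have mh : measurable_fun setT h.
  by apply: measurableT_comp; [exact: measurable_ln|apply: measurableT_comp => //; exact: measurable_expR].
pose K := Num.max (Num.max x1 x2) 0 + 1.
have [Ka [Kb Kc]] : x1 < K /\ x2 < K /\ 0 < K.
  have hh : Num.max (Num.max x1 x2) 0 < K by rewrite ltrDl.
  move: hh; rewrite !gt_max => /andP[/andP[-> ->] ->] //.
have big y : K <= y -> [/\ x1 < expR y, x2 <= expR y & 0 < ell (expR y)].
  move=> Ky; have e1 : y <= expR y by have := expR_ge1Dx y; lra.
  have e2 : x2 <= expR y by lra.
  by split; [lra| |exact: pell].
have hE y : K <= y -> h y = ln (ell (expR y)) by move=> /big[? _ _]; rewrite /h ellE.
have hu u e : 0 < e -> exists Y : R, forall y, Y <= y -> `|h (y + u) - h y| <= e.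
  move=> e0; have := hell (expR u) (expR_gt0 u) => /cvgrPdist_lt H.
  pose w : R := Num.min (1 - expR (- e)) (expR e - 1).
  have w0 : 0 < w by rewrite lt_min !subr_gt0 expR_lt1 expR_gt1; lra.
  have /pinfty_ge[M hM] := H _ w0.
  exists (Num.max M (K + `|u|)) => y; rewrite ge_max => /andP[My Ky].
  have [un1 un2] : - `|u| <= u /\ u <= `|u| by have := ler_norm u; have := ler_norm (- u); rewrite normrN; lra.
  have nu := normr_ge0 u.
  have [_ _ p1] := big y ltac:(lra); have [_ _ p2] := big (y + u) ltac:(lra).
  rewrite !hE; [|lra|lra]; rewrite -ln_div ?posrE //.
  pose r := ell (expR (y + u)) / ell (expR y).
  have hr : `|1 - r| < w.
    by rewrite /r [y + u]addrC expRD; apply: hM; have := expR_ge1Dx y; lra.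
  have r0 : 0 < r by rewrite divr_gt0.
  move: hr; rewrite lt_min !ltr_norml => /andP[/andP[h1 h2] /andP[h3 h4]].
  rewrite -/r ler_norml -[X in X <= _]expRK -[X in _ && (_ <= X)]expRK.
  by rewrite !ler_ln ?posrE ?expR_gt0 //; apply/andP; move: h1 h2 h3 h4; clear; split; lra.
have d2 : 0 < delta * ln 2 by rewrite mulr_gt0 // ln_gt0 // ltr1n.
have [Y hY] := uniform_translation mh hu d2.
exists (expR (Num.max 0 (Num.max Y K))); first by rewrite -expR0 ler_expR le_max lexx.
move=> x c hx /andP[c1 c2].
have x0 : 0 < x by apply: lt_le_trans hx; exact: expR_gt0.
have : Num.max 0 (Num.max Y K) <= ln x by rewrite -ler_expR lnK // posrE.
rewrite !ge_max => /andP[_ /andP[Yx Kx]].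
have lc0 : 0 <= ln c by exact: ln_ge0.
have lc1 : ln c <= 1.
  have := expR_ge1Dx (1 : R) => e1; rewrite -[X in _ <= X]expRK ler_ln ?posrE ?expR_gt0 //; lra.
have cx : expR (ln x + ln c) = c * x by rewrite expRD !lnK ?posrE //; [ring|lra].
have [_ _ p1] := big (ln x) Kx; have [_ _ p2] := big (ln x + ln c) ltac:(lra).
have := hY (ln x) (ln c) Yx; rewrite lc0 lc1 => /(_ isT).
rewrite !hE //; last by lra.
rewrite cx lnK ?posrE // in p1 p2 *.
have q : 2 `^ delta = expR (delta * ln 2) :> R by rewrite /powR pnatr_eq0.
rewrite ler_norml => /andP[k1 k2]; split => //.
  by rewrite q -[X in X <= _](lnK p2) -[X in _ <= _ * X](lnK p1) -expRD ler_expR; move: k1 k2; clear; lra.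
by rewrite q -[X in X <= _](lnK p1) -[X in _ <= _ * X](lnK p2) -expRD ler_expR; move: k1 k2; clear; lra.
Qed.

Lemma powR_absorb (C delta x : R) : 0 < delta -> 0 < C -> C `^ (delta^-1) <= x ->
  C <= x `^ delta.
Proof.
move=> d0 C0 h; have -> : C = (C `^ (delta^-1)) `^ delta.
  by rewrite -powRrM mulVf ?gt_eqF // powRr1 // ltW.
by apply: ge0_ler_powR; rewrite ?nnegrE ?powR_ge0 //; [exact: ltW|apply: le_trans h; exact: powR_ge0].
Qed.

(** A factor [2^e] per dyadic scale costs a power [x^e], and a second power
    [x^e] absorbs the constants. *)
Lemma slowly_varying_bounds (ell : R -> R) delta : slowly_varying ell -> 0 < delta ->
  exists2 x0 : R, 1 <= x0 & forall x, x0 <= x -> x `^ (- delta) <= ell x <= x `^ delta.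
Proof.
move=> sv d0; pose e := delta / 2; have e0 : 0 < e by rewrite /e; lra.
have [x0 x01 hloc] := slowly_varying_local sv e0.
have x00 : 0 < x0 by lra.
have x0l : 0 < ell x0 by case: (hloc x0 1 (lexx _) ltac:(by rewrite lexx ler1n)).
have ge1 x : x0 <= x -> 1 <= x `^ e.
  move=> xx; rewrite (_ : 1 = 1 `^ e); last by rewrite powR1.
  by apply: ge0_ler_powR; rewrite ?nnegrE; lra.
pose C : R := 2 `^ e * ell x0; have C0 : 0 < C by rewrite mulr_gt0 ?powR_gt0.
pose c : R := ell x0 / 2 `^ e; have c0 : 0 < c by rewrite divr_gt0 ?powR_gt0.
have t2 : 1 <= (2 : R) <= 2 by apply/andP; split; lra.
have up : forall x, x0 <= x -> ell x <= C * x `^ e.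
  apply: (dyadic_ind x00) => [x /andP[h1 h2]|x h IH].
    have [_ h _] := hloc x0 (x / x0) (lexx _) ltac:(by rewrite ler_pdivlMr // ler_pdivrMr // mul1r h1 h2).
    rewrite divfK ?gt_eqF // in h; apply: (le_trans h).
    by rewrite ler_peMr ?ge1 // ltW.
  have [_ h' _] := hloc x 2 h t2; apply: (le_trans h').
  have xx0 : 0 <= x by lra.
  by rewrite powR2M // [X in _ <= X]mulrCA ler_wpM2l // powR_ge0.
have lo : forall x, x0 <= x -> c * x `^ (- e) <= ell x.
  apply: (dyadic_ind x00) => [x /andP[h1 h2]|x h IH].
    have [_ _ h] := hloc x0 (x / x0) (lexx _) ltac:(by rewrite ler_pdivlMr // ler_pdivrMr // mul1r h1 h2).
    rewrite divfK ?gt_eqF // in h.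
    apply: (@le_trans _ _ c); last by rewrite /c ler_pdivrMr ?powR_gt0 // mulrC.
    rewrite ler_piMr //; first exact: ltW.
    by rewrite powRN invf_le1 ?powR_gt0 ?ge1 //; lra.
  have [_ _ h'] := hloc x 2 h t2.
  rewrite powR2M; last by lra.
  rewrite [2 `^ (- e)]powRN mulrCA mulrC ler_pdivrMr ?powR_gt0 // [X in _ <= X]mulrC.
  exact: le_trans h'.
exists (Num.max x0 (Num.max (C `^ e^-1) (c^-1 `^ e^-1))); first by rewrite le_max x01.
move=> x; rewrite !ge_max => /andP[xx /andP[xC xc]].
have x_0 : x == 0 = false by rewrite gt_eqF //; lra.
have dE : delta = e + e by rewrite /e; field.
apply/andP; split.
  apply: le_trans (lo x xx); rewrite dE opprD powRD ?x_0 ?implybT //.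
  rewrite ler_wpM2r ?powR_ge0 // powRN -[X in _ <= X]invrK lef_pV2 ?posrE ?powR_gt0 ?invr_gt0 //; last by lra.
  by apply: powR_absorb => //; rewrite invr_gt0.
apply: (le_trans (up x xx)); rewrite dE powRD ?x_0 ?implybT //.
by rewrite ler_wpM2r ?powR_ge0 //; exact: powR_absorb.
Qed.

End SlowlyVarying.

(** * Tails and truncated moments of the noise *)

Section Tails.
Context (R : realType) d (T : measurableType d) (P : probability T R).
Context (Z : {RV P >-> R}) (alpha qp qm : R) (L : R -> R).
Hypothesis (hq : qp + qm = 1) (hL : slowly_varying L) (halpha : 0 < alpha).
Hypothesis (htailp : right_tail P (fun w => Z w) qp L alpha).
Hypothesis (htailm : right_tail P (fun w => - Z w) qm L alpha).
Local Notation Ex := (Ex P).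
Local Notation integ := (integ P).

Definition tail (x : R) : R := fine (P [set w | x < `|Z w|]).

Let mZ : measurable_fun setT Z. Proof. by []. Qed.

Let mZabs : measurable_fun setT (fun w => `|Z w|).
Proof. exact: measurableT_comp. Qed.

Lemma measurable_tail x : measurable [set w | x < `|Z w|].
Proof. exact: measurable_gt. Qed.

Lemma tail_EFin x : P [set w | x < `|Z w|] = (tail x)%:E.
Proof. by rewrite /tail fineK // fin_num_measure //; exact: measurable_tail. Qed.

Lemma tail_mon x y : x <= y -> tail y <= tail x.
Proof.
move=> xy; rewrite -lee_fin -!tail_EFin; apply: le_measure; rewrite ?inE;
  [exact: measurable_tail|exact: measurable_tail|by move=> w /= h; apply: le_lt_trans xy h].
Qed.

Lemma tail_ge0 x : 0 <= tail x.
Proof. by rewrite /tail fine_ge0. Qed.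

Lemma tail_split x : 0 <= x ->
  tail x = fine (P [set w | x < Z w]) + fine (P [set w | x < - Z w]).
Proof.
move=> x0; rewrite -fineD; last 2 first.
- by rewrite fin_num_measure //; exact: measurable_gt.
- by rewrite fin_num_measure //; apply: measurable_gt; exact: measurableT_comp.
rewrite -measureU.
- rewrite /tail; congr (fine (P _)); apply/seteqP; split => w /=.
    by rewrite lter_normr => /orP[]; [left|right].
  by rewrite lter_normr; case=> ->; rewrite ?orbT.
- exact: measurable_gt.
- by apply: measurable_gt; exact: measurableT_comp.
- by apply/seteqP; split => w //= -[h1 h2]; move: x0 h1 h2; lra.
Qed.

Lemma cvg_double (f : R -> R) (l : R) : f x @[x --> +oo] --> l -> f (2 * x) @[x --> +oo] --> l.
Proof.
move=> fl; have h : (fun x : R => 2 * x) x @[x --> +oo%R] --> +oo%R; last exact: (cvg_comp _ _ h fl).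
move=> A [M [_ hM]]; exists (`|M|); split; first by rewrite num_real.
by move=> x /= Mx; apply: hM; have := ler_norm M; have := normr_ge0 M; lra.
Qed.

Let g x := L x * x `^ (- alpha).

Lemma tail_equiv : tail x / g x @[x --> +oo] --> (1 : R).
Proof.
have : fine (P [set w | x < Z w]) / g x + fine (P [set w | x < - Z w]) / g x
    @[x --> +oo] --> qp + qm by exact: cvgD.
rewrite hq; apply: cvg_trans; apply: near_eq_cvg.
near=> x; rewrite tail_split ?mulrDl //.
Unshelve. all: by end_near. Qed.

Lemma tail_gt0 x : 0 < tail x.
Proof.
have : \forall y \near +oo, x <= y /\ 0 < tail y / g y.
  near=> y; split; first by near: y; apply: nbhs_pinfty_ge; rewrite num_real.
  near: y; have := tail_equiv => /cvgrPdist_lt /(_ 1 ltr01); apply: filterS => y.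
  by rewrite ltr_norml; lra.
move=> /pinfty_ge[M /(_ M (lexx _))[xM h]].
apply: lt_le_trans (tail_mon xM); rewrite lt_neqAle tail_ge0 andbT eq_sym.
by apply: contraTneq h => ->; rewrite mul0r ltxx.
Unshelve. all: by end_near. Qed.

Lemma tail_double : tail (2 * x) / tail x @[x --> +oo] --> 2 `^ (- alpha).
Proof.
case: hL => _ Lpos Lsv.
have h : (tail (2 * x) / g (2 * x)) * (tail x / g x)^-1 * (L (2 * x) / L x) * 2 `^ (- alpha)
    @[x --> +oo] --> 1 * 1^-1 * 1 * 2 `^ (- alpha).
  apply: cvgM; last exact: cvg_cst.
  apply: cvgM; last exact: Lsv.
  apply: cvgM; first exact: (cvg_double tail_equiv).
  by apply: cvgV; [rewrite oner_eq0|exact: tail_equiv].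
rewrite invr1 !mul1r in h; apply: cvg_trans h; apply: near_eq_cvg.
have [M hM] := pinfty_ge Lpos.
near=> x.
have x0 : 0 < x by near: x; exact: nbhs_pinfty_gt.
have Mx : M <= x by near: x; apply: nbhs_pinfty_ge; rewrite num_real.
have Lx : 0 < L x by exact: hM.
have L2x : 0 < L (2 * x) by apply: hM; lra.
have tx := tail_gt0 x; have px : 0 < x `^ (- alpha) by exact: powR_gt0.
have p2 : 0 < 2 `^ (- alpha) :> R by exact: powR_gt0.
rewrite /g powR2M ?(ltW x0) //; field.
by rewrite !gt_eqF.
Unshelve. all: by end_near. Qed.

Definition truncmom (s x : R) (w : T) : R := if `|Z w| <= x then `|Z w| `^ s else 0.

Lemma measurable_truncmom s x : measurable_fun setT (truncmom s x).
Proof.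
apply: measurable_fun_ifT => //; first by apply: measurable_fun_ler => //.
by apply: (measurableT_comp (measurable_powR s)).
Qed.

Lemma truncmom_bound s x w : 0 <= s -> 0 <= x -> 0 <= truncmom s x w <= x `^ s.
Proof.
move=> s0 x0; rewrite /truncmom; case: ifP => [h|_]; last by rewrite lexx powR_ge0.
by rewrite powR_ge0 ge0_ler_powR // nnegrE.
Qed.

Lemma integ_truncmom s x : 0 <= s -> 0 <= x -> integ (truncmom s x).
Proof.
move=> s0 x0; apply: (@integ_bounded _ _ _ _ _ (x `^ s)); first exact: measurable_truncmom.
by move=> w; have /andP[h1 h2] := truncmom_bound w s0 x0; rewrite ger0_norm.
Qed.

Lemma truncmom_le s x : 0 <= s -> 0 <= x -> Ex (truncmom s x) <= x `^ s.
Proof.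
move=> s0 x0; rewrite -[X in _ <= X](Ex_cst P); apply: le_Ex.
- exact: integ_truncmom.
- exact: integ_cst.
- by move=> w; have /andP[] := truncmom_bound w s0 x0.
Qed.

Lemma truncmom_double s x : 0 <= s -> 0 <= x ->
  Ex (truncmom s (2 * x)) <= Ex (truncmom s x) + (2 * x) `^ s * tail x.
Proof.
move=> s0 x0; have x20 : 0 <= 2 * x by lra.
rewrite -[tail x](Ex_indic P (measurable_tail x)) -ExZ; last exact/integ_indic/measurable_tail.
rewrite -ExD; [|exact: integ_truncmom|exact/integZ/integ_indic/measurable_tail].
apply: le_Ex; first exact: integ_truncmom.
  by apply: integD; [exact: integ_truncmom|exact/integZ/integ_indic/measurable_tail].
move=> w; have /andP[h1 h2] := truncmom_bound w s0 x20.
have [h|h] := leP `|Z w| x.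
  rewrite {1 2}/truncmom h (le_trans h) ?lerDl; last by lra.
  by rewrite mulr_ge0 ?powR_ge0 // indicE.
rewrite indicE mem_set //= mulr1; apply: (le_trans h2); rewrite lerDr.
by have /andP[] := truncmom_bound w s0 x0.
Qed.

Lemma tail_karamata m : alpha < m -> exists c x0 : R,
  [/\ 0 < c, 1 <= x0 & forall x, x0 <= x -> Ex (truncmom m x) <= c * (x `^ m * tail x)].
Proof.
move=> am; have m0 : 0 <= m by move: halpha; lra.
apply: (karamata tail_gt0 tail_mon tail_double am) => x x0.
  exact: truncmom_le.
exact: truncmom_double.
Qed.

Lemma tail_power delta : 0 < delta -> exists c x0 : R,
  [/\ 0 < c, 1 <= x0 & forall x, x0 <= x -> c * x `^ (- (alpha + delta)) <= tail x].
Proof. by move=> d0; exact: (tail_lower tail_gt0 tail_mon tail_double). Qed.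

Lemma integ_moment s : 0 < s < alpha -> integ (fun w => `|Z w| `^ s).
Proof.
move=> ss; have /andP[s0 _] := ss.
have [|x x0|c [x0 hc]] := moment_bound tail_gt0 tail_mon tail_double (F := fun x => Ex (truncmom s x)) ss.
- by move=> x x0; apply: truncmom_le => //; exact: ltW.
- by apply: truncmom_double => //; exact: ltW.
have mm : measurable_fun setT (fun w => `|Z w| `^ s).
  exact: (measurableT_comp (measurable_powR s)).
apply/integrableP; split; first exact/measurable_EFinP.
pose f n w := (truncmom s n%:R w)%:E.
have fE w : `|(`|Z w| `^ s)%:E|%E = limn (f ^~ w).
  apply/esym/cvg_lim => //; apply: cvg_near_cst.
  exists (Num.truncn `|Z w|).+1 => // n /= hn; rewrite /f /truncmom.
  rewrite ifT; first by rewrite [X in _ = X%:E]ger0_norm ?powR_ge0.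
  by apply/ltW; apply: lt_le_trans (truncnS_gt _) _; rewrite ler_nat.
rewrite (eq_integral (fun w => limn (f ^~ w))); last by move=> w _; exact: fE.
rewrite monotone_convergence //.
- apply: (@le_lt_trans _ _ (c%:E)); last exact: ltry.
  apply: lime_le.
    apply: ereal_nondecreasing_is_cvgn => n m nm; apply: ge0_le_integral => //.
    - by move=> w _; rewrite lee_fin; have /andP[] := truncmom_bound w (ltW s0) (ler0n _ n).
    - by apply/measurable_EFinP; exact: measurable_truncmom.
    - by apply/measurable_EFinP; exact: measurable_truncmom.
    - move=> w _; rewrite lee_fin /truncmom; case: ifP => [h|_]; last first.
        by case: ifP; rewrite ?powR_ge0.
      by rewrite (le_trans h) // ler_nat.
  exists (Num.truncn `|x0|).+1 => // n /= hn.
  rewrite Ex_EFin; last by apply: integ_truncmom => //; exact: ltW.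
  rewrite lee_fin; apply: hc; apply: le_trans (ler_norm _) _.
  by apply/ltW; apply: lt_le_trans (truncnS_gt _) _; rewrite ler_nat.
- by move=> n; apply/measurable_EFinP; exact: measurable_truncmom.
- by move=> n w _; rewrite lee_fin; have /andP[] := truncmom_bound w (ltW s0) (ler0n _ n).
- move=> w _ n m nm; rewrite lee_fin /truncmom; case: ifP => [h|_]; last first.
    by case: ifP; rewrite ?powR_ge0.
  by rewrite (le_trans h) // ler_nat.
Qed.

End Tails.

(** * Closed walks and traces of powers of off-diagonal Gram matrices *)

Section Words.
Context (T : eqType).

Fixpoint words (A : seq T) k : seq (seq T) :=
  if k is k'.+1 then [seq a :: s | a <- A, s <- words A k'] else [:: [::]].

Lemma size_words A k s : s \in words A k -> size s = k.
Proof.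
elim: k s => [|k IH] s /=; first by rewrite inE => /eqP ->.
by case/allpairsP => -[a s'] /= [_ /IH <- ->].
Qed.

Lemma big_words (R : nmodType) A k (F : seq T -> R) :
  \sum_(s <- words A k.+1) F s = \sum_(a <- A) \sum_(s <- words A k) F (a :: s).
Proof. by rewrite big_allpairs_dep. Qed.

(** A word visiting [r] distinct letters has weight [q^-r]: its first letter is
    either a repetition (at most [k] choices) or new (weight [q^-1] each). *)
Lemma sum_words_weight (R : numFieldType) (A : seq T) (q : R) k : uniq A ->
  0 < q -> (size A)%:R <= q ->
  \sum_(s <- words A k) q ^- size (undup s) <= (k`!)%:R.
Proof.
move=> uA q0 Aq; elim: k => [|k IH]; first by rewrite big_seq1 expr0 invr1.
rewrite big_words exchange_big /=.
apply: (@le_trans _ _ (\sum_(s <- words A k) (k.+1)%:R * q ^- size (undup s))); last first.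
  by rewrite -mulr_sumr factS natrM ler_wpM2l.
rewrite big_seq [X in _ <= X]big_seq; apply: ler_sum => s /size_words sk.
have qi n : 0 <= q ^- n by rewrite invr_ge0 exprn_ge0 // ltW.
rewrite (bigID (fun a => a \in s)) /= -natr1 mulrDl mul1r; apply: lerD.
  apply: (@le_trans _ _ (\sum_(a <- A | a \in s) q ^- size (undup s))).
    by apply: ler_sum => a ->.
  rewrite big_const_seq iter_addr addr0 -[X in X <= _]mulr_natl ler_wpM2r // ler_nat.
  rewrite -sk -size_filter; apply: uniq_leq_size; first exact: filter_uniq.
  by move=> a; rewrite mem_filter => /andP[].
apply: (@le_trans _ _ (\sum_(a <- A) q ^- (size (undup s)).+1)).
  rewrite [X in _ <= X](bigID (fun a => a \in s)) /= -[X in X <= _]add0r; apply: lerD.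
    by apply: sumr_ge0.
  by apply: ler_sum => a /negbTE ->.
rewrite big_const_seq count_predT iter_addr addr0 -[X in X <= _]mulr_natl exprS invfM mulrA.
by rewrite ler_piMl // ler_pdivrMr // mul1r.
Qed.

End Words.

Section Walks.
Implicit Types (x a t : nat) (v u : seq nat).

(** The bipartite edges (row, column) crossed by the walk [x, u1, v1, u2, v2, ...]
    that alternates between rows [v] and columns [u]; they index the monomials in
    the expansion of powers of a Gram matrix. *)
Fixpoint edges x v u : seq (nat * nat) :=
  match v, u with
  | a :: v', t :: u' => (x, t) :: (a, t) :: edges a v' u'
  | _, _ => [::] end.

Fixpoint no_stay x v : bool := if v is a :: v' then (x != a) && no_stay a v' else true.

Lemma size_edges x v u : size v = size u -> size (edges x v u) = (size v).*2.
Proof. by elim: v x u => [|a v IH] x [|t u] //= [h]; rewrite (IH a u h). Qed.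

Lemma mem_edges x v u e : e \in edges x v u -> e.1 \in x :: v /\ e.2 \in u.
Proof.
elim: v x u => [|a v IH] x [|t u] //=; rewrite !inE => /or3P[/eqP ->|/eqP ->|/IH[]] /=.
- by rewrite !eqxx.
- by rewrite !eqxx orbT.
- by rewrite !inE => -> ->; rewrite !orbT.
Qed.

Lemma size_undup_cons (T : eqType) (y : T) (s : seq T) :
  size (undup (y :: s)) = ((y \notin s) + size (undup s))%N.
Proof. by rewrite /=; case: ifP. Qed.

(** A walk explores a connected graph, hence meets at most one vertex more than
    it has edges. *)
Lemma walk_vertices x v u : size v = size u ->
  (size (undup (x :: v)) + size (undup u) <= (size (undup (edges x v u))).+1)%N.
Proof.
elim: v x u => [|a v IH] x [|t u] // [h].
rewrite [edges _ _ _]/=.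
have := IH a u h; set es := edges a v u => {}IH.
have ntu : t \notin u -> (a, t) \notin es.
  by apply: contra => /mem_edges[].
have nxa : x \notin a :: v -> (x, t) \notin (a, t) :: es.
  move=> xav; rewrite inE negb_or; apply/andP; split.
    by apply: contra xav => /eqP[->]; rewrite mem_head.
  by apply: contra xav => /mem_edges[].
rewrite (size_undup_cons x) (size_undup_cons t) (size_undup_cons (x, t)) (size_undup_cons (a, t)).
move: ntu nxa IH; case: (t \notin u); case: (x \notin a :: v);
  case: ((a, t) \notin es); case: ((x, t) \notin _) => h1 h2 /=;
  try (by have := h1 isT); try (by have := h2 isT); lia.
Qed.

(** Since consecutive rows differ, each column is joined to two rows. *)
Lemma walk_columns x v u : size v = size u -> no_stay x v ->
  (2 * size (undup u) <= size (undup (edges x v u)))%N.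
Proof.
elim: v x u => [|a v IH] x [|t u] //= [h] /andP[xa nv].
have := IH a u h nv; set es := edges a v u => {}IH.
case: ifP => tu.
  apply: (leq_trans IH); case: ifP => _; case: ifP => _ //=; lia.
have n1 : (a, t) \notin es by apply/negP => /mem_edges[_ /=]; rewrite tu.
have n2 : (x, t) \notin es by apply/negP => /mem_edges[_ /=]; rewrite tu.
rewrite inE (negbTE n2) orbF (negbTE n1).
have -> : ((x, t) == (a, t)) = false by apply/eqP => -[/eqP]; rewrite (negbTE xa).
by rewrite [size (t :: _)]/= mulnS [size [:: _, _ & _]]/= -[X in (_ <= X)%N]add2n leq_add2l.
Qed.

Lemma sum_count_undup (T : eqType) (s : seq T) :
  (\sum_(e <- undup s) count_mem e s)%N = size s.
Proof.
apply/esym; rewrite -[LHS]sum1_size -big_undup_iterop_count /=; apply: eq_bigr => e _.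
by rewrite Monoid.iteropE iter_addn mul1n addn0.
Qed.

Lemma size_undup_repeated (T : eqType) (s : seq T) :
  (forall e, e \in s -> (2 <= count_mem e s)%N) -> (2 * size (undup s) <= size s)%N.
Proof.
move=> h; rewrite -[X in (_ <= X)%N]sum_count_undup.
rewrite mulnC -[size _]sum1_size big_distrl /= big_seq [X in (_ <= X)%N]big_seq.
by apply: leq_sum => e; rewrite mem_undup mul1n => /h.
Qed.

(** With [r] rows, [c] columns and [E] distinct edges among [2 K] steps, there
    are about [p^r n^c] walks, and [2 (K - E)] factors are left to bound by [b];
    the constraints on the shape turn all this but one [p] into powers of [Q]. *)
Lemma walk_weight (R : realType) (p n Q b : R) (r c E K : nat) :
  1 <= p -> 1 <= n -> 1 <= Q -> 0 <= b -> p <= Q -> p * n <= Q ^+ 2 -> b ^+ 2 <= Q ->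
  (0 < r)%N -> (r + c <= E.+1)%N -> (2 * c <= E)%N -> (E <= K)%N ->
  p ^+ r * n ^+ c * b ^+ (2 * (K - E)) <= p * Q ^+ K.
Proof.
move=> p1 n1 Q1 b0 pQ pnQ bQ r0 rcE cE EK.
have e1 : (2 * (r + (c - r)) = 2 * r + 2 * (c - r))%N by clear; lia.
have e2 : (c < r)%N -> (r = c + (r - c - 1) + 1)%N by clear; lia.
have e3 : (c < r)%N -> (2 * c + (r - c - 1) <= E)%N by move: rcE; clear; lia.
have [p0 n0 Q0] : [/\ 0 <= p, 0 <= n & 0 <= Q] by split; lra.
have h : p ^+ r * n ^+ c <= p * Q ^+ E.
  have nQ : n <= Q ^+ 2 by apply: le_trans pnQ; rewrite ler_peMl //.
  have [rc|cr] := leqP r c.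
    apply: (@le_trans _ _ (Q ^+ (2 * c))).
      rewrite -(subnKC rc) exprD mulrA -exprMn.
      rewrite e1 exprD !exprM; apply: ler_pM.
      - by rewrite exprn_ge0 // mulr_ge0 //.
      - by rewrite exprn_ge0 //.
      - by apply: lerXn2r; rewrite ?nnegrE ?mulr_ge0 ?exprn_ge0 //.
      - by apply: lerXn2r; rewrite ?nnegrE ?exprn_ge0 //.
    apply: (@le_trans _ _ (Q ^+ E)); first by apply: ler_weXn2l.
    by rewrite ler_peMl // exprn_ge0 //.
  have -> : p ^+ r * n ^+ c = p * ((p * n) ^+ c * p ^+ (r - c - 1)).
    have -> : p ^+ r = p ^+ (c + (r - c - 1) + 1) by rewrite -e2.
    by rewrite !exprD expr1 exprMn; ring.
  rewrite ler_wpM2l //.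
  apply: (@le_trans _ _ ((Q ^+ 2) ^+ c * Q ^+ (r - c - 1))).
    apply: ler_pM.
    - by rewrite exprn_ge0 // mulr_ge0 //.
    - by rewrite exprn_ge0 //.
    - by apply: lerXn2r; rewrite ?nnegrE ?mulr_ge0 ?exprn_ge0 //.
    - by apply: lerXn2r; rewrite ?nnegrE //.
  by rewrite -exprM -exprD; apply: ler_weXn2l => //; exact: e3.
apply: (@le_trans _ _ (p * Q ^+ E * Q ^+ (K - E))); last first.
  by rewrite -mulrA -exprD subnKC.
apply: ler_pM => //.
- by rewrite mulr_ge0 // exprn_ge0 //.
- exact: exprn_ge0.
- by rewrite exprM; apply: lerXn2r; rewrite ?nnegrE ?exprn_ge0 //.
Qed.

End Walks.

Section TraceExpansion.
Context (R : realType).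

Definition gram_off (p n : nat) (b : nat * nat -> R) : 'M[R]_p :=
  \matrix_(i < p, j < p) if i == j then 0 else \sum_(0 <= t < n) b (val i, t) * b (val j, t).

Lemma mxpow_gram_off p n b K (x y : 'I_p) :
  mxpow (gram_off p n b) K x y =
  \sum_(v <- words (iota 0 p) K) \sum_(u <- words (iota 0 n) K)
    (last (val x) v == val y)%:R * (no_stay x v)%:R * \prod_(e <- edges x v u) b e.
Proof.
elim: K x => [|K IH] x.
  by rewrite /= !big_seq1 /= big_nil !mulr1 /mxpow /= mxE.
rewrite /mxpow iterS -/(mxpow _ _) mxE big_words.
have -> : iota 0 p = index_iota 0 p by rewrite /index_iota subn0.
rewrite big_mkord; apply: eq_bigr => a _; rewrite IH mulr_sumr.
have -> : index_iota 0 p = iota 0 p by rewrite /index_iota subn0.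
apply: eq_bigr => v _; rewrite big_words mxE.
have [xa|xa] := eqVneq x a.
  rewrite mul0r; apply/esym; rewrite big1 // => t _; rewrite big1 // => u _.
  by rewrite xa /= eqxx mulr0 mul0r.
rewrite mulr_suml /index_iota subn0; apply: eq_bigr => t _.
rewrite mulr_sumr; apply: eq_bigr => u _ /=.
rewrite (inj_eq val_inj) xa /= !big_cons; ring.
Qed.

Lemma trace_gram_off p n b K :
  \tr (mxpow (gram_off p n b) K) =
  \sum_(s <- words (iota 0 p) K.+1) \sum_(u <- words (iota 0 n) K)
    (last (head 0%N s) (behead s) == head 0%N s)%:R * (no_stay (head 0%N s) (behead s))%:R *
    \prod_(e <- edges (head 0%N s) (behead s) u) b e.
Proof.
rewrite /mxtrace big_words.
have -> : iota 0 p = index_iota 0 p by rewrite /index_iota subn0.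
rewrite big_mkord; apply: eq_bigr => x _; rewrite mxpow_gram_off.
by rewrite /index_iota subn0.
Qed.

End TraceExpansion.

Section TraceMoment.
Context (R : realType) d (T : measurableType d) (P : probability T R).
Local Notation Ex := (Ex P).
Local Notation integ := (integ P).
Context (sigma Z : nat * nat -> {RV P >-> R}).
Hypothesis hZ : iid Z.
Hypothesis hindep : independent_fields sigma Z.
Hypothesis hstat : stationary_field sigma.
Hypothesis hsigma_ge0 : forall it w, 0 <= sigma it w.
Hypothesis hmom : forall k, integ (fun w => sigma (0%N, 0%N) w ^+ k).

Definition smom k := Ex (fun w => sigma (0%N, 0%N) w ^+ k).

Lemma sigma_moment e k : integ (fun w => sigma e w ^+ k) /\
  Ex (fun w => sigma e w ^+ k) = smom k.
Proof.
exact: (same_distribution_Ex (sigma_same_distribution hstat e)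
  (@exprn_measurable R setT k) (hmom k)).
Qed.

Lemma smom_ge0 k : 0 <= smom k.
Proof. by apply: Ex_ge0 => w; exact: exprn_ge0. Qed.

(** A crude substitute for Hoelder's inequality: the largest factor dominates. *)
Lemma prod_le_sum_pow (I : eqType) (s : seq I) (x : I -> R) : (forall i, 0 <= x i) ->
  s != [::] -> \prod_(i <- s) x i <= \sum_(i <- s) x i ^+ size s.
Proof.
move=> x0 s0.
have [m ms hm] : exists2 m, m \in s & forall i, i \in s -> x i <= x m.
  elim: s s0 => // a [|c s] IH _; first by exists a; rewrite ?mem_head // => i; rewrite inE => /eqP ->.
  have [//|m ms hm] := IH.
  have [h|h] := leP (x m) (x a).
    exists a; first exact: mem_head.
    by move=> i; rewrite inE => /predU1P[->//|/hm hi]; exact: le_trans h.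
  exists m; first by rewrite inE ms orbT.
  by move=> i; rewrite inE => /predU1P[->|/hm//]; exact: ltW.
apply: (@le_trans _ _ (x m ^+ size s)).
  elim: (s) hm => [|a t IH] hm; first by rewrite big_nil expr0.
  rewrite big_cons exprS ler_pM ?prodr_ge0 ?hm ?mem_head //.
  by apply: IH => i it; apply: hm; rewrite inE it orbT.
by rewrite (big_rem m ms) /= lerDl sumr_ge0 // => i _; exact: exprn_ge0.
Qed.

Lemma sigma_prod (es : seq (nat * nat)) :
  [/\ gmeas (sgen sigma setT) (fun w => \prod_(e <- es) sigma e w),
      integ (fun w => \prod_(e <- es) sigma e w) &
      Ex (fun w => \prod_(e <- es) sigma e w) <= 1 + (size es)%:R * smom (size es)].
Proof.
have gW : gmeas (sgen sigma setT) (fun w => \prod_(e <- es) sigma e w).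
  by apply: gmeas_prod => e _; exact: gmeas_coord.
case: (eqVneq es [::]) => [e0|e0].
  have -> : (fun w => \prod_(e <- es) sigma e w) = cst 1.
    by apply/funext => w; rewrite e0 big_nil.
  split; [|exact: integ_cst|by rewrite Ex_cst e0 mul0r addr0].
  by apply/gmeasP; exact: measurable_cst.
have mW := gmeas_measurable (@sgen_measurable _ _ _ _ _ sigma setT) gW.
have iS : integ (fun w => \sum_(e <- es) sigma e w ^+ size es).
  by apply: integ_sum => e _; case: (sigma_moment e (size es)).
have le w : \prod_(e <- es) sigma e w <= \sum_(e <- es) sigma e w ^+ size es.
  by apply: prod_le_sum_pow.
have iW : integ (fun w => \prod_(e <- es) sigma e w).
  apply: integ_le iS _ => // w; rewrite !ger0_norm ?prodr_ge0 //.
  by apply: sumr_ge0 => e _; exact: exprn_ge0.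
split => //; apply: (le_trans (le_Ex iW iS le)).
rewrite Ex_sum; last by move=> e _; case: (sigma_moment e (size es)).
rewrite (eq_bigr (fun=> smom (size es))); last by move=> e _; case: (sigma_moment e (size es)).
by rewrite big_const_seq count_predT iter_addr addr0 -[X in X <= _]mulr_natl lerDr.
Qed.

Context (zeta : R -> R) (V B : R).
Hypothesis mzeta : measurable_fun setT zeta.
Hypothesis zetaB : forall z, `|zeta z| <= B.
Local Notation z0 := (fun w => zeta (Z (0%N, 0%N) w)).
Hypothesis zeta_mean : Ex z0 = 0.
Hypothesis zeta_var : Ex (fun w => z0 w ^+ 2) <= V.

Let B0 : 0 <= B. Proof. exact: le_trans (normr_ge0 _) (zetaB 0). Qed.

Let mzk k : measurable_fun setT (fun z => zeta z ^+ k).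
Proof. exact: measurable_funX. Qed.

Let mz0 k : measurable_fun setT (fun w => z0 w ^+ k).
Proof. by apply: measurable_funX; exact: measurableT_comp. Qed.

Let iz0 k : integ (fun w => z0 w ^+ k).
Proof.
apply: (@integ_bounded _ _ _ _ _ (B ^+ k)) => // w; rewrite normrX.
by apply: lerXn2r; rewrite ?nnegrE.
Qed.

Let V0 : 0 <= V.
Proof. by apply: le_trans zeta_var; apply: Ex_ge0 => w; exact: sqr_ge0. Qed.

Lemma zeta_moment k : (2 <= k)%N -> `|Ex (fun w => z0 w ^+ k)| <= V * B ^+ (k - 2).
Proof.
move=> k2; apply: le_trans (norm_Ex (iz0 k)) _.
apply: (@le_trans _ _ (Ex (fun w => B ^+ (k - 2) * z0 w ^+ 2))).
  apply: le_Ex; [exact/integ_norm/iz0|exact/integZ/iz0|] => w.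
  rewrite -{1}(subnK k2) exprD normrM [X in _ * X]ger0_norm ?sqr_ge0 //.
  rewrite ler_wpM2r ?sqr_ge0 // normrX.
  by apply: lerXn2r; rewrite ?nnegrE.
by rewrite ExZ // mulrC ler_wpM2r // exprn_ge0.
Qed.

Let b w (e : nat * nat) := sigma e w * zeta (Z e w).

(** Given the volatility, the noise factors along distinct edges are independent,
    and a factor occurring only once integrates to zero. *)
Lemma walk_expectation (es : seq (nat * nat)) :
  integ (fun w => \prod_(e <- es) b w e) /\
  `|Ex (fun w => \prod_(e <- es) b w e)| <=
    (if all (fun e => 2 <= count_mem e es)%N es then
      (1 + (size es)%:R * smom (size es)) * Num.max 1 V ^+ size es *
      B ^+ (size es - 2 * size (undup es)) else 0).
Proof.
have [gW iW EW] := sigma_prod es.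
have W0 : 0 <= Ex (fun w => \prod_(e <- es) sigma e w).
  by apply: Ex_ge0 => w; apply: prodr_ge0.
have E1 w : \prod_(e <- es) b w e =
    \prod_(e <- es) sigma e w * \prod_(e <- undup es) zeta (Z e w) ^+ count_mem e es.
  rewrite /b big_split /=; congr (_ * _); rewrite -big_undup_iterop_count /=.
  exact: eq_bigr.
have [i2 e2] := Ex_sigma_prod_Z hZ hindep (g := fun e z => zeta z ^+ count_mem e es)
  gW iW (undup_uniq es) (fun e => mzk _) (fun e _ => iz0 _).
rewrite (_ : (fun w => \prod_(e <- es) b w e) = fun w => \prod_(e <- es) sigma e w *
   \prod_(e <- undup es) zeta (Z e w) ^+ count_mem e es); last exact/funext.
split => //; rewrite e2 normrM ger0_norm //.
case: ifPn => [/allP h|/allPn[e ees he]]; last first.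
  have -> : \prod_(e <- undup es) Ex (fun w => z0 w ^+ count_mem e es) = 0.
    rewrite (big_rem e) ?mem_undup //=.
    have -> : count_mem e es = 1%N.
      by apply/eqP; rewrite eqn_leq -ltnS ltnNge he /= -has_count has_pred1.
    by rewrite (Ex_eq _ (g := z0)) ?zeta_mean ?mul0r.
  by rewrite normr0 mulr0.
rewrite -mulrA; apply: ler_pM => //.
rewrite normr_prod.
apply: (@le_trans _ _ (\prod_(e <- undup es) (V * B ^+ (count_mem e es - 2)))).
  rewrite [X in X <= _]big_seq [X in _ <= X]big_seq; apply: ler_prod => e; rewrite mem_undup => ees.
  by rewrite normr_ge0 zeta_moment // h.
rewrite big_split /= prodrXr.
have -> : (\sum_(e <- undup es) (count_mem e es - 2) = size es - 2 * size (undup es))%N.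
  rewrite -[X in (X - _)%N]sum_count_undup -[X in (2 * X)%N]sum1_size big_distrr /=.
  rewrite big_seq [X in (X - _)%N]big_seq [X in (_ - X)%N]big_seq -sumnB.
    by apply: eq_bigr => e _; rewrite muln1.
  by move=> e; rewrite mem_undup => /h; rewrite muln1.
rewrite ler_wpM2r ?exprn_ge0 //.
rewrite big_const_seq count_predT iter_mulr mulr1.
apply: (@le_trans _ _ (Num.max 1 V ^+ size (undup es))).
  by apply: lerXn2r; rewrite ?nnegrE ?le_max ?lexx ?V0 ?orbT.
by apply: ler_weXn2l; rewrite ?le_max ?lexx ?size_undup.
Qed.

(** Moment method: walks in which some step is not repeated contribute nothing
    since the noise is centred, and the others are counted by their shape. *)
Lemma trace_moment (p n K : nat) (Q : R) : (0 < p)%N -> (0 < n)%N -> 1 <= Q ->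
  p%:R <= Q -> p%:R * n%:R <= Q ^+ 2 -> B ^+ 2 <= Q ->
  integ (fun w => \tr (mxpow (gram_off p n (b w)) K)) /\
  Ex (fun w => \tr (mxpow (gram_off p n (b w)) K)) <=
    (1 + (K.*2)%:R * smom K.*2) * Num.max 1 V ^+ K.*2 * (K.+1)`!%:R * K`!%:R *
    (p%:R * Q ^+ K).
Proof.
move=> p0 n0 Q1 pQ pnQ BQ.
set C := _ * _ ^+ K.*2.
have C0 : 0 <= C.
  rewrite mulr_ge0 ?exprn_ge0 ?le_max ?ler01 //.
  by rewrite addr_ge0 // mulr_ge0 // smom_ge0.
pose c0 (s : seq nat) : R := (last (head 0%N s) (behead s) == head 0%N s)%:R * (no_stay (head 0%N s) (behead s))%:R.
pose F (s u : seq nat) w := c0 s * \prod_(e <- edges (head 0%N s) (behead s) u) b w e.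
have iF s u : integ (F s u) by apply: integZ; case: (walk_expectation (edges (head 0%N s) (behead s) u)).
have trE w : \tr (mxpow (gram_off p n (b w)) K) =
    \sum_(s <- words (iota 0 p) K.+1) \sum_(u <- words (iota 0 n) K) F s u w.
  by rewrite trace_gram_off.
have iT : integ (fun w => \sum_(s <- words (iota 0 p) K.+1) \sum_(u <- words (iota 0 n) K) F s u w).
  by apply: integ_sum => s _; apply: integ_sum => u _.
rewrite (_ : (fun w => _) = fun w => \sum_(s <- words (iota 0 p) K.+1) \sum_(u <- words (iota 0 n) K) F s u w); last exact/funext.
split => //.
rewrite Ex_sum; last by move=> s _; apply: integ_sum.
have p0' : 0 < p%:R :> R by rewrite ltr0n.
have n0' : 0 < n%:R :> R by rewrite ltr0n.
have pQ0 : 0 <= p%:R * Q ^+ K by rewrite mulr_ge0 // exprn_ge0 //; lra.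
have term s u : s \in words (iota 0 p) K.+1 -> u \in words (iota 0 n) K ->
    Ex (F s u) <= C * (p%:R * Q ^+ K) * (p%:R ^- size (undup s) * n%:R ^- size (undup u)).
  move=> /size_words; case: s => [//|x v] [sv] /size_words su; rewrite /F [head _ _]/= [behead _]/=.
  have rhs0 : 0 <= C * (p%:R * Q ^+ K) * (p%:R ^- size (undup (x :: v)) * n%:R ^- size (undup u)).
    apply: mulr_ge0; first exact: mulr_ge0.
    by apply: mulr_ge0; rewrite invr_ge0; apply: exprn_ge0; exact: ltW.
  have [i1 e1] := walk_expectation (edges x v u).
  rewrite ExZ // /c0 [head _ _]/= [behead _]/=.
  case: (boolP (no_stay x v)) => [ns|_]; last by rewrite mulr0 mul0r.
  rewrite mulr1; apply: (@le_trans _ _ `|Ex (fun w => \prod_(e <- edges x v u) b w e)|).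
    by case: (_ == _); rewrite ?mul1r ?mul0r ?ler_norm.
  apply: (le_trans e1); case: ifPn => [h|//].
  have svu : size v = size u by rewrite sv su.
  rewrite size_edges // sv -/C -mulrA ler_wpM2l //.
  rewrite -invfM ler_pdivlMr ?mulr_gt0 ?exprn_gt0 // mulrC.
  have -> : (K.*2 - 2 * size (undup (edges x v u)) = 2 * (K - size (undup (edges x v u))))%N.
    by rewrite -mul2n mulnBr.
  apply: walk_weight => //.
  - by rewrite ler1n.
  - by rewrite ler1n.
  - by rewrite lt0n size_eq0; apply: contraTneq (mem_head x v) => h0; rewrite -mem_undup h0.
  - exact: walk_vertices.
  - exact: walk_columns.
  - have := size_undup_repeated (fun e ee => allP h e ee).
    by rewrite size_edges // sv -mul2n leq_pmul2l.
apply: (@le_trans _ _ (\sum_(s <- words (iota 0 p) K.+1) \sum_(u <- words (iota 0 n) K)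
    C * (p%:R * Q ^+ K) * (p%:R ^- size (undup s) * n%:R ^- size (undup u)))).
  rewrite big_seq [X in _ <= X]big_seq; apply: ler_sum => s hs.
  rewrite Ex_sum; last by [].
  rewrite big_seq [X in _ <= X]big_seq; apply: ler_sum => u hu.
  exact: term.
pose S1 : R := \sum_(s <- words (iota 0 p) K.+1) p%:R ^- size (undup s).
pose S2 : R := \sum_(u <- words (iota 0 n) K) n%:R ^- size (undup u).
rewrite (eq_bigr (fun s => C * (p%:R * Q ^+ K) * (p%:R ^- size (undup s) * S2))); last first.
  by move=> s _; rewrite -!mulr_sumr.
rewrite -mulr_sumr -mulr_suml -/S1.
have -> : C * (K.+1)`!%:R * K`!%:R * (p%:R * Q ^+ K) =
   C * (p%:R * Q ^+ K) * ((K.+1)`!%:R * K`!%:R) by ring.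
rewrite ler_wpM2l //; first by rewrite mulr_ge0.
apply: ler_pM.
- by apply: sumr_ge0 => s _; rewrite invr_ge0 exprn_ge0.
- by apply: sumr_ge0 => s _; rewrite invr_ge0 exprn_ge0.
- by apply: sum_words_weight; rewrite ?iota_uniq ?size_iota.
- by apply: sum_words_weight; rewrite ?iota_uniq ?size_iota.
Qed.

End TraceMoment.

(** * Second moments of off-diagonal Gram entries *)

Section CrossOff.
Context (R : realType).

Definition cross_off (p n : nat) (a b : nat * nat -> R) : 'M[R]_p :=
  \matrix_(i < p, j < p) if i == j then 0 else \sum_(0 <= t < n) a (val i, t) * b (val j, t).

Definition frob (p : nat) (M : 'M[R]_p) : R := \sum_i \sum_j M i j ^+ 2.

End CrossOff.

Section SecondMoment.
Context (R : realType) d (T : measurableType d) (P : probability T R).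
Local Notation Ex := (Ex P).
Local Notation integ := (integ P).
Context (sigma Z : nat * nat -> {RV P >-> R}).
Hypothesis hZ : iid Z.
Hypothesis hindep : independent_fields sigma Z.
Hypothesis hstat : stationary_field sigma.
Hypothesis hsigma_ge0 : forall it w, 0 <= sigma it w.
Hypothesis hmom : forall k, integ (fun w => sigma (0%N, 0%N) w ^+ k).
Context (u v : R -> R).
Hypothesis (mu : measurable_fun setT u) (mv : measurable_fun setT v).
Local Notation u0 := (fun w => u (Z (0%N, 0%N) w)).
Local Notation v0 := (fun w => v (Z (0%N, 0%N) w)).
Hypothesis (iu : integ (fun w => u0 w ^+ 2)) (iv : integ (fun w => v0 w ^+ 2)).

Lemma integ_of_sq (f : T -> R) : measurable_fun setT f -> integ (fun w => f w ^+ 2) -> integ f.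
Proof.
move=> mf i2; apply: (integ_le mf (integD (integ_cst P 1) i2)) => w.
rewrite [X in _ <= X]ger0_norm ?addr_ge0 ?sqr_ge0 //.
rewrite -[X in _ + X]real_normK ?num_real //.
by have := sqr_ge0 (`|f w| - 1); have := normr_ge0 (f w); nra.
Qed.

Let iu1 : integ u0. Proof. by apply: integ_of_sq iu; exact: measurableT_comp. Qed.
Let iv1 : integ v0. Proof. by apply: integ_of_sq iv; exact: measurableT_comp. Qed.

Let a w (e : nat * nat) := sigma e w * u (Z e w).
Let b w (e : nat * nat) := sigma e w * v (Z e w).
Let C4 : R := 1 + 4 * smom sigma 4.
Let E2 := Ex (fun w => u0 w ^+ 2) * Ex (fun w => v0 w ^+ 2).
Let E1 := Ex u0 ^+ 2 * Ex v0 ^+ 2.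

Let C40 : 0 <= C4. Proof. by rewrite addr_ge0 // mulr_ge0 // smom_ge0. Qed.
Let E20 : 0 <= E2.
Proof. by apply: mulr_ge0; apply: Ex_ge0 => w; exact: sqr_ge0. Qed.
Let E10 : 0 <= E1. Proof. by rewrite mulr_ge0 ?sqr_ge0. Qed.

(** For distinct rows, the four factors involve two noise variables twice when
    [t = s], and four distinct noise variables otherwise. *)
Lemma quadruple_expectation i j t s : i != j ->
  integ (fun w => a w (i, t) * b w (j, t) * (a w (i, s) * b w (j, s))) /\
  Ex (fun w => a w (i, t) * b w (j, t) * (a w (i, s) * b w (j, s))) <=
    C4 * (if t == s then E2 else E1).
Proof.
move=> ij; pose es := [:: (i, t); (j, t); (i, s); (j, s)].
have [gW iW EW] := sigma_prod hstat hsigma_ge0 hmom es.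
have W0 : 0 <= Ex (fun w => \prod_(e <- es) sigma e w).
  by apply: Ex_ge0 => w; apply: prodr_ge0.
have ji : (j == i) = false by rewrite eq_sym (negbTE ij).
case: (eqVneq t s) => [ts|ts].
  pose g (e : nat * nat) z := (if e.1 == i then u z else v z) ^+ 2.
  have mg e : measurable_fun setT (g e).
    by rewrite /g; case: (e.1 == i); exact: measurable_funX.
  have [i2 e2] := Ex_sigma_prod_Z hZ hindep (s := [:: (i, t); (j, t)]) (g := g) gW iW
    ltac:(by rewrite /= inE xpair_eqE (negbTE ij)) mg
    ltac:(by move=> e _; rewrite /g; case: (e.1 == i)).
  have E : (fun w => a w (i, t) * b w (j, t) * (a w (i, s) * b w (j, s))) =
     fun w => (\prod_(e <- es) sigma e w) * \prod_(e <- [:: (i, t); (j, t)]) g e (Z e w).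
    by apply/funext => w; rewrite /es !big_cons !big_nil /g /= eqxx ji -ts /a /b; ring.
  rewrite E; split => //; rewrite e2 !big_cons !big_nil /g /= eqxx ji mulr1.
  by rewrite ler_wpM2r.
pose g (e : nat * nat) z := if e.1 == i then u z else v z.
have mg e : measurable_fun setT (g e) by rewrite /g; case: (e.1 == i).
have [i2 e2] := Ex_sigma_prod_Z hZ hindep (s := es) (g := g) gW iW
    ltac:(by rewrite /es /= !inE !xpair_eqE ji (negbTE ij) (negbTE ts) !eqxx !andbF) mg
    ltac:(by move=> e _; rewrite /g; case: (e.1 == i)).
have E : (fun w => a w (i, t) * b w (j, t) * (a w (i, s) * b w (j, s))) =
     fun w => (\prod_(e <- es) sigma e w) * \prod_(e <- es) g e (Z e w).
  by apply/funext => w; rewrite /es !big_cons !big_nil /g /= eqxx ji /a /b; ring.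
rewrite E; split => //; rewrite e2 /es !big_cons !big_nil /g /= eqxx ji mulr1.
have -> : Ex u0 * (Ex v0 * (Ex u0 * Ex v0)) = E1 by rewrite /E1; ring.
by rewrite ler_wpM2r.
Qed.

Lemma cross_entry_moment n i j : i != j ->
  integ (fun w => (\sum_(0 <= t < n) a w (i, t) * b w (j, t)) ^+ 2) /\
  Ex (fun w => (\sum_(0 <= t < n) a w (i, t) * b w (j, t)) ^+ 2) <=
    C4 * (n%:R * E2 + n%:R ^+ 2 * E1).
Proof.
move=> ij; pose q t s w := a w (i, t) * b w (j, t) * (a w (i, s) * b w (j, s)).
have iq t s : integ (q t s) by case: (quadruple_expectation t s ij).
have e : (fun w => (\sum_(0 <= t < n) a w (i, t) * b w (j, t)) ^+ 2) =
    fun w => \sum_(0 <= t < n) \sum_(0 <= s < n) q t s w.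
  apply/funext => w; rewrite expr2 mulr_suml; apply: eq_bigr => t _.
  by rewrite mulr_sumr.
have iS : integ (fun w => \sum_(0 <= t < n) \sum_(0 <= s < n) q t s w).
  by apply: integ_sum => t _; apply: integ_sum.
rewrite e; split => //; rewrite Ex_sum; last by move=> t _; exact: integ_sum.
apply: (@le_trans _ _ (\sum_(0 <= t < n) C4 * (E2 + n%:R * E1))); last first.
  rewrite sumr_const_nat subn0 -[X in X <= _]mulr_natl expr2.
  by rewrite le_eqVlt; apply/orP; left; apply/eqP; ring.
apply: ler_sum_nat => t /andP[_ tn]; rewrite Ex_sum //.
apply: (@le_trans _ _ (\sum_(0 <= s < n) C4 * ((if t == s then E2 else 0) + E1))).
  apply: ler_sum_nat => s _; have [_] := quadruple_expectation t s ij.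
  move=> h; apply: (le_trans h); rewrite ler_wpM2l //.
  by case: ifP => _; rewrite ?lerDl ?add0r.
rewrite -mulr_sumr ler_wpM2l // big_split /= sumr_const_nat subn0 -[E1 *+ n]mulr_natl.
rewrite lerD2r big_mkord (bigD1 (Ordinal tn)) //= eqxx big1 ?addr0 // => s.
by rewrite -val_eqE /= eq_sym => /negbTE ->.
Qed.

Lemma frob_cross_moment p n :
  integ (fun w => frob (cross_off p n (a w) (b w))) /\
  Ex (fun w => frob (cross_off p n (a w) (b w))) <=
    C4 * (p%:R ^+ 2 * n%:R * E2 + p%:R ^+ 2 * n%:R ^+ 2 * E1).
Proof.
have h (i j : 'I_p) : integ (fun w => cross_off p n (a w) (b w) i j ^+ 2) /\
    Ex (fun w => cross_off p n (a w) (b w) i j ^+ 2) <= C4 * (n%:R * E2 + n%:R ^+ 2 * E1).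
  case: (eqVneq i j) => [ij|ij].
    have -> : (fun w => cross_off p n (a w) (b w) i j ^+ 2) = cst 0.
      by apply/funext => w; rewrite mxE ij eqxx expr0n.
    split; first exact: integ_cst.
    by rewrite Ex_cst mulr_ge0 // addr_ge0 // mulr_ge0 // exprn_ge0.
  rewrite (_ : (fun w => _) = fun w => (\sum_(0 <= t < n) a w (val i, t) * b w (val j, t)) ^+ 2).
    exact: cross_entry_moment.
  by apply/funext => w; rewrite mxE (negbTE ij).
have iF (i : 'I_p) : integ (fun w => \sum_j cross_off p n (a w) (b w) i j ^+ 2).
  by apply: integ_sum => j _; case: (h i j).
split; first by apply: integ_sum.
rewrite Ex_sum //.
apply: (@le_trans _ _ (\sum_(i < p) \sum_(j < p) C4 * (n%:R * E2 + n%:R ^+ 2 * E1))).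
  apply: ler_sum => i _; rewrite Ex_sum; last by move=> j _; case: (h i j).
  by apply: ler_sum => j _; case: (h i j).
rewrite !sumr_const !card_ord -mulrnA -[X in X <= _]mulr_natl natrM.
by rewrite le_eqVlt; apply/orP; left; apply/eqP; ring.
Qed.

End SecondMoment.

(** * Partial sums of mixing sequences *)

Section Staircase.
Context (R : realType) d (T : measurableType d) (P : probability T R).
Local Notation Ex := (Ex P).
Local Notation integ := (integ P).

(** A combination of indicators of half-lines: composed with a random variable,
    it becomes a combination of indicators of events. *)
Definition staircase (N : nat) (x : R) : R :=
  N%:R^-1 * \sum_(k < N) (k.+1%:R / N%:R <= x)%R%:R.

Lemma staircase_approx N x : (0 < N)%N -> 0 <= x <= 1 ->
  [/\ 0 <= staircase N x, staircase N x <= x & x <= staircase N x + N%:R^-1].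
Proof.
move=> N0 /andP[x0 x1]; have Np : 0 < N%:R :> R by rewrite ltr0n.
pose m := Num.truncn (N%:R * x).
have xN0 : 0 <= N%:R * x by rewrite mulr_ge0 // ltW.
have /andP[m1 m2] := truncn_itv xN0.
have mN : (m <= N)%N.
  by rewrite -(ler_nat R); apply: le_trans m1 _; rewrite ler_piMr // ltW.
have e : staircase N x = m%:R / N%:R.
  rewrite /staircase mulrC; congr (_ / _).
  have -> : \sum_(k < N) (k.+1%:R / N%:R <= x)%R%:R = \sum_(k < N) (k < m)%N%:R :> R.
    apply: eq_bigr => k _; congr (_%:R); congr nat_of_bool.
    rewrite ler_pdivrMr // mulrC; apply/idP/idP => h.
      by rewrite -ltnS -(ltr_nat R); apply: le_lt_trans h m2.
    by apply: le_trans m1; rewrite ler_nat.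
  rewrite -natr_sum; congr (_%:R).
  rewrite -(big_mkord xpredT (fun k => (k < m)%N : nat)) (big_cat_nat (n := m)) //=.
  rewrite [X in (X + _)%N](eq_big_nat _ _ (F2 := fun=> 1%N)); last by move=> k /andP[_ ->].
  rewrite [X in (_ + X)%N](eq_big_nat _ _ (F2 := fun=> 0%N)); last first.
    by move=> k /andP[h _]; rewrite ltnNge h.
  by rewrite sum_nat_const_nat subn0 muln1 sum_nat_const_nat muln0 addn0.
rewrite e; split.
- by rewrite divr_ge0 // ltW.
- by rewrite ler_pdivrMr // mulrC.
- rewrite -[X in _ + X]div1r -mulrDl ler_pdivlMr // mulrC natr1.
  exact: ltW.
Qed.

Lemma measurable_staircase N : measurable_fun setT (staircase N).
Proof.
apply: measurable_funM => //; apply: measurable_sum => k.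
rewrite (_ : (fun x => _) = fun x => if k.+1%:R / N%:R <= x then 1 else 0 : R).
  apply: measurable_fun_ifT => //; exact: measurable_fun_ler.
by apply/funext => x; case: (_ <= x).
Qed.

(** Quantizing two [0,1]-valued variables reduces their covariance to those of
    their level sets. *)
Lemma covariance_levels (U V : T -> R) (al : R) :
  measurable_fun setT U -> measurable_fun setT V ->
  (forall w, 0 <= U w <= 1) -> (forall w, 0 <= V w <= 1) ->
  (forall x y, `|fine (P ([set w | x <= U w] `&` [set w | y <= V w])) -
    fine (P [set w | x <= U w]) * fine (P [set w | y <= V w])| <= al) ->
  `|Ex (fun w => U w * V w) - Ex U * Ex V| <= al.
Proof.
move=> mU mV U01 V01 hal.
have mAx (W : T -> R) x : measurable_fun setT W -> measurable [set w | x <= W w].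
  by move=> mW; rewrite -[X in measurable X]setTI; exact: measurable_fun_ler.
have step N : (0 < N)%N -> `|Ex (fun w => U w * V w) - Ex U * Ex V| <= al + 4 * N%:R^-1.
  move=> N0; have Np : 0 < N%:R :> R by rewrite ltr0n.
  pose UN w := staircase N (U w); pose VN w := staircase N (V w).
  have mUN : measurable_fun setT UN by apply: measurableT_comp mU; exact: measurable_staircase.
  have mVN : measurable_fun setT VN by apply: measurableT_comp mV; exact: measurable_staircase.
  have aU w := staircase_approx N0 (U01 w); have aV w := staircase_approx N0 (V01 w).
  have bd (f : T -> R) : measurable_fun setT f -> (forall w, 0 <= f w <= 1) -> integ f.
    move=> mf hf; apply: (@integ_bounded _ _ _ _ _ 1) => // w.
    by have /andP[h1 h2] := hf w; rewrite ger0_norm.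
  have UN01 w : 0 <= UN w <= 1 by case: (aU w); rewrite -/(UN w); have := U01 w; lra.
  have VN01 w : 0 <= VN w <= 1 by case: (aV w); rewrite -/(VN w); have := V01 w; lra.
  have iU := bd U mU U01; have iV := bd V mV V01.
  have iUN := bd _ mUN UN01; have iVN := bd _ mVN VN01.
  have pr (f g : T -> R) : (forall w, 0 <= f w <= 1) -> (forall w, 0 <= g w <= 1) ->
      forall w, 0 <= f w * g w <= 1.
    by move=> hf hg w; have := hf w; have := hg w; nra.
  have iUV := bd _ (measurable_funM mU mV) (pr _ _ U01 V01).
  have iUVN := bd _ (measurable_funM mUN mVN) (pr _ _ UN01 VN01).
  have iN : N%:R^-1 <= 1 :> R by rewrite invf_le1 // ler1n.
  have iN0 : 0 < N%:R^-1 :> R by rewrite invr_gt0.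
  have cN : `|Ex (fun w => UN w * VN w) - Ex UN * Ex VN| <= al.
    pose A k := [set w | k.+1%:R / N%:R <= U w].
    pose B k := [set w | k.+1%:R / N%:R <= V w].
    have mA k : measurable (A k) by exact: mAx.
    have mB k : measurable (B k) by exact: mAx.
    have eU : UN = fun w => N%:R^-1 * \sum_(k < N) \1_(A k) w.
      apply/funext => w; congr (_ * _); apply: eq_bigr => k _.
      by rewrite indicE; congr (_%:R); congr nat_of_bool; apply/idP/idP; rewrite inE.
    have eV : VN = fun w => N%:R^-1 * \sum_(k < N) \1_(B k) w.
      apply/funext => w; congr (_ * _); apply: eq_bigr => k _.
      by rewrite indicE; congr (_%:R); congr nat_of_bool; apply/idP/idP; rewrite inE.
    have iS (C : nat -> set T) : (forall k, measurable (C k)) ->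
        integ (fun w => \sum_(k < N) \1_(C k) w).
      by move=> mC; apply: integ_sum => k _; exact: integ_indic.
    have ES (C : nat -> set T) : (forall k, measurable (C k)) ->
        Ex (fun w => N%:R^-1 * \sum_(k < N) \1_(C k) w) = N%:R^-1 * \sum_(k < N) fine (P (C k)).
      move=> mC; rewrite ExZ; last exact: iS.
      rewrite Ex_sum; last by move=> k _; exact: integ_indic.
      by congr (_ * _); apply: eq_bigr => k _; rewrite Ex_indic.
    have eUV : (fun w => UN w * VN w) = fun w => N%:R^-1 ^+ 2 *
        \sum_(k < N) \sum_(l < N) \1_(A k `&` B l) w.
      apply/funext => w; rewrite eU eV mulrACA -expr2; congr (_ * _).
      rewrite mulr_suml; apply: eq_bigr => k _; rewrite mulr_sumr.
      by apply: eq_bigr => l _; rewrite indicI.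
    rewrite eUV eU eV !ES // ExZ; last first.
      by apply: integ_sum => k _; apply: integ_sum => l _; apply: integ_indic; exact: measurableI.
    rewrite Ex_sum; last first.
      by move=> k _; apply: integ_sum => l _; apply: integ_indic; exact: measurableI.
    rewrite mulrACA -expr2 -mulrBr mulr_suml -sumrB normrM.
    rewrite ger0_norm; last by rewrite exprn_ge0 // ltW.
    apply: (@le_trans _ _ (N%:R^-1 ^+ 2 * \sum_(k < N) \sum_(l < N) al)).
      rewrite ler_wpM2l ?exprn_ge0 //.
      apply: le_trans (ler_norm_sum _ _ _) _; apply: ler_sum => k _.
      rewrite Ex_sum; last by move=> l _; apply: integ_indic; exact: measurableI.
      rewrite mulr_sumr -sumrB; apply: le_trans (ler_norm_sum _ _ _) _.
      apply: ler_sum => l _; rewrite Ex_indic; last exact: measurableI.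
      exact: hal.
    rewrite !sumr_const !card_ord -mulrnA -[al *+ _]mulr_natl natrM mulrA exprVn -expr2 mulVf ?mul1r //.
    by rewrite expf_neq0 // gt_eqF.
  have d1 : Ex (fun w => U w * V w) <= Ex (fun w => UN w * VN w) + 2 * N%:R^-1.
    rewrite -[X in _ + X](Ex_cst P) -ExD //; last exact: integ_cst.
    apply: le_Ex => // [|w]; first by apply: integD => //; exact: integ_cst.
    by have [h1 h2 h3] := aU w; have [h4 h5 h6] := aV w; rewrite -/(UN w) -/(VN w) in h1 h2 h3 h4 h5 h6 *;
      have := U01 w; have := V01 w; nra.
  have d2 : Ex (fun w => UN w * VN w) <= Ex (fun w => U w * V w).
    apply: le_Ex => // w.
    by have [h1 h2 h3] := aU w; have [h4 h5 h6] := aV w; exact: ler_pM.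
  have d3 : Ex UN <= Ex U by apply: le_Ex => // w; case: (aU w).
  have d4 : Ex VN <= Ex V by apply: le_Ex => // w; case: (aV w).
  have d5 : Ex U <= Ex UN + N%:R^-1.
    rewrite -[X in _ + X](Ex_cst P) -ExD //; last exact: integ_cst.
    apply: le_Ex => // [|w]; first by apply: integD => //; exact: integ_cst.
    by case: (aU w).
  have d6 : Ex V <= Ex VN + N%:R^-1.
    rewrite -[X in _ + X](Ex_cst P) -ExD //; last exact: integ_cst.
    apply: le_Ex => // [|w]; first by apply: integD => //; exact: integ_cst.
    by case: (aV w).
  have le1 (f : T -> R) : integ f -> (forall w, 0 <= f w <= 1) -> 0 <= Ex f <= 1.
    move=> fi hf; apply/andP; split; first by apply: Ex_ge0 => w; case/andP: (hf w).
    rewrite -[X in _ <= X](Ex_cst P); apply: le_Ex => // [|w]; first exact: integ_cst.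
    by case/andP: (hf w).
  have /andP[u0 u1] := le1 _ iU U01; have /andP[v0 v1] := le1 _ iV V01.
  have /andP[u0' u1'] := le1 _ iUN UN01; have /andP[v0' v1'] := le1 _ iVN VN01.
  move: cN; rewrite !ler_norml => /andP[c1 c2].
  have p1 : Ex UN * Ex VN <= Ex U * Ex V by exact: ler_pM.
  have p2 : Ex U * Ex V <= Ex UN * Ex VN + 2 * N%:R^-1 by nra.
  by apply/andP; move: c1 c2 p1 p2 d1 d2 iN0; clear; split; lra.
apply/ler_addgt0Pr => e e0.
have := step (Num.truncn (4 / e)).+1 isT => h; apply: (le_trans h).
rewrite lerD2l ler_pdivrMr ?ltr0n // mulrC -ler_pdivrMr //.
by apply/ltW; apply: truncnS_gt.
Qed.

End Staircase.

Section MixingVariance.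
Context (R : realType) d (T : measurableType d) (P : probability T R).
Local Notation Ex := (Ex P).
Local Notation integ := (integ P).

(** The level sets of [f (Y s)] belong to the past of [s], and those of [f (Y t)]
    to the future of [t]. *)
Lemma mixing_covariance (Y : nat -> {RV P >-> R}) (f : R -> R) s t :
  measurable_fun setT f -> (forall x, 0 <= f x <= 1) -> (s < t)%N ->
  `|Ex (fun w => f (Y s w) * f (Y t w)) - Ex (fun w => f (Y s w)) * Ex (fun w => f (Y t w))|
    <= mixing_coef Y (t - s).
Proof.
move=> mf f01 st; apply: covariance_levels => //.
- exact: measurableT_comp.
- exact: measurableT_comp.
move=> x y; apply: sup_upper_bound.
  split; first by exists `|fine (P (set0 `&` set0)) - fine (P set0) * fine (P set0)|,
    0%N, set0, set0; split => //; exact: (@sigma_algebra0 _ setT).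
  exists 1 => _ [m [A [B [hA hB ->]]]].
  have mA : measurable A by exact: sigma_gen_measurable hA.
  have mB : measurable B by exact: sigma_gen_measurable hB.
  have pr C : measurable C -> 0 <= fine (P C) <= 1.
    move=> mC; rewrite fine_ge0 //= -lee_fin fineK ?fin_num_measure //.
    exact: probability_le1.
  have := pr _ mA; have := pr _ mB; have := pr _ (measurableI _ _ mA mB).
  move=> /andP[h1 h2] /andP[h3 h4] /andP[h5 h6]; rewrite ler_norml.
  by apply/andP; split; nra.
exists s, [set w | x <= f (Y s w)], [set w | y <= f (Y t w)]; split => //.
  have -> : [set w | x <= f (Y s w)] = Y s @^-1` (f @^-1` `[x, +oo[%classic).
    by apply/seteqP; split => w /=; rewrite in_itv /= andbT.
  apply: sub_sigma_algebra; exists s, (f @^-1` `[x, +oo[%classic); split => //=.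
  by rewrite -[X in measurable X]setTI; apply: mf => //; exact: measurable_itv.
have -> : [set w | y <= f (Y t w)] = Y t @^-1` (f @^-1` `[y, +oo[%classic).
  by apply/seteqP; split => w /=; rewrite in_itv /= andbT.
apply: sub_sigma_algebra; exists t, (f @^-1` `[y, +oo[%classic); split => //=.
  by rewrite subnKC // ltnW.
by rewrite -[X in measurable X]setTI; apply: mf => //; exact: measurable_itv.
Qed.

Lemma harmonic_le_ln n : \sum_(0 <= k < n) (k.+1%:R)^-1 <= 1 + ln n%:R :> R.
Proof.
elim: n => [|n IH]; first by rewrite big_geq // addr_ge0 // ln0.
rewrite big_nat_recr //=.
case: n IH => [|n] IH; first by rewrite big_geq // add0r invr1 ln1 addr0.
have h : n.+2%:R^-1 <= ln n.+2%:R - ln n.+1%:R :> R.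
  rewrite -ln_div ?posrE ?ltr0n //.
  rewrite -[X in X <= _]expRK ler_ln ?posrE ?expR_gt0 ?divr_gt0 ?ltr0n //.
  rewrite ler_pdivlMr ?ltr0n //.
  have e0 := expR_gt0 (n.+2%:R^-1 : R).
  have := expR_ge1Dx (- n.+2%:R^-1 : R); rewrite expRN => h.
  have h1 : (1 - n.+2%:R^-1) * expR n.+2%:R^-1 <= 1 :> R.
    by move: h; rewrite -(ler_pM2r e0) mulVf // gt_eqF.
  have n2 : 0 < n.+2%:R :> R by rewrite ltr0n.
  have -> : n.+1%:R = (1 - n.+2%:R^-1) * n.+2%:R :> R.
    by rewrite mulrBl mulVf ?gt_eqF // mul1r -[n.+2%:R]natr1 addrK.
  by rewrite mulrA [_ * (1 - _)]mulrC ler_piMl // ltW.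
by apply: (le_trans (lerD IH h)); rewrite -addrA lerD2l addrC subrK.
Qed.

(** Covariances at distance [j] are at most [c / j], whence the harmonic sum. *)
Lemma mixing_variance (Y : nat -> {RV P >-> R}) (f : R -> R) (c m : R) n :
  measurable_fun setT f -> (forall x, 0 <= f x <= 1) -> 0 <= c ->
  (forall t, Ex (fun w => f (Y t w)) = m) ->
  (forall j, (0 < j)%N -> mixing_coef Y j <= c / j%:R) ->
  Ex (fun w => (\sum_(0 <= t < n) (f (Y t w) - m)) ^+ 2) <=
    n%:R * (1 + 2 * c * (1 + ln n%:R)).
Proof.
move=> mf f01 c0 hm hmix.
have mfY t : measurable_fun setT (fun w => f (Y t w)) by exact: measurableT_comp.
have bd (g : T -> R) (B : R) : measurable_fun setT g -> (forall w, `|g w| <= B) -> integ g.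
  by move=> mg hg; exact: (@integ_bounded _ _ _ P g B mg hg).
have ifY t : integ (fun w => f (Y t w)).
  by apply: (bd _ 1) => // w; have := f01 (Y t w); rewrite ler_norml => /andP[? ?]; apply/andP; split; lra.
have m01 : 0 <= m <= 1.
  rewrite -(hm 0%N); apply/andP; split; first by apply: Ex_ge0 => w; case/andP: (f01 (Y 0%N w)).
  rewrite -[X in _ <= X](Ex_cst P); apply: le_Ex => // [|w]; first exact: integ_cst.
  by case/andP: (f01 (Y 0%N w)).
pose x t w := f (Y t w) - m.
have mx t : measurable_fun setT (x t) by exact: measurable_funB.
have xb t w : `|x t w| <= 1.
  rewrite /x ler_norml; have /andP[? ?] := f01 (Y t w); have /andP[? ?] := m01.
  by apply/andP; split; lra.
have ixx s t : integ (fun w => x s w * x t w).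
  apply: (bd _ 1); first exact: measurable_funM.
  by move=> w; rewrite normrM; apply: mulr_ile1.
have cov s t : (s < t)%N -> Ex (fun w => x s w * x t w) <= c / (t - s)%:R.
  move=> st; apply: le_trans (hmix _ _); last by rewrite subn_gt0.
  apply: le_trans (mixing_covariance Y mf f01 st); apply: le_trans (ler_norm _).
  have iff' : integ (fun w => f (Y s w) * f (Y t w)).
    apply: (bd _ 1); first exact: measurable_funM.
    move=> w; have /andP[? ?] := f01 (Y s w); have /andP[? ?] := f01 (Y t w).
    by rewrite ger0_norm ?mulr_ge0 //; exact: mulr_ile1.
  rewrite (Ex_eq _ (g := fun w => f (Y s w) * f (Y t w) - (m * f (Y s w) + (m * f (Y t w) - m ^+ 2)))).
    have i1 : integ (fun w => m * f (Y s w)) by exact: integZ.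
    have i2 : integ (fun w => m * f (Y t w)) by exact: integZ.
    have i3 : integ (fun w => m * f (Y t w) - m ^+ 2) by apply: integB i2 _; exact: integ_cst.
    rewrite ExB //; last exact: integD i1 i3.
    rewrite ExD // ExB //; last exact: integ_cst.
    rewrite Ex_cst !ExZ // !hm.
    by rewrite le_eqVlt; apply/orP; left; apply/eqP; ring.
  by move=> w; rewrite /x; ring.
have iS n' : integ (fun w => (\sum_(0 <= t < n') x t w) ^+ 2).
  rewrite (_ : (fun w => _) = fun w => \sum_(0 <= s < n') \sum_(0 <= t < n') x s w * x t w).
    by apply: integ_sum => s _; apply: integ_sum.
  by apply/funext => w; rewrite expr2 mulr_suml; apply: eq_bigr => s _; rewrite mulr_sumr.
elim: n => [|n IH].
  rewrite mul0r (Ex_eq _ (g := fun=> 0)) ?Ex_cst // => w.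
  by rewrite big_geq // expr0n.
have iSx : integ (fun w => \sum_(0 <= t < n) x t w * x n w) by apply: integ_sum.
rewrite (Ex_eq _ (g := fun w => (\sum_(0 <= t < n) x t w) ^+ 2 +
   (2 * (\sum_(0 <= t < n) x t w * x n w) + x n w * x n w))); last first.
  move=> w; transitivity ((\sum_(0 <= t < n) x t w + x n w) ^+ 2).
    by rewrite -(big_nat_recr n 0 (fun t => x t w)).
  rewrite -mulr_suml; move: (\sum_(0 <= t < n) x t w) (x n w) => a b; ring.
rewrite ExD //; last by apply: integD => //; exact: integZ.
rewrite ExD //; last exact: integZ.
rewrite ExZ // Ex_sum //.
have h1 : \sum_(0 <= t < n) Ex (fun w => x t w * x n w) <= c * (1 + ln n%:R).
  apply: (@le_trans _ _ (\sum_(0 <= t < n) c / (n - t)%:R)).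
    by apply: ler_sum_nat => t /andP[_ tn]; exact: cov.
  rewrite big_nat_rev /= add0n -mulr_sumr ler_wpM2l //.
  apply: le_trans (harmonic_le_ln n); apply: ler_sum_nat => t /andP[_ tn].
  by rewrite subnBA // addnC addnK.
have h2 : Ex (fun w => x n w * x n w) <= 1.
  rewrite -[X in _ <= X](Ex_cst P); apply: le_Ex => // [|w]; first exact: integ_cst.
  by apply: le_trans (ler_norm _) _; rewrite normrM; apply: mulr_ile1.
have l1 : ln n%:R <= ln n.+1%:R :> R.
  case: n {IH iSx h1 h2} => [|n]; first by rewrite ln0 // ln1.
  by rewrite ler_ln ?posrE ?ltr0n // ler_nat.
have l0 : 0 <= ln n.+1%:R :> R by apply: ln_ge0; rewrite ler1n.
have n0 : 0 <= n%:R :> R by [].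
have eX (X : R) : n.+1%:R * X = n%:R * X + X by rewrite -natr1 mulrDl mul1r.
have k1 : 2 * c * (1 + ln n%:R) <= 2 * c * (1 + ln n.+1%:R).
  by rewrite ler_wpM2l ?mulr_ge0 // lerD2l.
have k2 : n%:R * (1 + 2 * c * (1 + ln n%:R)) <= n%:R * (1 + 2 * c * (1 + ln n.+1%:R)).
  by rewrite ler_wpM2l // lerD2l.
rewrite eX; apply: lerD; first exact: le_trans IH k2.
rewrite addrC; apply: lerD => //; apply: le_trans k1.
by rewrite -mulrA ler_pM2l.
Qed.

End MixingVariance.

(** * Large deviations of the row sums *)

Section ProbTools.
Context (R : realType) d (T : measurableType d) (P : probability T R).
Local Notation Ex := (Ex P).
Local Notation integ := (integ P).

Definition pr (A : set T) : R := fine (P A).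

Lemma prE A : measurable A -> P A = (pr A)%:E.
Proof. by move=> mA; rewrite /pr fineK // fin_num_measure. Qed.

Lemma pr_ge0 A : 0 <= pr A. Proof. exact: fine_ge0. Qed.

Lemma pr_le A B : measurable A -> measurable B -> A `<=` B -> pr A <= pr B.
Proof.
by move=> mA mB AB; rewrite -lee_fin -!prE //; apply: le_measure; rewrite ?inE.
Qed.

Lemma pr_setU A B : measurable A -> measurable B -> pr (A `|` B) <= pr A + pr B.
Proof.
move=> mA mB; rewrite -lee_fin EFinD -!prE //; last exact: measurableU.
exact: measureU2.
Qed.

Lemma measurable_exists (I : eqType) (s : seq I) (A : I -> set T) :
  (forall i, i \in s -> measurable (A i)) ->
  measurable [set w | exists2 i, i \in s & A i w].
Proof.
elim: s => [|i s IH] mA.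
  by rewrite (_ : [set w | _] = set0) //; apply/seteqP; split => w // [].
rewrite (_ : [set w | _] = A i `|` [set w | exists2 j, j \in s & A j w]).
  apply: measurableU; first by apply: mA; rewrite mem_head.
  by apply: IH => j js; apply: mA; rewrite inE js orbT.
apply/seteqP; split => w /=.
  by case=> j; rewrite inE => /predU1P[->|js] h; [left|right; exists j].
by case=> [h|[j js h]]; [exists i; rewrite ?mem_head|exists j; rewrite // inE js orbT].
Qed.

Lemma pr_exists (I : eqType) (s : seq I) (A : I -> set T) :
  (forall i, i \in s -> measurable (A i)) ->
  pr [set w | exists2 i, i \in s & A i w] <= \sum_(i <- s) pr (A i).
Proof.
elim: s => [|i s IH] mA.
  rewrite big_nil (_ : [set w | _] = set0); first by rewrite /pr measure0.
  by apply/seteqP; split => w // [].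
have mA' j : j \in s -> measurable (A j) by move=> js; apply: mA; rewrite inE js orbT.
have mi : measurable (A i) by apply: mA; rewrite mem_head.
rewrite (_ : [set w | _] = A i `|` [set w | exists2 j, j \in s & A j w]).
  rewrite big_cons; apply: le_trans (pr_setU mi (measurable_exists mA')) _.
  by rewrite lerD2l IH.
apply/seteqP; split => w /=.
  by case=> j; rewrite inE => /predU1P[->|js] h; [left|right; exists j].
by case=> [h|[j js h]]; [exists i; rewrite ?mem_head|exists j; rewrite // inE js orbT].
Qed.

Lemma pr_markov (f : T -> R) c : integ f -> (forall w, 0 <= f w) -> 0 < c ->
  pr [set w | c < f w] <= Ex f / c.
Proof.
move=> hf f0 c0; rewrite -lee_fin -prE; last by apply: measurable_gt; exact: integ_measurable hf.
exact: markov_Ex_lt.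
Qed.

Lemma pr_chebyshev (f : T -> R) c : measurable_fun setT f -> integ (fun w => f w ^+ 2) -> 0 < c ->
  pr [set w | c < `|f w|] <= Ex (fun w => f w ^+ 2) / c ^+ 2.
Proof.
move=> mf hf c0.
rewrite (_ : [set w | _] = [set w | c ^+ 2 < f w ^+ 2]).
  exact: (pr_markov hf (fun w => sqr_ge0 _) (exprn_gt0 2 c0)).
by apply/seteqP; split => w /=; rewrite -[f w ^+ 2]real_normK ?num_real // ltr_pXn2r ?nnegrE // ltW.
Qed.

End ProbTools.

Section RowSums.
Context (R : realType) d (T : measurableType d) (P : probability T R).
Local Notation Ex := (Ex P).
Local Notation integ := (integ P).
Local Notation pr := (pr P).
Context (sigma Z : nat * nat -> {RV P >-> R}).
Hypothesis hZ : iid Z.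
Hypothesis hindep : independent_fields sigma Z.
Hypothesis hstat : stationary_field sigma.
Hypothesis hsigma_ge0 : forall it w, 0 <= sigma it w.
Hypothesis hmom : forall k, integ (fun w => sigma (0%N, 0%N) w ^+ k).
Local Notation Z0 := (Z (0%N, 0%N)).
Local Notation tail := (tail Z0).
Local Notation smom := (smom sigma).

Definition clip (x z : R) : R := if `|z| <= x then z else 0.

Lemma measurable_clip x : measurable_fun setT (clip x).
Proof.
apply: measurable_fun_ifT => //; apply: measurable_fun_ler => //.
Qed.

Lemma clip_bound x z : 0 <= x -> `|clip x z| <= x.
Proof. by rewrite /clip; case: ifP => // _; rewrite normr0. Qed.

Lemma integ_clip x e k : 0 <= x -> integ (fun w => clip x (Z e w) ^+ k).
Proof.
move=> x0; apply: (@integ_bounded _ _ _ _ _ (x ^+ k)).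
  by apply: measurable_funX; apply: measurableT_comp => //; exact: measurable_clip.
by move=> w; rewrite normrX; apply: lerXn2r; rewrite ?nnegrE ?clip_bound.
Qed.

Definition cmom k x := Ex (fun w => clip x (Z0 w) ^+ k).

Lemma Z_tail e x : pr [set w | x < `|Z e w|] = tail x.
Proof.
rewrite /pr /tail; have := Z_same_distribution hZ e.
move=> /(_ ((fun z : R => `|z|) @^-1` `]x, +oo[%classic)).
have -> : [set w | x < `|Z e w|] = Z e @^-1` ((fun z : R => `|z|) @^-1` `]x, +oo[%classic).
  by apply/seteqP; split => w /=; rewrite in_itv /= andbT.
have -> : [set w | x < `|Z0 w|] = Z0 @^-1` ((fun z : R => `|z|) @^-1` `]x, +oo[%classic).
  by apply/seteqP; split => w /=; rewrite in_itv /= andbT.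
move=> -> //; rewrite -[X in measurable X]setTI; apply: normr_measurable => //.
Qed.

Lemma exceedance_prob (s : seq (nat * nat)) x :
  pr [set w | exists2 e, e \in s & x < `|Z e w|] <= (size s)%:R * tail x.
Proof.
apply: le_trans (pr_exists P (A := fun e => [set w | x < `|Z e w|]) _) _.
  by move=> e _; exact: measurable_tail.
rewrite (eq_bigr (fun=> tail x)) => [|e _]; last exact: Z_tail.
by rewrite big_const_seq count_predT iter_addr addr0 mulr_natl.
Qed.

Local Notation X2 i t := (fun w => (sigma (i, t) w * Z (i, t) w) ^+ 2).
Local Notation row i n := [seq (i, t) | t <- iota 0 n].

Lemma gmeas_sigma_pow k e : gmeas (sgen sigma setT) (fun w => sigma e w ^+ k).
Proof.
apply: (gmeas_comp (g := fun x => x ^+ k)); first exact: exprn_measurable.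
exact: gmeas_coord.
Qed.

Lemma sigma_Z_expectation e k g : measurable_fun setT g ->
  integ (fun w => g (Z0 w)) ->
  integ (fun w => sigma e w ^+ k * g (Z e w)) /\
  Ex (fun w => sigma e w ^+ k * g (Z e w)) = smom k * Ex (fun w => g (Z0 w)).
Proof.
move=> mg ig; have [iS eS] := sigma_moment hstat hmom e k.
have [i1 e1] := Ex_sigma_prod_Z hZ hindep (s := [:: e]) (g := fun=> g)
  (gmeas_sigma_pow k e) iS isT (fun=> mg) (fun _ _ => ig).
have E : (fun w => sigma e w ^+ k * \prod_(f <- [:: e]) g (Z f w)) =
    fun w => sigma e w ^+ k * g (Z e w).
  by apply/funext => w; rewrite big_seq1.
by move: i1 e1; rewrite E big_seq1 eS.
Qed.

Let mXsum i n : measurable_fun setT (fun w => \sum_(0 <= t < n) X2 i t w).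
Proof. by apply: measurable_sum => t; apply: measurable_funX; exact: measurable_funM. Qed.

(** Without centring, a first moment suffices once the noise is truncated at
    [x]; the truncation costs the probability that some noise exceeds [x]. *)
Lemma row_bound_infvar i n x tau : 0 <= x -> 0 < tau ->
  pr [set w | tau < `|\sum_(0 <= t < n) X2 i t w|] <=
    n%:R * tail x + n%:R * (smom 2 * cmom 2 x) / tau.
Proof.
move=> x0 t0.
pose S w := \sum_(0 <= t < n) sigma (i, t) w ^+ 2 * clip x (Z (i, t) w) ^+ 2.
have term t : integ (fun w => sigma (i, t) w ^+ 2 * clip x (Z (i, t) w) ^+ 2) /\
    Ex (fun w => sigma (i, t) w ^+ 2 * clip x (Z (i, t) w) ^+ 2) = smom 2 * cmom 2 x.
  apply: (sigma_Z_expectation (i, t) 2 (g := fun z => clip x z ^+ 2)).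
    by apply: measurable_funX; exact: measurable_clip.
  exact: integ_clip.
have iS : integ S by apply: integ_sum => t _; case: (term t).
have S0 w : 0 <= S w by apply: sumr_ge0 => t _; rewrite mulr_ge0 ?sqr_ge0.
have mE : measurable [set w | exists2 e, e \in row i n & x < `|Z e w|].
  by apply: measurable_exists => e _; exact: measurable_tail.
have mS : measurable [set w | tau < S w] by exact/measurable_gt/(integ_measurable iS).
apply: (@le_trans _ _ (pr ([set w | exists2 e, e \in row i n & x < `|Z e w|] `|` [set w | tau < S w]))).
  apply: pr_le; [|exact: measurableU|].
    by apply: measurable_gt; apply: measurableT_comp => //; exact: mXsum.
  move=> w /= h; have [b|nb] := pselect (exists2 e, e \in row i n & x < `|Z e w|); [by left|right].
  apply: (lt_le_trans h); rewrite ger0_norm; last by apply: sumr_ge0 => t _; exact: sqr_ge0.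
  apply: ler_sum_nat => t /andP[_ tn]; rewrite /clip; case: ifP => [_|]; first by rewrite exprMn.
  move=> /negbT; rewrite -ltNge => zb; case: nb; exists (i, t) => //.
  by apply: map_f; rewrite mem_iota.
apply: le_trans (pr_setU P mE mS) _; apply: lerD.
  by apply: le_trans (exceedance_prob _ _) _; rewrite size_map size_iota.
apply: le_trans (pr_markov iS S0 t0) _.
rewrite Ex_sum; last by move=> t _; case: (term t).
rewrite (eq_bigr (fun=> smom 2 * cmom 2 x)); last by move=> t _; case: (term t).
by rewrite sumr_const_nat subn0 -[X in X / _ <= _]mulr_natl.
Qed.

Hypothesis hZ2 : integ (fun w => Z0 w ^+ 2).
Let V := Ex (fun w => Z0 w ^+ 2).

Lemma cmom2_le x : 0 <= x -> 0 <= cmom 2 x <= V.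
Proof.
move=> x0; apply/andP; split; first by apply: Ex_ge0 => w; exact: sqr_ge0.
apply: le_Ex => // [|w]; first exact: integ_clip.
by rewrite /clip; case: ifP => // _; rewrite expr0n sqr_ge0.
Qed.

(** The cross terms vanish: the recentred truncated noise variables are centred,
    and independent of each other and of the volatility. *)
Lemma clipped_sum_variance i n x : 0 <= x ->
  integ (fun w => (\sum_(0 <= t < n) sigma (i, t) w ^+ 2 * (clip x (Z (i, t) w) ^+ 2 - cmom 2 x)) ^+ 2) /\
  Ex (fun w => (\sum_(0 <= t < n) sigma (i, t) w ^+ 2 * (clip x (Z (i, t) w) ^+ 2 - cmom 2 x)) ^+ 2)
    <= n%:R * (smom 4 * cmom 4 x).
Proof.
move=> x0; pose h z := clip x z ^+ 2 - cmom 2 x.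
have mh : measurable_fun setT h.
  by apply: measurable_funB => //; apply: measurable_funX; exact: measurable_clip.
have ih : integ (fun w => h (Z0 w)) by apply: integB; [exact: integ_clip|exact: integ_cst].
have h2E w : h (Z0 w) ^+ 2 = clip x (Z0 w) ^+ 4 + ((- (2 * cmom 2 x)) * clip x (Z0 w) ^+ 2 + cmom 2 x ^+ 2).
  by rewrite /h; ring.
have i4 : integ (fun w => clip x (Z0 w) ^+ 4) by exact: integ_clip.
have i22 : integ (fun w => (- (2 * cmom 2 x)) * clip x (Z0 w) ^+ 2) by apply: integZ; exact: integ_clip.
have i2 : integ (fun w => (- (2 * cmom 2 x)) * clip x (Z0 w) ^+ 2 + cmom 2 x ^+ 2).
  by apply: integD => //; exact: integ_cst.
have ih2 : integ (fun w => h (Z0 w) ^+ 2).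
  by rewrite (_ : (fun w => _) = fun w => clip x (Z0 w) ^+ 4 +
    ((- (2 * cmom 2 x)) * clip x (Z0 w) ^+ 2 + cmom 2 x ^+ 2)); [exact: integD|exact/funext].
have Eh : Ex (fun w => h (Z0 w)) = 0.
  by rewrite ExB ?Ex_cst ?subrr //; [exact: integ_clip|exact: integ_cst].
have Eh2 : Ex (fun w => h (Z0 w) ^+ 2) <= cmom 4 x.
  rewrite (Ex_eq _ h2E) ExD // ExD //; last exact: integ_cst.
  rewrite ExZ ?Ex_cst; last exact: integ_clip.
  by rewrite -/(cmom 2 x) -/(cmom 4 x); have := sqr_ge0 (cmom 2 x); nra.
pose q s t w := (sigma (i, s) w ^+ 2 * h (Z (i, s) w)) * (sigma (i, t) w ^+ 2 * h (Z (i, t) w)).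
have hq s t : integ (q s t) /\ Ex (q s t) <= if s == t then smom 4 * cmom 4 x else 0.
  case: (eqVneq s t) => [<-|st].
    have [i1 e1] := sigma_Z_expectation (i, s) 4 (measurable_funX 2 mh) ih2.
    have -> : q s s = fun w => sigma (i, s) w ^+ 4 * h (Z (i, s) w) ^+ 2.
      by apply/funext => w; rewrite /q; ring.
    split => //; rewrite e1 ler_wpM2l //; exact: smom_ge0.
  pose es := [:: (i, s); (i, s); (i, t); (i, t)].
  have [gW iW _] := sigma_prod hstat hsigma_ge0 hmom es.
  have [i1 e1] := Ex_sigma_prod_Z hZ hindep (s := [:: (i, s); (i, t)]) (g := fun=> h) gW iW
    ltac:(by rewrite /= inE xpair_eqE (negbTE st) andbF) (fun=> mh) (fun _ _ => ih).
  have E : q s t = fun w => (\prod_(e <- es) sigma e w) * \prod_(e <- [:: (i, s); (i, t)]) h (Z e w).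
    by apply/funext => w; rewrite /q /es !big_cons !big_nil; ring.
  by rewrite E; split => //; rewrite e1 !big_cons Eh mul0r mulr0.
have iq s t : integ (q s t) by case: (hq s t).
have E : (fun w => (\sum_(0 <= t < n) sigma (i, t) w ^+ 2 * h (Z (i, t) w)) ^+ 2) =
    fun w => \sum_(0 <= s < n) \sum_(0 <= t < n) q s t w.
  by apply/funext => w; rewrite expr2 mulr_suml; apply: eq_bigr => s _; rewrite mulr_sumr.
have iS : integ (fun w => \sum_(0 <= s < n) \sum_(0 <= t < n) q s t w).
  by apply: integ_sum => s _; exact: integ_sum.
have -> : (fun w => (\sum_(0 <= t < n) sigma (i, t) w ^+ 2 * (clip x (Z (i, t) w) ^+ 2 - cmom 2 x)) ^+ 2)
  = fun w => \sum_(0 <= s < n) \sum_(0 <= t < n) q s t w by exact: E.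
split => //; rewrite Ex_sum; last by move=> s _; exact: integ_sum.
apply: (@le_trans _ _ (\sum_(0 <= s < n) smom 4 * cmom 4 x)); last first.
  by rewrite sumr_const_nat subn0 -[X in X <= _]mulr_natl.
apply: ler_sum_nat => s /andP[_ sn]; rewrite Ex_sum //.
apply: (@le_trans _ _ (\sum_(0 <= t < n) if s == t then smom 4 * cmom 4 x else 0)).
  by apply: ler_sum_nat => t _; case: (hq s t).
rewrite big_mkord (bigD1 (Ordinal sn)) //= eqxx big1 ?addr0 // => t.
by rewrite -val_eqE /= eq_sym => /negbTE ->.
Qed.

(** Capping and rescaling to [0, 1] makes the covariance bound for bounded
    functions of a mixing sequence applicable to [y^2]. *)
Definition cap (K y : R) : R := Num.min (y ^+ 2 / K) 1.
Definition excess (K y : R) : R := y ^+ 2 - K * cap K y.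

Lemma measurable_cap K : measurable_fun setT (cap K).
Proof.
by apply: measurable_minr => //; apply: measurable_funM => //; exact: measurable_funX.
Qed.

Lemma cap_bound K y : 0 < K -> 0 <= cap K y <= 1.
Proof.
move=> K0; rewrite /cap ge_min lexx orbT andbT le_min ler01 andbT.
by rewrite divr_ge0 ?sqr_ge0 // ltW.
Qed.

Lemma excess_bound K y M : 0 < K -> 0 <= y -> 0 <= excess K y <= y ^+ (2 + 2 * M) / K ^+ M.
Proof.
move=> K0 y0; have r0 : 0 <= y ^+ (2 + 2 * M) / K ^+ M.
  by rewrite divr_ge0 ?exprn_ge0 // ltW.
rewrite /excess /cap; have [h|h] := leP (y ^+ 2 / K) 1.
  by rewrite mulrC divfK ?subrr ?lexx //; rewrite gt_eqF.
rewrite mulr1; move: h; rewrite ltr_pdivlMr // mul1r => h.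
apply/andP; split; first by rewrite subr_ge0 ltW.
rewrite ler_pdivlMr ?exprn_gt0 // exprD exprM.
apply: (@le_trans _ _ (y ^+ 2 * K ^+ M)).
  by apply: ler_wpM2r; [apply: exprn_ge0; exact: ltW|rewrite gerBl; exact: ltW].
by rewrite ler_wpM2l ?sqr_ge0 // lerXn2r ?nnegrE ?sqr_ge0 // ltW.
Qed.

(** The volatility has moments of all orders, so that the excess of its square
    over the cap [K] is of order [K^-M] in mean; the mixing rate controls the
    variance of the capped part. *)
Lemma volatility_sum_bound i n (c K tau : R) M : 0 <= c -> 0 < K -> 0 < tau ->
  (forall j, (0 < j)%N -> mixing_coef (fun t => sigma (i, t)) j <= c / j%:R) ->
  pr [set w | tau *+ 2 < `|\sum_(0 <= t < n) (sigma (i, t) w ^+ 2 - smom 2)|] <=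
    K ^+ 2 * (n%:R * (1 + 2 * c * (1 + ln n%:R))) / tau ^+ 2 +
    2 * n%:R * (smom (2 + 2 * M) / K ^+ M) / tau.
Proof.
move=> c0 K0 t0 hmix.
have ms t : measurable_fun setT (sigma (i, t)) by [].
have cap1 (x : R) : 0 <= cap K x <= 1 by exact: cap_bound.
have mcap t : measurable_fun setT (fun w => cap K (sigma (i, t) w)).
  by apply: measurableT_comp; [exact: measurable_cap|].
have icap t : integ (fun w => cap K (sigma (i, t) w)).
  apply: (@integ_bounded _ _ _ _ _ 1) => // w.
  by have /andP[h1 h2] := cap1 (sigma (i, t) w); rewrite ger0_norm.
pose m := Ex (fun w => cap K (sigma (0%N, 0%N) w)).
have Ecap t : Ex (fun w => cap K (sigma (i, t) w)) = m.
  have i0 : integ (fun w => cap K (sigma (0%N, 0%N) w)).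
    apply: (@integ_bounded _ _ _ _ _ 1).
      by apply: measurableT_comp; [exact: measurable_cap|].
    by move=> w; have /andP[h1 h2] := cap1 (sigma (0%N, 0%N) w); rewrite ger0_norm.
  by case: (same_distribution_Ex (sigma_same_distribution hstat (i, t)) (measurable_cap K) i0).
have s2 t : integ (fun w => sigma (i, t) w ^+ 2) /\ Ex (fun w => sigma (i, t) w ^+ 2) = smom 2.
  exact: sigma_moment.
have iex t : integ (fun w => excess K (sigma (i, t) w)).
  by apply: integB; [case: (s2 t)|exact: integZ].
pose rho := smom 2 - K * m.
have Eex t : Ex (fun w => excess K (sigma (i, t) w)) = rho.
  by rewrite ExB ?ExZ ?Ecap //; [case: (s2 t) => _ ->|case: (s2 t)|exact: integZ].
have rho0 : 0 <= rho.
  by rewrite -(Eex 0%N); apply: Ex_ge0 => w; case/andP: (excess_bound 0 K0 (hsigma_ge0 (i, 0%N) w)).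
have rhoM : rho <= smom (2 + 2 * M) / K ^+ M.
  rewrite -(Eex 0%N); have [iM eM] := sigma_moment hstat hmom (i, 0%N) (2 + 2 * M).
  rewrite -eM mulrC -ExZ //; apply: le_Ex => //; first exact: integZ.
  by move=> w; rewrite mulrC; case/andP: (excess_bound M K0 (hsigma_ge0 (i, 0%N) w)).
pose S3 w := \sum_(0 <= t < n) (cap K (sigma (i, t) w) - m).
pose S4 w := \sum_(0 <= t < n) `|excess K (sigma (i, t) w) - rho|.
have mS3 : measurable_fun setT S3.
  by apply: measurable_sum => t; exact: measurable_funB.
have S3n w : `|S3 w| <= n%:R.
  apply: le_trans (ler_norm_sum _ _ _) _.
  apply: (@le_trans _ _ (\sum_(0 <= t < n) 1)); last by rewrite sumr_const_nat subn0.
  apply: ler_sum => t _; have /andP[h1 h2] := cap1 (sigma (i, t) w).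
  have m0 : 0 <= m by apply: Ex_ge0 => w'; case/andP: (cap1 (sigma (0%N, 0%N) w')).
  have m1 : m <= 1.
    rewrite -(Ecap 0%N) -[X in _ <= X](Ex_cst P); apply: le_Ex => // [|w']; first exact: integ_cst.
    by case/andP: (cap1 (sigma (i, 0%N) w')).
  by rewrite ler_norml; apply/andP; split; lra.
have iS3 : integ (fun w => S3 w ^+ 2).
  apply: (@integ_bounded _ _ _ _ _ (n%:R ^+ 2)); first exact: measurable_funX.
  by move=> w; rewrite normrX; apply: lerXn2r; rewrite ?nnegrE.
have iS4 : integ S4.
  by apply: integ_sum => t _; apply: integ_norm; apply: integB => //; exact: integ_cst.
have S40 w : 0 <= S4 w by apply: sumr_ge0.
have b3 : pr [set w | tau / K < `|S3 w|] <= K ^+ 2 * (n%:R * (1 + 2 * c * (1 + ln n%:R))) / tau ^+ 2.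
  apply: le_trans (pr_chebyshev mS3 iS3 _) _; first exact: divr_gt0.
  have v := mixing_variance n (measurable_cap K) cap1 c0 Ecap hmix.
  rewrite ler_pdivrMr; last by rewrite exprn_gt0 // divr_gt0.
  apply: (le_trans v); rewrite le_eqVlt; apply/orP; left; apply/eqP; field.
  by rewrite !gt_eqF.
have b4 : pr [set w | tau < S4 w] <= 2 * n%:R * (smom (2 + 2 * M) / K ^+ M) / tau.
  apply: le_trans (pr_markov iS4 S40 t0) _; rewrite ler_pM2r ?invr_gt0 //.
  rewrite Ex_sum; last by move=> t _; apply: integ_norm; apply: integB => //; exact: integ_cst.
  apply: (@le_trans _ _ (\sum_(0 <= t < n) 2 * (smom (2 + 2 * M) / K ^+ M))); last first.
    by rewrite sumr_const_nat subn0 -[X in X <= _]mulr_natl mulrCA mulrA.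
  apply: ler_sum => t _.
  apply: (@le_trans _ _ (Ex (fun w => excess K (sigma (i, t) w) + rho))).
    apply: le_Ex; [by apply: integ_norm; apply: integB => //; exact: integ_cst|by apply: integD => //; exact: integ_cst|].
    move=> w; apply: le_trans (ler_normB _ _) _; rewrite [`|rho|]ger0_norm // ger0_norm //.
    by case/andP: (excess_bound 0 K0 (hsigma_ge0 (i, t) w)).
  rewrite ExD ?Ex_cst ?Eex //; last exact: integ_cst.
  by rewrite -mulr2n -[X in X <= _]mulr_natl ler_pM2l.
have m3 : measurable [set w | tau / K < `|S3 w|].
  by apply: measurable_gt; exact: measurableT_comp.
have m4 : measurable [set w | tau < S4 w] by apply: measurable_gt; exact: integ_measurable iS4.
apply: le_trans (lerD b3 b4); apply: le_trans (pr_setU P m3 m4).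
apply: pr_le; [|exact: measurableU|].
  apply: measurable_gt; apply: measurableT_comp => //; apply: measurable_sum => t.
  by apply: measurable_funB => //; exact: measurable_funX.
move=> w /= h; have [b|b] := ltP (tau / K) `|S3 w|; [by left|right].
have e : \sum_(0 <= t < n) (sigma (i, t) w ^+ 2 - smom 2) =
   K * S3 w + \sum_(0 <= t < n) (excess K (sigma (i, t) w) - rho).
  by rewrite mulr_sumr -big_split; apply: eq_bigr => t _; rewrite /excess /rho /=; ring.
have l4 : `|\sum_(0 <= t < n) (excess K (sigma (i, t) w) - rho)| <= S4 w by exact: ler_norm_sum.
have l3 : `|K * S3 w| <= tau by rewrite normrM gtr0_norm // mulrC -ler_pdivlMr.
move: h; rewrite e mulr2n => h; have := ler_normD (K * S3 w) (\sum_(0 <= t < n) (excess K (sigma (i, t) w) - rho)).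
by move: h l4 l3; move: (`|_ + _|) (`|_ * _|) (`|\sum_(_ <= _ < _) _|) => p q r; lra.
Qed.

(** The centred row sum splits into a truncated part that is centred given the
    volatility, a volatility part and a deterministic bias. *)
Lemma row_bound_finvar i n x (c K tau : R) M : 0 <= x -> 0 <= c -> 0 < K -> 0 < tau ->
  (forall j, (0 < j)%N -> mixing_coef (fun t => sigma (i, t)) j <= c / j%:R) ->
  n%:R * (smom 2 * (V - cmom 2 x)) <= tau ->
  pr [set w | tau *+ 4 < `|\sum_(0 <= t < n) X2 i t w - n%:R * (smom 2 * V)|] <=
    n%:R * tail x + n%:R * (smom 4 * cmom 4 x) / tau ^+ 2 +
    (K ^+ 2 * (n%:R * (1 + 2 * c * (1 + ln n%:R))) / (tau / (V + 1)) ^+ 2 +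
     2 * n%:R * (smom (2 + 2 * M) / K ^+ M) / (tau / (V + 1))).
Proof.
move=> x0 c0 K0 t0 hmix hbias.
have [F0 FV] : 0 <= cmom 2 x /\ cmom 2 x <= V by have /andP[] := cmom2_le x0.
have V0 : 0 < V + 1 by lra.
have t1 : 0 < tau / (V + 1) by exact: divr_gt0.
pose S1 w := \sum_(0 <= t < n) sigma (i, t) w ^+ 2 * (clip x (Z (i, t) w) ^+ 2 - cmom 2 x).
pose S2 w := \sum_(0 <= t < n) (sigma (i, t) w ^+ 2 - smom 2).
have [iS1 eS1] := clipped_sum_variance i n x0.
have mS1 : measurable_fun setT S1.
  apply: measurable_sum => t; apply: measurable_funM; first exact: measurable_funX.
  apply: measurable_funB => //; apply: measurable_funX.
  by apply: measurableT_comp; [exact: measurable_clip|].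
have mS2 : measurable_fun setT S2.
  by apply: measurable_sum => t; apply: measurable_funB => //; exact: measurable_funX.
have m0 : measurable [set w | exists2 e, e \in row i n & x < `|Z e w|].
  by apply: measurable_exists => e _; exact: measurable_tail.
have m1 : measurable [set w | tau < `|S1 w|] by apply: measurable_gt; exact: measurableT_comp.
have m2 : measurable [set w | (tau / (V + 1)) *+ 2 < `|S2 w|].
  by apply: measurable_gt; exact: measurableT_comp.
have b0 : pr [set w | exists2 e, e \in row i n & x < `|Z e w|] <= n%:R * tail x.
  by apply: le_trans (exceedance_prob _ _) _; rewrite size_map size_iota.
have b1 : pr [set w | tau < `|S1 w|] <= n%:R * (smom 4 * cmom 4 x) / tau ^+ 2.
  apply: le_trans (pr_chebyshev mS1 iS1 t0) _.
  by rewrite ler_pM2r // invr_gt0 exprn_gt0.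
have b2 := volatility_sum_bound n M c0 K0 t1 hmix.
apply: le_trans (lerD (lerD b0 b1) b2).
apply: le_trans (_ : _ <= pr (([set w | exists2 e, e \in row i n & x < `|Z e w|] `|`
  [set w | tau < `|S1 w|]) `|` [set w | (tau / (V + 1)) *+ 2 < `|S2 w|])) _; last first.
  apply: le_trans (pr_setU P _ m2) _; first exact: measurableU.
  by rewrite lerD2r; exact: pr_setU.
apply: pr_le; [|by apply: measurableU => //; exact: measurableU|].
  by apply: measurable_gt; apply: measurableT_comp => //; apply: measurable_funB => //; exact: mXsum.
move=> w /= h.
have [b|nb] := pselect (exists2 e, e \in row i n & x < `|Z e w|); first by left; left.
have [k1|k1] := ltP tau `|S1 w|; first by left; right.
have [k2|k2] := ltP ((tau / (V + 1)) *+ 2) `|S2 w|; first by right.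
exfalso; move: h; apply/negP; rewrite -leNgt.
have E : \sum_(0 <= t < n) X2 i t w - n%:R * (smom 2 * V) =
    S1 w + cmom 2 x * S2 w - n%:R * (smom 2 * (V - cmom 2 x)).
  have -> : \sum_(0 <= t < n) X2 i t w =
      \sum_(0 <= t < n) (sigma (i, t) w ^+ 2 * (clip x (Z (i, t) w) ^+ 2 - cmom 2 x) +
        (cmom 2 x * (sigma (i, t) w ^+ 2 - smom 2) + cmom 2 x * smom 2)).
    apply: eq_big_nat => t /andP[_ tn]; rewrite /clip; case: ifP => [_|]; first by ring.
    move=> /negbT; rewrite -ltNge => zb; case: nb; exists (i, t) => //.
    by apply: map_f; rewrite mem_iota.
  rewrite !big_split /= sumr_const_nat subn0 -/(S1 w) -mulr_sumr -/(S2 w) -[_ *+ n]mulr_natl.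
  by ring.
rewrite E; have k3 : `|cmom 2 x * S2 w| <= tau *+ 2.
  rewrite normrM ger0_norm //; apply: (@le_trans _ _ ((V + 1) * ((tau / (V + 1)) *+ 2))).
    by apply: ler_pM => //; lra.
  by rewrite mulrnAr mulrC divfK ?gt_eqF.
have s20 : 0 <= smom 2 by exact: smom_ge0.
have k4 : 0 <= n%:R * (smom 2 * (V - cmom 2 x)).
  by rewrite !mulr_ge0 // subr_ge0.
apply: le_trans (ler_normB _ _) _; rewrite [X in _ + X]ger0_norm //.
have := ler_normD (S1 w) (cmom 2 x * S2 w); rewrite !mulrS addr0.
move: hbias k1 k3; rewrite mulr2n; move: (`|_ + _|) (`|S1 w|) (`|_ * _|) (n%:R * _) => p q r s; lra.
Qed.

End RowSums.

(** * The off-diagonal part of the sample covariance matrix *)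

Section OffDiagonal.
Context (R : realType) d (T : measurableType d) (P : probability T R).
Local Notation Ex := (Ex P).
Local Notation integ := (integ P).
Local Notation pr := (pr P).
Context (sigma Z : nat * nat -> {RV P >-> R}).
Hypothesis hZ : iid Z.
Hypothesis hindep : independent_fields sigma Z.
Hypothesis hstat : stationary_field sigma.
Hypothesis hsigma_ge0 : forall it w, 0 <= sigma it w.
Hypothesis hmom : forall k, integ (fun w => sigma (0%N, 0%N) w ^+ k).
Local Notation Z0 := (Z (0%N, 0%N)).
Local Notation tail := (tail Z0).
Local Notation smom := (smom sigma).
Local Notation cmom := (cmom Z).
Local Notation S p n w := (sample_cov sigma Z p n w).
Let fld (u : R -> R) w (e : nat * nat) : R := sigma e w * u (Z e w).

Lemma sample_covE p n w (i j : 'I_p) :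
  S p n w i j = \sum_(0 <= t < n) fld id w (val i, t) * fld id w (val j, t).
Proof. by rewrite mxE big_mkord; apply: eq_bigr => t _; rewrite !mxE. Qed.

Lemma offdiag_cross p n w :
  S p n w - diag_part (S p n w) = cross_off p n (fld id w) (fld id w).
Proof.
have h (M : 'M[R]_p) : M - diag_part M = \matrix_(i, j) if i == j then 0 else M i j.
  apply/matrixP => i j; rewrite !mxE.
  by case: (eqVneq i j) => [->|ij]; rewrite ?mulr1n ?subrr // mulr0n subr0.
rewrite h; apply/matrixP => i j; rewrite [LHS]mxE [RHS]mxE.
by case: ifP => // _; rewrite sample_covE.
Qed.

Lemma frob_ge0 p (M : 'M[R]_p) : 0 <= frob M.
Proof. by apply: sumr_ge0 => i _; apply: sumr_ge0 => j _; exact: sqr_ge0. Qed.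

Definition grid p n : seq (nat * nat) := [seq (i, t) | i <- iota 0 p, t <- iota 0 n].

Lemma size_grid p n : size (grid p n) = (p * n)%N.
Proof. by rewrite size_allpairs !size_iota. Qed.

Lemma mem_grid p n i t : (i < p)%N -> (t < n)%N -> (i, t) \in grid p n.
Proof. by move=> ip tn; apply: allpairs_f; rewrite mem_iota. Qed.

Let C4 : R := 1 + 4 * smom 4.

(** The truncated noise need not be centred, and the Frobenius norm pays for
    both its second moment and its mean. *)
Lemma offdiag_bound_infvar p n x tau : 0 <= x -> 0 < tau -> exists B : set T,
  [/\ measurable B,
      pr B <= (p * n)%:R * tail x +
        C4 * (p%:R ^+ 2 * n%:R * cmom 2 x ^+ 2 + p%:R ^+ 2 * n%:R ^+ 2 * cmom 1 x ^+ 4) / tau ^+ 2 &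
      forall w, ~ B w -> forall v, `|qform (S p n w - diag_part (S p n w)) v| <= tau * dotc v v].
Proof.
move=> x0 t0; pose u := clip x.
have mu : measurable_fun setT u by exact: measurable_clip.
have iu : integ (fun w => u (Z0 w) ^+ 2) by exact: integ_clip.
have [iF eF] := frob_cross_moment hZ hindep hstat hsigma_ge0 hmom mu mu iu iu p n.
pose E := [set w | exists2 e, e \in grid p n & x < `|Z e w|].
pose F := [set w | tau ^+ 2 < frob (cross_off p n (fld u w) (fld u w))].
have mE : measurable E by apply: measurable_exists => e _; exact: measurable_tail.
have mF : measurable F by apply: measurable_gt; exact: integ_measurable iF.
exists (E `|` F); split; first exact: measurableU.
- apply: le_trans (pr_setU P mE mF) _; apply: lerD.
    by apply: le_trans (exceedance_prob hZ _ _) _; rewrite size_grid.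
  apply: le_trans (pr_markov iF (fun w => frob_ge0 _) (exprn_gt0 2 t0)) _.
  rewrite ler_pM2r ?invr_gt0 ?exprn_gt0 //; apply: (le_trans eF).
  have -> : Ex (fun w => u (Z0 w)) = cmom 1 x by apply: Ex_eq => w; rewrite expr1.
  by rewrite -!expr2 -exprM.
- move=> w /not_orP[nE nF] v; rewrite offdiag_cross.
  have -> : cross_off p n (fld id w) (fld id w) = cross_off p n (fld u w) (fld u w).
    have h i t : (i < p)%N -> (t < n)%N -> fld id w (i, t) = fld u w (i, t).
      move=> ip tn; congr (_ * _); rewrite /u /clip; case: ifP => // /negbT.
      by rewrite -ltNge => zb; case: nE; exists (i, t) => //; exact: mem_grid.
    apply/matrixP => i j; rewrite !mxE; case: ifP => // _.
    by apply: eq_big_nat => t /andP[_ tn]; rewrite (h _ _ (ltn_ord i) tn) (h _ _ (ltn_ord j) tn).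
  apply: qform_frobenius; first exact: ltW.
  by rewrite leNgt; apply/negP => hh; exact: nF.
Qed.

Hypothesis hZ2 : integ (fun w => Z0 w ^+ 2).
Hypothesis hZmean : Ex Z0 = 0.
Let V := Ex (fun w => Z0 w ^+ 2).

Lemma trace_pow_ge0 p (M : 'M[R]_p) j : M^T = M -> 0 <= \tr (mxpow M (2 ^ j.+1)).
Proof.
move=> sM; rewrite expnS mul2n -addnn mxpowD.
apply: sumr_ge0 => i _; rewrite mxE; apply: sumr_ge0 => k _.
by rewrite -{2}(tr_mxpow _ sM) mxE -expr2 sqr_ge0.
Qed.

Lemma tr_gram_off p n b : (@gram_off R p n b)^T = gram_off p n b.
Proof.
apply/matrixP => i j; rewrite !mxE eq_sym; case: ifP => // _.
by apply: eq_bigr => t _; rewrite mulrC.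
Qed.

(** The noise is split at level [b] into two centred parts; moments of high
    order control the bounded part and second moments all the others. *)
Lemma offdiag_bound_finvar p n b Q tau j : (0 < p)%N -> (0 < n)%N -> 0 <= b -> 0 < tau -> 1 <= Q ->
  p%:R <= Q -> p%:R * n%:R <= Q ^+ 2 -> (2 * b) ^+ 2 <= Q ->
  let K := (2 ^ j.+1)%N in exists B : set T,
  [/\ measurable B,
      pr B <= (1 + (K.*2)%:R * smom K.*2) * Num.max 1 V ^+ K.*2 * (K.+1)`!%:R * K`!%:R *
        (p%:R * Q ^+ K) / tau ^+ K +
        3 * (C4 * (p%:R ^+ 2 * n%:R * (V * (V - cmom 2 b))) / tau ^+ 2) &
      forall w, ~ B w -> forall v, `|qform (S p n w - diag_part (S p n w)) v| <= 4 * tau * dotc v v].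
Proof.
move=> p0 n0 b0 t0 Q1 pQ pnQ bQ K.
pose mu := cmom 1 b.
pose lo z := clip b z - mu; pose hi z := z - clip b z + mu.
have mclip : measurable_fun setT (clip b) by exact: measurable_clip.
have mlo : measurable_fun setT lo by exact: measurable_funB.
have mhi : measurable_fun setT hi by apply: measurable_funD => //; exact: measurable_funB.
have iZ : integ Z0 by exact: integ_of_sq hZ2.
have ic1 : integ (fun w => clip b (Z0 w)).
  rewrite (_ : (fun w => _) = fun w => clip b (Z0 w) ^+ 1); first exact: integ_clip.
  by apply/funext => w; rewrite expr1.
have Ec1 : Ex (fun w => clip b (Z0 w)) = mu by apply: Ex_eq => w; rewrite expr1.
have ic2 : integ (fun w => clip b (Z0 w) ^+ 2) by exact: integ_clip.
have mub : `|mu| <= b.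
  rewrite -Ec1; apply: le_trans (norm_Ex ic1) _; rewrite -[X in _ <= X](Ex_cst P).
  by apply: le_Ex => [||w]; [exact: integ_norm|exact: integ_cst|exact: clip_bound].
have lob z : `|lo z| <= 2 * b.
  apply: le_trans (ler_normB _ _) _; rewrite mulr2n mulrDl mul1r.
  by apply: lerD => //; exact: clip_bound.
have Elo : Ex (fun w => lo (Z0 w)) = 0.
  by rewrite ExB // ?Ex_cst ?Ec1 ?subrr //; exact: integ_cst.
have iZc : integ (fun w => Z0 w - clip b (Z0 w)) by exact: integB.
have Ehi : Ex (fun w => hi (Z0 w)) = 0.
  rewrite ExD // ?Ex_cst; last exact: integ_cst.
  by rewrite ExB // hZmean Ec1 sub0r addNr.
have mcl2 : mu ^+ 2 >= 0 by exact: sqr_ge0.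
have ilo2 : integ (fun w => lo (Z0 w) ^+ 2).
  apply: (@integ_bounded _ _ _ _ _ ((2 * b) ^+ 2)).
    by apply: measurable_funX; exact: measurableT_comp.
  by move=> w; rewrite normrX; apply: lerXn2r; rewrite ?nnegrE ?mulr_ge0.
have /andP[c20 c2V] : 0 <= cmom 2 b <= V by exact: cmom2_le.
have Elo2 : Ex (fun w => lo (Z0 w) ^+ 2) <= V.
  rewrite (Ex_eq _ (g := fun w => clip b (Z0 w) ^+ 2 + ((- (2 * mu)) * clip b (Z0 w) + mu ^+ 2))).
    rewrite ExD //; last by apply: integD; [exact: integZ|exact: integ_cst].
    rewrite ExD; [|exact: integZ|exact: integ_cst].
    rewrite ExZ // Ex_cst Ec1 -/(cmom 2 b); nra.
  by move=> w; rewrite /lo; ring.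
have hi2 w : hi (Z0 w) ^+ 2 = (Z0 w ^+ 2 - clip b (Z0 w) ^+ 2) +
     ((2 * mu) * (Z0 w - clip b (Z0 w)) + mu ^+ 2).
  rewrite /hi /clip; case: ifP => _; ring.
have i1 : integ (fun w => Z0 w ^+ 2 - clip b (Z0 w) ^+ 2) by exact: integB.
have i2 : integ (fun w => (2 * mu) * (Z0 w - clip b (Z0 w)) + mu ^+ 2).
  by apply: integD; [exact: integZ|exact: integ_cst].
have ihi2 : integ (fun w => hi (Z0 w) ^+ 2).
  rewrite (_ : (fun w => _) = fun w => (Z0 w ^+ 2 - clip b (Z0 w) ^+ 2) +
     ((2 * mu) * (Z0 w - clip b (Z0 w)) + mu ^+ 2)); [exact: integD|exact/funext].
have Ehi2 : Ex (fun w => hi (Z0 w) ^+ 2) <= V - cmom 2 b.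
  rewrite (Ex_eq _ hi2) ExD // ExB // ExD; [|exact: integZ|exact: integ_cst].
  rewrite ExZ // ExB // Ex_cst hZmean Ec1 -/V -/(cmom 2 b); nra.
have hi20 : 0 <= Ex (fun w => hi (Z0 w) ^+ 2) by apply: Ex_ge0 => w; exact: sqr_ge0.
have lo20 : 0 <= Ex (fun w => lo (Z0 w) ^+ 2) by apply: Ex_ge0 => w; exact: sqr_ge0.
have [iT eT] := trace_moment hZ hindep hstat hsigma_ge0 hmom mlo lob Elo Elo2 K p0 n0 Q1 pQ pnQ bQ.
pose G w := gram_off p n (fld lo w).
have cross (u v : R -> R) : measurable_fun setT u -> measurable_fun setT v ->
    integ (fun w => u (Z0 w) ^+ 2) -> integ (fun w => v (Z0 w) ^+ 2) ->
    Ex (fun w => u (Z0 w)) = 0 ->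
    Ex (fun w => u (Z0 w) ^+ 2) * Ex (fun w => v (Z0 w) ^+ 2) <= V * (V - cmom 2 b) ->
    measurable [set w | tau ^+ 2 < frob (cross_off p n (fld u w) (fld v w))] /\
    pr [set w | tau ^+ 2 < frob (cross_off p n (fld u w) (fld v w))] <=
      C4 * (p%:R ^+ 2 * n%:R * (V * (V - cmom 2 b))) / tau ^+ 2.
  move=> mu' mv iu iv Eu hE.
  have [iF eF] := frob_cross_moment hZ hindep hstat hsigma_ge0 hmom mu' mv iu iv p n.
  split; first by apply: measurable_gt; exact: integ_measurable iF.
  apply: le_trans (pr_markov iF (fun w => frob_ge0 _) (exprn_gt0 2 t0)) _.
  rewrite ler_pM2r ?invr_gt0 ?exprn_gt0 //; apply: (le_trans eF).
  have C40 : 0 <= C4 by rewrite addr_ge0 // mulr_ge0 // smom_ge0.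
  rewrite ler_wpM2l // Eu expr0n mul0r mulr0 addr0 ler_wpM2l ?mulr_ge0 ?exprn_ge0 //.
have [m1 q1] := cross lo hi mlo mhi ilo2 ihi2 Elo (ler_pM lo20 hi20 Elo2 Ehi2).
have [m2 q2] := cross hi lo mhi mlo ihi2 ilo2 Ehi
   ltac:(by rewrite mulrC; exact: (ler_pM lo20 hi20 Elo2 Ehi2)).
have [m3 q3] := cross hi hi mhi mhi ihi2 ihi2 Ehi
   ltac:(by apply: ler_pM => //; apply: le_trans Ehi2 _; rewrite gerBl).
set B1 := [set w | _ < frob (cross_off p n (fld lo w) (fld hi w))] in m1 q1.
set B2 := [set w | _ < frob (cross_off p n (fld hi w) (fld lo w))] in m2 q2.
set B3 := [set w | _ < frob (cross_off p n (fld hi w) (fld hi w))] in m3 q3.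
pose B0 := [set w | tau ^+ K < \tr (mxpow (G w) K)].
have m0 : measurable B0 by apply: measurable_gt; exact: integ_measurable iT.
have q0 : pr B0 <= (1 + (K.*2)%:R * smom K.*2) * Num.max 1 V ^+ K.*2 * (K.+1)`!%:R * K`!%:R *
        (p%:R * Q ^+ K) / tau ^+ K.
  apply: le_trans (pr_markov iT _ (exprn_gt0 K t0)) _.
    by move=> w; apply: trace_pow_ge0; exact: tr_gram_off.
  by rewrite ler_pM2r // invr_gt0 exprn_gt0.
exists (B0 `|` (B1 `|` (B2 `|` B3))); split.
- by do 3 (apply: measurableU => //).
- apply: le_trans (pr_setU P m0 _) _; first by do 2 (apply: measurableU => //).
  apply: lerD => //; apply: le_trans (pr_setU P m1 _) _; first exact: measurableU.
  have := pr_setU P m2 m3; move: q1 q2 q3; clear; lra.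
- move=> w /not_orP[n0' /not_orP[n1 /not_orP[n2 n3]]] v; rewrite offdiag_cross.
  have -> : cross_off p n (fld id w) (fld id w) = G w + (cross_off p n (fld lo w) (fld hi w) +
     (cross_off p n (fld hi w) (fld lo w) + cross_off p n (fld hi w) (fld hi w))).
    apply/matrixP => i k; rewrite !mxE; case: ifP => _; first by rewrite !addr0.
    rewrite -!big_split; apply: eq_bigr => t _; rewrite /fld /lo /hi /=; ring.
  rewrite !qformD.
  have h0 : `|qform (G w) v| <= tau * dotc v v.
    apply: (@qform_trace _ _ _ j) => //; [exact: tr_gram_off|exact: ltW|].
    by rewrite leNgt; apply/negP => hh; exact: n0'.
  have h1 : `|qform (cross_off p n (fld lo w) (fld hi w)) v| <= tau * dotc v v.
    by apply: qform_frobenius; [exact: ltW|rewrite leNgt; apply/negP => hh; exact: n1].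
  have h2 : `|qform (cross_off p n (fld hi w) (fld lo w)) v| <= tau * dotc v v.
    by apply: qform_frobenius; [exact: ltW|rewrite leNgt; apply/negP => hh; exact: n2].
  have h3 : `|qform (cross_off p n (fld hi w) (fld hi w)) v| <= tau * dotc v v.
    by apply: qform_frobenius; [exact: ltW|rewrite leNgt; apply/negP => hh; exact: n3].
  have -> : 4 * tau * dotc v v = tau * dotc v v + (tau * dotc v v + (tau * dotc v v + tau * dotc v v)) by ring.
  do 3 (apply: le_trans (ler_normD _ _) _; apply: lerD => //).
Qed.

End OffDiagonal.

(** * Growth of the normalizing sequence and of the dimension *)

Section Powers.
Context (R : realType).

Lemma near_power_ge (C e : R) : 0 < e -> \forall n \near \oo, C <= n%:R `^ e.
Proof.
move=> e0; pose c := Num.max C 1; have c0 : 0 < c by rewrite lt_max ltr01 orbT.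
exists (Num.truncn (c `^ e^-1)).+1 => // n /= hn.
apply: (@le_trans _ _ c); first by rewrite le_max lexx.
apply: powR_absorb => //; apply/ltW; apply: lt_le_trans (truncnS_gt _) _.
by rewrite ler_nat.
Qed.

Lemma powR_mono (x y z : R) : 1 <= x -> y <= z -> x `^ y <= x `^ z.
Proof. by move=> x1 yz; exact: ler_powR. Qed.

Lemma powR_add (x y z : R) : 0 < x -> x `^ (y + z) = x `^ y * x `^ z.
Proof. by move=> x0; rewrite powRD // [x == 0]gt_eqF // implybT. Qed.

Lemma ln_le_powR (x e : R) : 0 < x -> 0 < e -> ln x <= x `^ e / e.
Proof.
move=> x0 e0; rewrite ler_pdivlMr // mulrC -ln_powR.
by apply/ltW/ln_sublinear; exact: powR_gt0.
Qed.

Lemma near_comp (Q : nat -> Prop) (f : nat -> nat) :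
  f n @[n --> \oo] --> \oo -> (\forall k \near \oo, Q k) -> \forall n \near \oo, Q (f n).
Proof. by move=> h hQ; exact: h. Qed.

End Powers.

Section NormalizingSequence.
Context (R : realType) d (T : measurableType d) (P : probability T R).
Context (Z : {RV P >-> R}) (alpha qp qm : R) (L : R -> R) (a : nat -> R).
Hypothesis (hq : qp + qm = 1) (hL : slowly_varying L) (halpha : 0 < alpha).
Hypothesis (htailp : right_tail P (fun w => Z w) qp L alpha).
Hypothesis (htailm : right_tail P (fun w => - Z w) qm L alpha).
Hypothesis (ha : (k%:R%:E * P [set w | (a k < `|Z w|)%R])%E @[k --> \oo] --> 1%E).
Local Notation tail := (tail Z).

Lemma near_tail_le2 : \forall k \near \oo, k%:R * tail (a k) <= 2.
Proof.
have o : open [set x : \bar R | (x < 2%:E)%E] by exact: open_ereal_lt_ereal.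
have h : \forall k \near \oo, (k%:R%:E * P [set w | (a k < `|Z w|)%R] < 2%:E)%E.
  have nb : nbhs 1%E [set x : \bar R | (x < 2%:E)%E].
    by apply: open_nbhs_nbhs; split => //=; rewrite lte_fin ltr1n.
  exact: (ha nb).
by apply: filterS h => k; rewrite tail_EFin -EFinM lte_fin; exact: ltW.
Qed.

Lemma near_norming_ge x : \forall k \near \oo, x <= a k.
Proof.
have tx := tail_gt0 hq htailp htailm x.
near=> k; rewrite leNgt; apply/negP => ax.
have h1 : k%:R * tail (a k) <= 2 by near: k; exact: near_tail_le2.
have h2 : tail x <= tail (a k) by apply: tail_mon; exact: ltW.
have h3 : 3 / tail x <= k%:R `^ 1 by near: k; exact: near_power_ge.
rewrite powRr1 // ler_pdivrMr // in h3.
have h4 : 3 <= k%:R * tail (a k) by apply: le_trans h3 _; rewrite ler_wpM2l.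
by have := le_trans h4 h1; rewrite ler_nat.
Unshelve. all: by end_near. Qed.

(** As [k * tail (a k)] stays bounded and [tail x] is at least of order
    [x^-(alpha + e)], the level [a k] is at least of order [k^(1 / (alpha + e))]. *)
Lemma near_norming_power delta : 0 < delta ->
  \forall k \near \oo, k%:R `^ (alpha^-1 - delta) <= a k.
Proof.
move=> d0; pose e := delta * alpha ^+ 2 / 2.
have e0 : 0 < e by rewrite divr_gt0 // mulr_gt0 // exprn_gt0.
have [c [x0 [c0 x01 hc]]] := tail_power hq hL halpha htailp htailm e0.
have ae0 : 0 < alpha + e by apply: addr_gt0.
near=> k.
have k1 : 1 <= k%:R :> R by rewrite ler1n; near: k; exists 1%N.
have h1 : k%:R * tail (a k) <= 2 by near: k; exact: near_tail_le2.
have ak : x0 <= a k by near: k; exact: near_norming_ge.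
have a0 : 0 < a k by lra.
have h2 := hc _ ak.
have h3 : k%:R * c / 2 <= a k `^ (alpha + e).
  have p0 : 0 < a k `^ (alpha + e) by exact: powR_gt0.
  have : k%:R * (c * a k `^ (- (alpha + e))) <= 2 by apply: le_trans h1; rewrite ler_wpM2l.
  by rewrite powRN mulrA ler_pdivrMr // ler_pdivrMr // [2 * _]mulrC.
have h4 : (2 / c) `^ (alpha + e)^-1 <= k%:R `^ (delta / 2).
  by near: k; apply: near_power_ge; rewrite divr_gt0.
have k0 : 0 < k%:R :> R by lra.
have h5 : (k%:R * c / 2) `^ (alpha + e)^-1 <= a k.
  apply: (@le_trans _ _ ((a k `^ (alpha + e)) `^ (alpha + e)^-1)).
    apply: ge0_ler_powR => //; rewrite ?nnegrE ?powR_ge0 ?invr_ge0 ?(ltW ae0) //.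
    by rewrite !mulr_ge0 ?invr_ge0 // ltW.
  by rewrite -powRrM mulfV ?gt_eqF // powRr1 // ltW.
apply: le_trans h5.
have -> : k%:R * c / 2 = k%:R * (2 / c)^-1 by rewrite invf_div mulrA.
rewrite powRM // ?invr_ge0 ?divr_ge0 //; try exact: ltW.
have c2 : 0 < 2 / c by rewrite divr_gt0.
rewrite -(powR_inv1 (ltW c2)) -powRrM mulN1r powRN.
rewrite ler_pdivlMr ?powR_gt0 //.
apply: (@le_trans _ _ (k%:R `^ (alpha^-1 - delta) * k%:R `^ (delta / 2))).
  by rewrite ler_wpM2l // powR_ge0.
rewrite -powR_add //; apply: powR_mono => //.
have : (alpha + e)^-1 = alpha^-1 - e / (alpha * (alpha + e)).
  by field; rewrite !gt_eqF.
move=> ->; rewrite -addrA lerD2l.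
have -> : - delta + delta / 2 = - (delta / 2) by field.
rewrite lerN2 ler_pdivrMr ?mulr_gt0 // /e.
have : 0 <= delta / 2 * (alpha * (delta * alpha ^+ 2 / 2)).
  by rewrite !mulr_ge0 ?exprn_ge0 ?invr_ge0 // ltW.
by move=> h; move: h; rewrite mulrDr [delta / 2 * (_ + _)]mulrDr; nra.
Unshelve. all: by end_near. Qed.

End NormalizingSequence.

Section Dimension.
Context (R : realType) (p : nat -> nat) (beta : R) (ell : R -> R).
Hypothesis (hp_oo : p n @[n --> \oo] --> \oo).
Hypothesis (hell : slowly_varying ell) (hbeta : 0 < beta <= 1).
Hypothesis (hp : forall n, (0 < n)%N -> (p n)%:R = n%:R `^ beta * ell n%:R).
Local Notation N n := (n * p n)%N.

Lemma near_dim_gt0 : \forall n \near \oo, (0 < p n)%N /\ (0 < n)%N.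
Proof.
near=> n; split; last by near: n; exists 1%N.
by near: n; apply: (near_comp (Q := fun k => (0 < k)%N) hp_oo); exists 1%N.
Unshelve. all: by end_near. Qed.

Lemma cvg_size : N n @[n --> \oo] --> \oo.
Proof.
move=> A [m _ hm]; suff : \forall n \near \oo, A (N n) by [].
near=> n; apply: hm => /=.
have [p0 _] : (0 < p n)%N /\ (0 < n)%N by near: n; exact: near_dim_gt0.
have : (m <= n)%N by near: n; exists m.
by move=> /leq_trans; apply; rewrite leq_pmulr.
Unshelve. all: by end_near. Qed.

Lemma near_dim_bounds delta : 0 < delta ->
  \forall n \near \oo, n%:R `^ (beta - delta) <= (p n)%:R <= n%:R `^ (beta + delta).
Proof.
move=> d0; have [x0 x01 hx] := slowly_varying_bounds hell d0.
near=> n.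
have n0 : (0 < n)%N by near: n; exists 1%N.
have n0' : 0 < n%:R :> R by rewrite ltr0n.
have : x0 <= n%:R `^ 1 by near: n; exact: near_power_ge.
rewrite powRr1 // => /hx /andP[h1 h2].
by rewrite hp // !powR_add // !ler_wpM2l // powR_ge0.
Unshelve. all: by end_near. Qed.

(** As [beta <= 1], [p <= n^(1 + delta)], and [p = p^(1/2) p^(1/2)]. *)
Lemma near_dim_upper (delta : R) : 0 < delta ->
  \forall n \near \oo, (p n)%:R <= (N n)%:R `^ (2^-1 + delta).
Proof.
move=> d0; near=> n.
have [p0 n0] : (0 < p n)%N /\ (0 < n)%N by near: n; exact: near_dim_gt0.
have p0' : 0 < (p n)%:R :> R by rewrite ltr0n.
have n0' : 0 < n%:R :> R by rewrite ltr0n.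
have n1 : 1 <= n%:R :> R by rewrite ler1n.
have p1 : 1 <= (p n)%:R :> R by rewrite ler1n.
have /andP[_ h] : n%:R `^ (beta - delta) <= (p n)%:R <= n%:R `^ (beta + delta).
  by near: n; exact: near_dim_bounds.
have hn : (p n)%:R <= n%:R `^ (1 + delta).
  by apply: (le_trans h); apply: powR_mono => //; case/andP: hbeta => _; lra.
have sq (x : R) : 0 < x -> x = x `^ 2^-1 * x `^ 2^-1.
  by move=> x0; rewrite -powR_add // (_ : 2^-1 + 2^-1 = 1) ?powRr1 ?ltW //; lra.
rewrite natrM powRM ?ler0n //.
rewrite [X in X <= _](sq _ p0') powR_add // [X in _ <= _ * X]powR_add //.
apply: (@le_trans _ _ ((n%:R `^ (1 + delta)) `^ 2^-1 * (p n)%:R `^ 2^-1)).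
  by rewrite ler_wpM2r ?powR_ge0 // ge0_ler_powR ?nnegrE ?powR_ge0 // invr_ge0.
rewrite -powRrM; apply: (@le_trans _ _ ((n%:R `^ 2^-1 * n%:R `^ delta) * (p n)%:R `^ 2^-1)).
  by rewrite ler_wpM2r ?powR_ge0 // -powR_add //; apply: powR_mono => //; lra.
rewrite -powR_add // [X in _ <= _ * X]mulrC mulrA ler_wpM2r ?powR_ge0 //.
rewrite ler_peMr ?powR_ge0 //.
rewrite -[X in X <= _](powRr0 (p n)%:R).
by apply: powR_mono => //; exact: ltW.
Unshelve. all: by end_near. Qed.

(** From [p >= n^(beta / 2)] follows [n * p <= p^(2 / beta + 1)]. *)
Lemma near_dim_lower : \forall n \near \oo, (N n)%:R `^ (beta / (beta + 2)) <= (p n)%:R.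
Proof.
have /andP[b0 b1] := hbeta.
have b20 : 0 < beta / 2 by rewrite divr_gt0.
near=> n.
have [p0 n0] : (0 < p n)%N /\ (0 < n)%N by near: n; exact: near_dim_gt0.
have p0' : 0 < (p n)%:R :> R by rewrite ltr0n.
have n0' : 0 < n%:R :> R by rewrite ltr0n.
have /andP[h _] : n%:R `^ (beta - beta / 2) <= (p n)%:R <= n%:R `^ (beta + beta / 2).
  by near: n; exact: near_dim_bounds.
have h2 : n%:R <= (p n)%:R `^ (2 / beta).
  have -> : n%:R = (n%:R `^ (beta - beta / 2)) `^ (2 / beta) :> R.
    rewrite -powRrM (_ : (beta - beta / 2) * (2 / beta) = 1) ?powRr1 ?ler0n //.
    by field; rewrite gt_eqF.
  by apply: ge0_ler_powR; rewrite ?nnegrE ?powR_ge0 ?divr_ge0 // ltW.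
apply: (@le_trans _ _ (((p n)%:R `^ (2 / beta) * (p n)%:R) `^ (beta / (beta + 2)))).
  have e0 : 0 <= beta / (beta + 2) by apply: divr_ge0; lra.
  apply: ge0_ler_powR; rewrite ?e0 ?nnegrE ?mulr_ge0 ?ler0n ?powR_ge0 //.
  by rewrite natrM ler_wpM2r.
rewrite -[X in _ * X]powRr1 ?(ltW p0') // -powR_add // -powRrM.
rewrite (_ : (2 / beta + 1) * (beta / (beta + 2)) = 1) ?powRr1 ?(ltW p0') //.
by field; rewrite !gt_eqF //; lra.
Unshelve. all: by end_near. Qed.

End Dimension.

(** * Negligible terms under infinite variance *)

Section TruncatedNoise.
Context (R : realType) d (T : measurableType d) (P : probability T R).
Context (Z : nat * nat -> {RV P >-> R}) (alpha qp qm : R) (L : R -> R).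
Local Notation Z0 := (Z (0%N, 0%N)).
Hypothesis (hq : qp + qm = 1) (hL : slowly_varying L) (halpha : 0 < alpha).
Hypothesis (htailp : right_tail P (fun w => Z0 w) qp L alpha).
Hypothesis (htailm : right_tail P (fun w => - Z0 w) qm L alpha).
Local Notation tail := (tail Z0).
Local Notation cmom := (cmom Z).
Local Notation Ex := (Ex P).

Lemma cmom_even m x : (0 < m)%N -> cmom m.*2 x = Ex (truncmom Z0 m.*2%:R x).
Proof.
move=> m0; apply: Ex_eq => w; rewrite /clip /truncmom; case: ifP => _.
  by rewrite powR_mulrn // -mul2n !exprM real_normK ?num_real.
by rewrite expr0n -mul2n muln_eq0 /= eqn0Ngt m0.
Qed.

Lemma cmom_karamata m : (0 < m)%N -> alpha < m.*2%:R -> exists C x0 : R,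
  [/\ 0 < C, 1 <= x0 & forall x N, x0 <= x -> 0 < N -> N * tail x <= 2 ->
    cmom m.*2 x <= C * x ^+ m.*2 / N].
Proof.
move=> m0 am; have [c [x0 [c0 x01 hc]]] := tail_karamata hq hL halpha htailp htailm am.
exists (2 * c), x0; split=> // [|x N xx0 N0 hN]; first by rewrite mulr_gt0.
have x0' : 0 <= x by lra.
rewrite cmom_even //; apply: (le_trans (hc x xx0)); rewrite powR_mulrn //.
rewrite ler_pdivlMr // [2 * c]mulrC -!mulrA ler_wpM2l ?(ltW c0) //.
by rewrite [2 * _]mulrC ler_wpM2l ?exprn_ge0 // mulrC.
Qed.

Lemma split_power (s y z : R) : 1 <= s -> 0 < y -> 0 <= z -> z <= y + y `^ (1 - s) * z `^ s.
Proof.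
move=> s1 y0 z0; have q0 : 0 <= y `^ (1 - s) * z `^ s by rewrite mulr_ge0 ?powR_ge0.
have [h|h] := leP z y; first by lra.
have zp : 0 < z by lra.
suff : z <= y `^ (1 - s) * z `^ s by lra.
have -> : 1 - s = - (s - 1) by ring.
rewrite powRN mulrC ler_pdivlMr ?powR_gt0 //.
rewrite -[X in _ <= _ `^ X](subrK 1 s) [z `^ _]powR_add // powRr1 ?(ltW zp) // mulrC ler_pM2r //.
by apply: ge0_ler_powR; rewrite ?nnegrE; lra.
Qed.

(** Splitting the first moment at the level [x N^(-1/s)] balances the part below
    it, bounded trivially, and the part above it, bounded by the moment of order
    [s]. *)
Lemma cmom1_bound (s : R) : 1 <= s -> alpha < s -> exists C x0 : R,
  [/\ 0 < C, 1 <= x0 & forall x N, x0 <= x -> 0 < N -> N * tail x <= 2 ->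
    `|cmom 1 x| <= C * (x * N `^ (- s^-1))].
Proof.
move=> s1 as1; have [c [x0 [c0 x01 hc]]] := tail_karamata hq hL halpha htailp htailm as1.
exists (1 + 2 * c), x0; split=> // [|x N xx0 N0 hN]; first by lra.
have s0 : 0 < s by lra.
have xp : 0 < x by lra.
pose y := x * N `^ (- s^-1).
have y0 : 0 < y by rewrite mulr_gt0 // powR_gt0.
have i1 : integ P (fun w => clip x (Z0 w) ^+ 1) by apply: integ_clip; exact: ltW.
have it : integ P (truncmom Z0 s x) by apply: integ_truncmom; exact: ltW.
apply: (le_trans (norm_Ex i1)).
apply: (@le_trans _ _ (Ex (fun w => y + y `^ (1 - s) * truncmom Z0 s x w))).
  apply: le_Ex; [exact: integ_norm|by apply: integD; [exact: integ_cst|exact: integZ]|].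
  move=> w; rewrite expr1 /clip /truncmom; case: ifP => _.
    exact: split_power.
  by rewrite normr0 mulr0 addr0 ltW.
rewrite ExD; [|exact: integ_cst|exact: integZ].
rewrite Ex_cst ExZ // mulrDl mul1r -/y lerD2l.
apply: (@le_trans _ _ (y `^ (1 - s) * (c * (x `^ s * (2 / N))))).
  rewrite ler_wpM2l ?powR_ge0 //; apply: (le_trans (hc x xx0)).
  rewrite ler_wpM2l ?(ltW c0) // ler_wpM2l ?powR_ge0 //.
  by rewrite ler_pdivlMr // mulrC.
rewrite le_eqVlt; apply/orP; left; apply/eqP.
have -> : y `^ (1 - s) = x `^ (1 - s) * N `^ (1 - s^-1).
  rewrite /y powRM ?powR_ge0 ?(ltW xp) // -powRrM; congr (_ * _ `^ _).
  by field; rewrite gt_eqF.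
have e1 : x `^ (1 - s) * x `^ s = x by rewrite -powR_add // subrK powRr1 // ltW.
have e2 : N `^ (1 - s^-1) / N = N `^ (- s^-1).
  rewrite -(powR_inv1 (ltW N0)) -powR_add //; congr (_ `^ _); ring.
rewrite /y -e2 -{3}e1; ring.
Qed.

(** Raising the level by a constant factor makes exceedances as rare as
    desired, while it only changes the truncated moments by constants. *)
Lemma tail_scaling eta : 0 < eta -> exists (k : nat) (x0 : R),
  1 <= x0 /\ forall x, x0 <= x -> tail (2 ^+ k * x) <= eta * tail x.
Proof.
move=> eta0; have a2 : 0 < alpha / 2 by rewrite divr_gt0.
have [x0 x01 hp] := potter (tail_gt0 hq htailp htailm)
  (tail_double hq hL htailp htailm) a2.
pose th : R := 2 `^ (- (alpha - alpha / 2)).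
have th0 : 0 < th by exact: powR_gt0.
have th1 : th < 1 by apply: powR2N_lt1; lra.
have [k hk] : exists k, th ^+ k <= eta.
  have := cvg_expr (z := th); rewrite gtr0_norm // => /(_ th1) /cvgrPdist_lt /(_ _ eta0).
  case=> k _ /(_ k (leqnn _)); rewrite sub0r normrN gtr0_norm ?exprn_gt0 // => h.
  by exists k; exact: ltW.
exists k, x0; split => // x xx0.
apply: (@le_trans _ _ (th ^+ k * tail x)); last by rewrite ler_wpM2r // tail_ge0.
elim: k {hk} => [|k IH]; first by rewrite !expr0 !mul1r.
have x2 : x0 <= 2 ^+ k * x.
  apply: (le_trans xx0); rewrite ler_peMl //; first by lra.
  by rewrite exprn_ege1 // ler1n.
have [_ h] := hp _ x2; rewrite !exprS -!mulrA; apply: (le_trans h).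
by rewrite ler_pM2l.
Qed.

End TruncatedNoise.

Section InfiniteVariance.
Context (R : realType) d (T : measurableType d) (P : probability T R).
Context (sigma Z : nat * nat -> {RV P >-> R}) (a : nat -> R) (p : nat -> nat).
Context (beta alpha qp qm : R) (ell L : R -> R).
Local Notation Z0 := (Z (0%N, 0%N)).
Local Notation N n := (n * p n)%N.
Local Notation pr := (pr P).
Local Notation tail := (tail Z0).
Local Notation smom := (smom sigma).
Local Notation S n w := (sample_cov sigma Z (p n) n w).
Hypothesis hZ : iid Z.
Hypothesis hindep : independent_fields sigma Z.
Hypothesis hstat : stationary_field sigma.
Hypothesis hsigma_ge0 : forall it w, 0 <= sigma it w.
Hypothesis hmom : forall k, integ P (fun w => sigma (0%N, 0%N) w ^+ k).
Hypothesis hp_oo : p n @[n --> \oo] --> \oo.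
Hypothesis (halpha : 0 < alpha) (halpha2 : alpha < 2) (hq : qp + qm = 1).
Hypothesis hL : slowly_varying L.
Hypothesis (htailp : right_tail P (fun w => Z0 w) qp L alpha).
Hypothesis (htailm : right_tail P (fun w => - Z0 w) qm L alpha).
Hypothesis ha : (k%:R%:E * P [set w | (a k < `|Z0 w|)%R])%E @[k --> \oo] --> 1%E.

(** Truncated at [a_N] with [N = n p], the noise has second moment of order
    [a_N^2 / N]; a row has [n] entries, which leaves [1 / p]. *)
Lemma row_exceedance_infvar eps : 0 < eps -> exists2 C : R, 0 <= C &
  \forall n \near \oo, forall i,
    pr [set w | eps * a (N n) ^+ 2 <
        `|\sum_(0 <= t < n) (sigma (i, t) w * Z (i, t) w) ^+ 2|] <= C / (p n)%:R.
Proof.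
move=> e0; have [c [x0 [c0 x01 hc]]] := cmom_karamata hq hL halpha htailp htailm (ltn0Sn 0) halpha2.
have s20 : 0 <= smom 2 by exact: smom_ge0.
exists (2 + smom 2 * c / eps).
  by rewrite addr_ge0 // divr_ge0 ?mulr_ge0 // ltW.
near=> n => i.
have [p0 n0] : (0 < p n)%N /\ (0 < n)%N by near: n; exact: near_dim_gt0.
have p0' : 0 < (p n)%:R :> R by rewrite ltr0n.
have n0' : 0 < n%:R :> R by rewrite ltr0n.
have hN : (N n)%:R * tail (a (N n)) <= 2.
  near: n; apply: (near_comp (Q := fun k => k%:R * tail (a k) <= 2) (cvg_size hp_oo)).
  exact: (near_tail_le2 ha).
have hx : x0 <= a (N n).
  near: n; apply: (near_comp (Q := fun k => x0 <= a k) (cvg_size hp_oo)).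
  exact: (near_norming_ge hq htailp htailm ha).
have a0 : 0 < a (N n) by lra.
have N0 : 0 < (N n)%:R :> R by rewrite natrM mulr_gt0.
apply: le_trans (row_bound_infvar hZ hindep hstat hmom i n (ltW a0) (mulr_gt0 e0 (exprn_gt0 2 a0))) _.
rewrite mulrDl; apply: lerD.
  by rewrite ler_pdivlMr // mulrC mulrA -natrM mulnC.
have h := hc _ _ hx N0 hN; move: (a (N n)) a0 h => A a0; rewrite natrM => h.
apply: (@le_trans _ _ (n%:R * (smom 2 * (c * A ^+ 2 / (n%:R * (p n)%:R))) / (eps * A ^+ 2))).
  by rewrite ler_pM2r ?invr_gt0 ?mulr_gt0 ?exprn_gt0 // ler_pM2l // ler_wpM2l.
by rewrite le_eqVlt; apply/orP; left; apply/eqP; field; rewrite !gt_eqF.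
Unshelve. all: by end_near. Qed.

(** Relative to [a_N^4], the second moments contribute a term of order [1 / n]
    and the means a term of order [N^(2 - 4 / s)]; both vanish as [s < 2]. *)
Lemma offdiag_negligible_infvar eps eta : 0 < eps -> 0 < eta ->
  \forall n \near \oo, exists B : set T, [/\ measurable B, pr B <= eta &
    forall w, ~ B w -> forall v,
      `|qform (S n w - diag_part (S n w)) v| <= eps * a (N n) ^+ 2 * dotc v v].
Proof.
move=> e0 eta0.
have eta40 : 0 < eta / 4 by rewrite divr_gt0.
have [k [x1 [x11 hk]]] := tail_scaling hq hL halpha htailp htailm eta40.
have [c [x0 [c0 x01 hc]]] := cmom_karamata hq hL halpha htailp htailm (ltn0Sn 0) halpha2.
have [s [s1 as1 s2]] : exists s : R, [/\ 1 <= s, alpha < s & s < 2].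
  exists ((Num.max alpha 1 + 2) / 2).
  have : alpha <= Num.max alpha 1 /\ 1 <= Num.max alpha 1 by rewrite !le_max !lexx orbT.
  have : Num.max alpha 1 < 2 by rewrite gt_max halpha2 ltr1n.
  by move: (Num.max _ _) => m; split; lra.
have [c' [x2 [c'0 x21 hc']]] := cmom1_bound hq hL halpha htailp htailm s1 as1.
pose C4 : R := 1 + 4 * smom 4.
have C40 : 0 < C4 by rewrite ltr_pwDl // mulr_ge0 // smom_ge0.
pose D : R := C4 * (2 ^+ k) ^+ 4 / eps ^+ 2 * (c ^+ 2 + c' ^+ 4).
have s0 : 0 < s by lra.
have r0 : 0 < 4 * s^-1 - 2 by rewrite subr_gt0 ltr_pdivlMr //; lra.
have [y0 y1 y2 yp] : [/\ x0 <= x0 + x1 + x2, x1 <= x0 + x1 + x2, x2 <= x0 + x1 + x2 &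
  0 < x0 + x1 + x2] by split; lra.
near=> n.
have [p0 n0] : (0 < p n)%N /\ (0 < n)%N by near: n; exact: near_dim_gt0.
have p0' : 0 < (p n)%:R :> R by rewrite ltr0n.
have n0' : 0 < n%:R :> R by rewrite ltr0n.
have hN : (N n)%:R * tail (a (N n)) <= 2.
  near: n; apply: (near_comp (Q := fun k => k%:R * tail (a k) <= 2) (cvg_size hp_oo)).
  exact: (near_tail_le2 ha).
have hx : x0 + x1 + x2 <= a (N n).
  near: n; apply: (near_comp (Q := fun k => x0 + x1 + x2 <= a k) (cvg_size hp_oo)).
  exact: (near_norming_ge hq htailp htailm ha).
have g1 : D / (eta / 4) <= n%:R `^ 1 by near: n; exact: near_power_ge.
have g2 : D / (eta / 4) <= (N n)%:R `^ (4 * s^-1 - 2).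
  near: n; apply: (near_comp (Q := fun k => D / (eta / 4) <= k%:R `^ (4 * s^-1 - 2)) (cvg_size hp_oo)).
  exact: near_power_ge.
have a0 : 0 < a (N n) := lt_le_trans yp hx.
have N0 : 0 < (N n)%:R :> R by rewrite natrM mulr_gt0.
set A := a (N n) in hN hx a0 *.
pose x := 2 ^+ k * A.
have Ax : A <= x by rewrite /x ler_peMl ?(ltW a0) // exprn_ege1 // ler1n.
have hNx : (N n)%:R * tail x <= eta / 4 * 2.
  apply: le_trans (ler_wpM2l (ltW eta40) hN); rewrite mulrCA ler_pM2l //; apply: hk; exact: le_trans y1 hx.
have hNx2 : (N n)%:R * tail x <= 2.
  by apply: le_trans hN; rewrite ler_pM2l //; exact: tail_mon.
have x00 : x0 <= x := le_trans y0 (le_trans hx Ax).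
have x20 : x2 <= x := le_trans y2 (le_trans hx Ax).
have xp : 0 < x := lt_le_trans a0 Ax.
have F1 := hc _ _ x00 N0 hNx2.
have F2 := hc' _ _ x20 N0 hNx2.
have t0 : 0 < eps * A ^+ 2 by rewrite mulr_gt0 // exprn_gt0.
have [B [mB hB hBv]] := offdiag_bound_infvar hZ hindep hstat hsigma_ge0 hmom (p n) n (ltW xp) t0.
exists B; split => //; apply: (le_trans hB).
have -> : eta = eta / 4 * 2 + (eta / 4 + eta / 4) by field.
apply: lerD; first by rewrite mulnC.
have x4 : x ^+ 4 = (2 ^+ k) ^+ 4 * A ^+ 4 by rewrite exprMn.
have q1 : (p n)%:R ^+ 2 * n%:R * cmom Z 2 x ^+ 2 <= c ^+ 2 * x ^+ 4 / n%:R.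
  have F0 : 0 <= cmom Z 2 x by apply: Ex_ge0 => w; exact: sqr_ge0.
  have : cmom Z 2 x ^+ 2 <= (c * x ^+ 2 / (N n)%:R) ^+ 2 by rewrite lerXn2r // nnegrE //; apply: le_trans F1.
  move=> h; apply: le_trans (ler_wpM2l _ h) _; first by rewrite mulr_ge0 ?exprn_ge0.
  by rewrite natrM le_eqVlt; apply/orP; left; apply/eqP; field; rewrite !gt_eqF.
have q2 : (p n)%:R ^+ 2 * n%:R ^+ 2 * cmom Z 1 x ^+ 4 <= c' ^+ 4 * x ^+ 4 * (N n)%:R `^ (2 - 4 * s^-1).
  have h : `|cmom Z 1 x| ^+ 4 <= (c' * (x * (N n)%:R `^ (- s^-1))) ^+ 4.
    by rewrite lerXn2r // nnegrE !mulr_ge0 ?powR_ge0 // ltW.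
  have e : `|cmom Z 1 x| ^+ 4 = cmom Z 1 x ^+ 4.
    by rewrite -[4%N]/(2 * 2)%N !exprM real_normK ?num_real.
  rewrite e in h; apply: le_trans (ler_wpM2l _ h) _; first by rewrite mulr_ge0 ?exprn_ge0.
  have -> : (N n)%:R `^ (2 - 4 * s^-1) = (N n)%:R ^+ 2 * ((N n)%:R `^ (- s^-1)) ^+ 4 :> R.
    rewrite powR_add // powR_mulrn ?(ltW N0) //; congr (_ * _).
    by rewrite -[in RHS]powR_mulrn ?powR_ge0 // -powRrM; congr (_ `^ _); ring.
  by rewrite natrM le_eqVlt; apply/orP; left; apply/eqP; ring.
rewrite ler_pdivrMr ?exprn_gt0 //.
apply: (@le_trans _ _ (C4 * (c ^+ 2 * x ^+ 4 / n%:R + c' ^+ 4 * x ^+ 4 * (N n)%:R `^ (2 - 4 * s^-1)))).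
  by rewrite ler_pM2l //; exact: lerD.
rewrite -ler_pdivrMr ?exprn_gt0 //.
have d1 : D / n%:R <= eta / 4.
  by rewrite ler_pdivrMr // mulrC -ler_pdivrMr // -[n%:R]powRr1 // ltW.
have d2 : D * (N n)%:R `^ (2 - 4 * s^-1) <= eta / 4.
  have -> : 2 - 4 * s^-1 = - (4 * s^-1 - 2) by ring.
  by rewrite powRN ler_pdivrMr ?powR_gt0 // mulrC -ler_pdivrMr.
apply: le_trans (lerD d1 d2).
have K0 : 0 <= C4 * (2 ^+ k) ^+ 4 / eps ^+ 2.
  by rewrite divr_ge0 ?mulr_ge0 ?exprn_ge0 // ltW.
rewrite /D x4; set u := _ `^ _; have u0 : 0 <= u by exact: powR_ge0.
have v0 : 0 <= (n%:R)^-1 :> R by rewrite invr_ge0.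
have c20 : 0 <= c ^+ 2 by exact: sqr_ge0.
have c40 : 0 <= c' ^+ 4 by rewrite exprn_ge0 // ltW.
have -> : C4 * (c ^+ 2 * ((2 ^+ k) ^+ 4 * A ^+ 4) / n%:R + c' ^+ 4 * ((2 ^+ k) ^+ 4 * A ^+ 4) * u) /
   (eps * A ^+ 2) ^+ 2 = C4 * (2 ^+ k) ^+ 4 / eps ^+ 2 * (c ^+ 2 / n%:R + c' ^+ 4 * u).
  by field; rewrite !gt_eqF.
move: (C4 * _ / _) K0 => K K0.
rewrite -[K * _ / _]mulrA -[K * _ * u]mulrA -mulrDr ler_wpM2l //.
have h1 : 0 <= c ^+ 2 * u by exact: mulr_ge0.
have h2 : 0 <= c' ^+ 4 / n%:R by exact: mulr_ge0.
by rewrite !mulrDl; apply: lerD; rewrite ?lerDl ?lerDr.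
Unshelve. all: by end_near. Qed.

End InfiniteVariance.

(** * Negligible terms under finite variance *)

Section FiniteVariance.
Context (R : realType) d (T : measurableType d) (P : probability T R).
Context (sigma Z : nat * nat -> {RV P >-> R}) (a : nat -> R) (p : nat -> nat).
Context (beta alpha qp qm : R) (ell L : R -> R).
Local Notation Z0 := (Z (0%N, 0%N)).
Local Notation N n := (n * p n)%N.
Local Notation pr := (pr P).
Local Notation Ex := (Ex P).
Local Notation integ := (integ P).
Local Notation tail := (tail Z0).
Local Notation smom := (smom sigma).
Local Notation cmom := (cmom Z).
Local Notation S n w := (sample_cov sigma Z (p n) n w).
Hypothesis hZ : iid Z.
Hypothesis hindep : independent_fields sigma Z.
Hypothesis hstat : stationary_field sigma.
Hypothesis hsigma_ge0 : forall it w, 0 <= sigma it w.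
Hypothesis hmom : forall k, integ (fun w => sigma (0%N, 0%N) w ^+ k).
Hypothesis hp_oo : p n @[n --> \oo] --> \oo.
Hypothesis (hell : slowly_varying ell) (hbeta : 0 < beta <= 1).
Hypothesis hp : forall n, (0 < n)%N -> (p n)%:R = n%:R `^ beta * ell n%:R.
Hypothesis (halpha2 : 2 < alpha) (halpha4 : alpha < 4) (hq : qp + qm = 1).
Hypothesis hL : slowly_varying L.
Hypothesis (htailp : right_tail P (fun w => Z0 w) qp L alpha).
Hypothesis (htailm : right_tail P (fun w => - Z0 w) qm L alpha).
Hypothesis ha : (k%:R%:E * P [set w | (a k < `|Z0 w|)%R])%E @[k --> \oo] --> 1%E.
Let halpha : 0 < alpha. Proof. by apply: lt_trans halpha2. Qed.
Let r : R := alpha^-1.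
Let kappa : R := beta / (beta + 2).
Let V := Ex (fun w => Z0 w ^+ 2).

Lemma integ_square : integ (fun w => Z0 w ^+ 2).
Proof.
have h : 0 < (2 : R) < alpha by rewrite ltr0n.
have := integ_moment hq hL htailp htailm h.
rewrite (_ : (fun w => `|Z0 w| `^ 2) = fun w => Z0 w ^+ 2) //.
by apply/funext => w; rewrite powR_mulrn // real_normK // num_real.
Qed.

Lemma excess_variance (s x : R) : 2 < s < alpha -> 0 < x ->
  V - cmom 2 x <= x `^ (2 - s) * Ex (fun w => `|Z0 w| `^ s).
Proof.
move=> /andP[s2 sa] x0; have h : 0 < s < alpha by apply/andP; split; lra.
have im := integ_moment hq hL htailp htailm h.
have ic : integ (fun w => clip x (Z0 w) ^+ 2) by apply: integ_clip; exact: ltW.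
rewrite -ExZ // -ExB //; last exact: integ_square.
apply: le_Ex; [apply: integB => //; exact: integ_square|exact: integZ|].
move=> w; rewrite /clip; case: ifP => [_|/negbT]; last rewrite -ltNge => xz.
  by rewrite subrr mulr_ge0 ?powR_ge0.
rewrite expr0n subr0 /= -real_normK ?num_real // -powR_mulrn //.
have z0 : 0 < `|Z0 w| by lra.
rewrite -[in X in X <= _](subrK s 2) powR_add // ler_wpM2r ?powR_ge0 //.
have -> : 2 - s = - (s - 2) by ring.
rewrite !powRN lef_pV2 ?posrE ?powR_gt0 //.
by apply: ge0_ler_powR; rewrite ?nnegrE; lra.
Qed.

(** A slack [delta] small enough for all the comparisons of powers below. *)
Lemma slack_exists : exists delta : R, [/\ 0 < delta, 20 * delta <= 2 * r - 2^-1,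
  2 * delta <= alpha - 2 & 6 * delta <= kappa].
Proof.
have r0 : 0 < 2 * r - 2^-1.
  by rewrite subr_gt0 /r ltr_pdivlMr //; move: halpha4; lra.
have k0 : 0 < kappa by have /andP[b0 _] := hbeta; rewrite divr_gt0 //; lra.
have m : exists m : R, [/\ 0 < m, m <= 2 * r - 2^-1, m <= alpha - 2 & m <= kappa].
  exists (Num.min (2 * r - 2^-1) (Num.min (alpha - 2) kappa)).
  by rewrite !lt_min !ge_min !lexx !orbT r0 k0 subr_gt0 halpha2.
by case: m => m [m0 m1 m2 m3]; exists (m / 20); split; lra.
Qed.

Lemma near_regime delta C : 0 < delta -> \forall n \near \oo,
  [/\ (0 < p n)%N /\ (0 < n)%N, (N n)%:R * tail (a (N n)) <= 2,
     (N n)%:R `^ (r - delta) <= a (N n), C <= a (N n) &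
     [/\ C <= (N n)%:R `^ delta, (p n)%:R <= (N n)%:R `^ (2^-1 + delta) &
         (N n)%:R `^ kappa <= (p n)%:R]].
Proof.
move=> d0; near=> n; split; [|..|split].
- by near: n; exact: near_dim_gt0.
- near: n; apply: (near_comp (Q := fun k => k%:R * tail (a k) <= 2) (cvg_size hp_oo)).
  exact: (near_tail_le2 ha).
- near: n; apply: (near_comp (Q := fun k => k%:R `^ (r - delta) <= a k) (cvg_size hp_oo)).
  exact: (near_norming_power hq hL halpha htailp htailm ha).
- near: n; apply: (near_comp (Q := fun k => C <= a k) (cvg_size hp_oo)).
  exact: (near_norming_ge hq htailp htailm ha).
- near: n; apply: (near_comp (Q := fun k => C <= k%:R `^ delta) (cvg_size hp_oo)).
  exact: near_power_ge.
- by near: n; apply: (near_dim_upper hp_oo hell hbeta hp).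
- by near: n; apply: (near_dim_lower hp_oo hell hbeta hp).
Unshelve. all: by end_near. Qed.

(** The part of the variance beyond the normalizing level does not matter,
    because the dimension grows at least like a power of the sample size. *)
Lemma bias_bound (n q N A s2 m eps delta : R) : 0 < delta -> 2 * delta <= alpha - 2 ->
  6 * delta <= kappa -> 0 < n -> 1 <= q -> N = n * q -> 1 <= N ->
  N `^ (r - delta) <= A -> N `^ kappa <= q -> 0 <= s2 -> 0 <= m -> 0 < eps ->
  4 * s2 * m / eps <= N `^ delta ->
  n * (s2 * (A `^ (2 - (alpha - delta)) * m)) <= eps * A ^+ 2 / 4.
Proof.
move=> d0 d2 d6 n0 q1 eN N1 hA hq' s20 m0 e0 hC.
have N0 : 0 < N by lra.
have A0 : 0 < A by apply: lt_le_trans hA; exact: powR_gt0.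
have q0 : 0 < q by lra.
rewrite powR_add // powR_mulrn ?(ltW A0) // powRN.
set s := alpha - delta; have s0 : 0 < s by rewrite /s; lra.
have ra : r * alpha = 1 by rewrite /r mulVf // gt_eqF.
have r0 : 0 < r by rewrite /r invr_gt0.
have r2 : r <= 2^-1 by rewrite /r lef_pV2 ?posrE //; exact: ltW.
have h1 : N `^ ((r - delta) * s) <= A `^ s.
  by rewrite powRrM; apply: ge0_ler_powR; rewrite ?nnegrE ?powR_ge0 ?(ltW s0) ?(ltW A0).
have h2 : n * N `^ delta <= A `^ s.
  apply: le_trans h1; rewrite -(ler_pM2r q0) mulrAC -eN -[X in X * _]powRr1 ?(ltW N0) // -powR_add //.
  apply: (@le_trans _ _ (N `^ ((r - delta) * s) * N `^ kappa)); last by rewrite ler_wpM2l ?powR_ge0.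
  rewrite -powR_add //; apply: powR_mono => //.
  have -> : (r - delta) * s = r * alpha - r * delta - alpha * delta + delta ^+ 2 by rewrite /s; ring.
  have k1 : r * delta <= 2^-1 * delta by rewrite ler_pM2r.
  have k2 : alpha * delta <= 4 * delta by rewrite ler_pM2r // ltW.
  have k3 : 0 <= delta ^+ 2 by exact: sqr_ge0.
  by rewrite ra; lra.
have As0 : 0 < A `^ s by exact: powR_gt0.
have -> : n * (s2 * (A ^+ 2 / A `^ s * m)) = A ^+ 2 * (n * s2 * m / A `^ s) by ring.
have -> : eps * A ^+ 2 / 4 = A ^+ 2 * (eps / 4) by ring.
rewrite ler_wpM2l ?sqr_ge0 // ler_pdivrMr //.
apply: le_trans (_ : eps / 4 * (n * N `^ delta) <= _); last by rewrite ler_pM2l // divr_gt0.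
rewrite ler_pdivrMr // in hC.
have -> : eps / 4 * (n * N `^ delta) = n / 4 * (N `^ delta * eps) by ring.
have -> : n * s2 * m = n / 4 * (4 * s2 * m) by field.
by rewrite ler_pM2l // divr_gt0.
Qed.

(** As [alpha < 4], sums of [n] volatilities fluctuate on a
    scale close to [n^(1/2)], which is smaller than [a_N^2]. *)
Lemma volatility_term_bound (n q N A c eps delta : R) : 0 < delta ->
  20 * delta <= 2 * r - 2^-1 -> 1 <= n -> 1 <= q -> N = n * q ->
  N `^ (r - delta) <= A -> 0 < c -> 0 < eps ->
  (N `^ delta) ^+ 2 * (n * (1 + 2 * c * (1 + ln n))) / (eps * A ^+ 2 / 4 / (V + 1)) ^+ 2 <=
  (1 + 2 * c * (1 + delta^-1)) * (V + 1) ^+ 2 * 16 / eps ^+ 2 / q.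
Proof.
move=> d0 d20 n1 q1 eN hA c0 e0.
have V0 : 0 < V + 1 by rewrite ltr_wpDl // Ex_ge0 // => w; exact: sqr_ge0.
have n0 : 0 < n by lra.
have q0 : 0 < q by lra.
have nN : n <= N by rewrite eN ler_peMr // ltW.
have N1 : 1 <= N by lra.
have N0 : 0 < N by lra.
have A0 : 0 < A by apply: lt_le_trans hA; exact: powR_gt0.
have nd1 : 1 <= N `^ delta.
  by rewrite -[X in X <= _](powRr0 N); apply: powR_mono => //; exact: ltW.
have hl : 1 + 2 * c * (1 + ln n) <= (1 + 2 * c * (1 + delta^-1)) * N `^ delta.
  have l1 : ln n <= N `^ delta / delta.
    apply: le_trans (ln_le_powR n0 d0) _; rewrite ler_pM2r ?invr_gt0 //.
    by apply: ge0_ler_powR; rewrite ?nnegrE // ltW.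
  have -> : (1 + 2 * c * (1 + delta^-1)) * N `^ delta =
      N `^ delta + 2 * c * (N `^ delta + N `^ delta / delta) by field; rewrite gt_eqF.
  by apply: lerD => //; rewrite ler_wpM2l ?mulr_ge0 ?(ltW c0) //; exact: lerD.
have hA4 : (N `^ delta) ^+ 2 * N * N `^ delta <= A ^+ 4.
  apply: (@le_trans _ _ ((N `^ (r - delta)) ^+ 4)); last first.
    by rewrite lerXn2r // nnegrE ?powR_ge0 // ltW.
  rewrite -!powR_mulrn ?powR_ge0 // -!powRrM -{2}[N]powRr1 ?(ltW N0) // -!powR_add //.
  by apply: powR_mono => //; lra.
rewrite ler_pdivlMr // mulrAC ler_pdivrMr ?exprn_gt0 ?divr_gt0 ?mulr_gt0 ?exprn_gt0 //.
have -> : (1 + 2 * c * (1 + delta^-1)) * (V + 1) ^+ 2 * 16 / eps ^+ 2 * (eps * A ^+ 2 / 4 / (V + 1)) ^+ 2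
  = (1 + 2 * c * (1 + delta^-1)) * A ^+ 4.
  by field; rewrite !gt_eqF.
have -> : (N `^ delta) ^+ 2 * (n * (1 + 2 * c * (1 + ln n))) * q =
  (N `^ delta) ^+ 2 * N * (1 + 2 * c * (1 + ln n)) by rewrite eN; ring.
have c10 : 0 <= 1 + 2 * c * (1 + delta^-1).
  by rewrite addr_ge0 ?mulr_ge0 ?addr_ge0 ?invr_ge0 // ltW.
apply: le_trans (ler_wpM2l c10 hA4).
have -> : (1 + 2 * c * (1 + delta^-1)) * ((N `^ delta) ^+ 2 * N * N `^ delta) =
  (N `^ delta) ^+ 2 * N * ((1 + 2 * c * (1 + delta^-1)) * N `^ delta) by ring.
by rewrite ler_wpM2l // mulr_ge0 ?exprn_ge0 ?powR_ge0 // ltW.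
Qed.

(** Truncated at [a_N] with [N = n p], the noise has fourth moment of order
    [a_N^4 / N], so that the truncated part of a row sum exceeds [a_N^2] with
    probability of order [1 / p]. *)
Lemma row_exceedance_finvar (eps c b : R) : 0 < eps -> 0 < c -> 1 < b ->
  (forall i j : nat, (0 < j)%N -> mixing_coef (fun t => sigma (i, t)) j <= c * j%:R `^ (- b)) ->
  exists2 C : R, 0 <= C & \forall n \near \oo, forall i,
    pr [set w | eps * a (N n) ^+ 2 < `|\sum_(0 <= t < n) (sigma (i, t) w * Z (i, t) w) ^+ 2 -
         n%:R * (smom 2 * V)|] <= C / (p n)%:R.
Proof.
move=> e0 c0 b1 hmix.
have hmix' i j : (0 < j)%N -> mixing_coef (fun t => sigma (i, t)) j <= c / j%:R.
  move=> j0; apply: (le_trans (hmix i j j0)); rewrite ler_pM2l //.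
  rewrite -powR_inv1 ?ler0n //; apply: powR_mono; first by rewrite ler1n.
  by rewrite lerN2 ltW.
have [delta [d0 d20 d2 d6]] := slack_exists.
have [k [x0 [k0 x01 hk]]] := cmom_karamata hq hL halpha htailp htailm (ltn0Sn 1) halpha4.
pose s := alpha - delta; have hs : 2 < s < alpha by rewrite /s; apply/andP; split; lra.
pose m := Ex (fun w => `|Z0 w| `^ s).
have m0 : 0 <= m by apply: Ex_ge0 => w; exact: powR_ge0.
have sm0 j : 0 <= smom j by exact: smom_ge0.
pose M := (Num.truncn (delta^-1)).+1.
have hM : 1 <= delta * M%:R.
  by rewrite mulrC -ler_pdivrMr // div1r; apply/ltW/truncnS_gt.
have V0 : 0 <= V by apply: Ex_ge0 => w; exact: sqr_ge0.
pose C1 : R := 16 * smom 4 * k / eps ^+ 2.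
pose C2 : R := (1 + 2 * c * (1 + delta^-1)) * (V + 1) ^+ 2 * 16 / eps ^+ 2.
pose C3 : R := 8 * smom (2 + 2 * M) * (V + 1) / eps.
have C10 : 0 <= C1 by rewrite divr_ge0 ?mulr_ge0 ?exprn_ge0 // ltW.
have C20 : 0 <= C2.
  by rewrite divr_ge0 ?mulr_ge0 ?addr_ge0 ?mulr_ge0 ?addr_ge0 ?invr_ge0 ?exprn_ge0 ?addr_ge0 // ltW.
have C30 : 0 <= C3 by rewrite divr_ge0 ?mulr_ge0 ?addr_ge0 // ltW.
exists (2 + C1 + (C2 + C3)); first by rewrite !addr_ge0.
near=> n => i.
have [[p0 n0] hN hA hC [hC' hpu hpl]] : [/\ (0 < p n)%N /\ (0 < n)%N, (N n)%:R * tail (a (N n)) <= 2,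
     (N n)%:R `^ (r - delta) <= a (N n), x0 + 4 * smom 2 * m / eps <= a (N n) &
     [/\ x0 + 4 * smom 2 * m / eps <= (N n)%:R `^ delta, (p n)%:R <= (N n)%:R `^ (2^-1 + delta) &
         (N n)%:R `^ kappa <= (p n)%:R]].
  by near: n; exact: near_regime.
have D0 : 0 <= 4 * smom 2 * m / eps by rewrite divr_ge0 ?mulr_ge0 // ltW.
have n1 : 1 <= n%:R :> R by rewrite ler1n.
have p1 : 1 <= (p n)%:R :> R by rewrite ler1n.
have n0' : 0 < n%:R :> R by rewrite ltr0n.
have p0' : 0 < (p n)%:R :> R by rewrite ltr0n.
have N1 : 1 <= (N n)%:R :> R by rewrite ler1n muln_gt0 n0.
have N0 : 0 < (N n)%:R :> R := lt_le_trans ltr01 N1.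
have eN : (N n)%:R = n%:R * (p n)%:R :> R by rewrite natrM.
set A := a (N n) in hN hA hC *.
have xA : x0 <= A by apply: le_trans hC; rewrite lerDl.
have A1 : 1 <= A := le_trans x01 xA.
have A0 : 0 < A := lt_le_trans ltr01 A1.
have t0 : 0 < eps * A ^+ 2 / 4 by rewrite divr_gt0 // mulr_gt0 // exprn_gt0.
have bias : n%:R * (smom 2 * (V - cmom 2 A)) <= eps * A ^+ 2 / 4.
  apply: le_trans (bias_bound d0 d2 d6 n0' p1 eN N1 hA hpl (sm0 2%N) m0 e0 _); last first.
    by apply: le_trans hC'; rewrite lerDr; exact: le_trans ler01 x01.
  by rewrite ler_pM2l // ler_wpM2l //; exact: excess_variance.
have Kd : 0 < (N n)%:R `^ delta by exact: powR_gt0.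
have := row_bound_finvar hZ hindep hstat hsigma_ge0 hmom integ_square (i := i) M (ltW A0) (ltW c0) Kd t0
  (hmix' i) bias.
have -> : (eps * A ^+ 2 / 4) *+ 4 = eps * A ^+ 2 by rewrite -[LHS]mulr_natr divfK.
move=> /le_trans; apply.
rewrite [X in _ <= X]mulrDl; apply: lerD.
  rewrite mulrDl; apply: lerD.
    by rewrite ler_pdivlMr // mulrC mulrA -natrM mulnC.
  have F := hk _ _ xA N0 hN.
  apply: (@le_trans _ _ (n%:R * (smom 4 * (k * A ^+ 4 / (N n)%:R)) / (eps * A ^+ 2 / 4) ^+ 2)).
    by rewrite ler_pM2r ?invr_gt0 ?exprn_gt0 // ler_pM2l // ler_wpM2l.
  by rewrite eN /C1 le_eqVlt; apply/orP; left; apply/eqP; field; rewrite !gt_eqF.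
rewrite [X in _ <= X]mulrDl; apply: lerD.
  exact: volatility_term_bound.
have KM : (N n)%:R <= (N n)%:R `^ delta ^+ M.
  rewrite -powR_mulrn ?powR_ge0 // -powRrM -[X in X <= _]powRr1 ?(ltW N0) //.
  exact: powR_mono.
have V1 : 0 < V + 1 by exact: ltr_wpDl.
have sM : 0 <= smom (2 + 2 * M) by exact: sm0.
apply: (@le_trans _ _ (2 * n%:R * (smom (2 + 2 * M) / (N n)%:R) / (eps / 4 / (V + 1)))).
  apply: ler_pM.
  - by rewrite !mulr_ge0 ?invr_ge0 ?exprn_ge0 ?powR_ge0.
  - by rewrite invr_ge0 divr_ge0 ?(ltW t0) ?(ltW V1).
  - rewrite ler_wpM2l ?mulr_ge0 // ler_wpM2l // lef_pV2 ?posrE ?exprn_gt0 //.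
  - rewrite lef_pV2 ?posrE ?divr_gt0 ?mulr_gt0 ?exprn_gt0 ?invr_gt0 //.
    rewrite ler_pM2r ?invr_gt0 // ler_pM2r ?invr_gt0 // ler_peMr ?(ltW e0) //.
    by rewrite exprn_ege1.
by rewrite eN /C3 le_eqVlt; apply/orP; left; apply/eqP; field; rewrite !gt_eqF.
Unshelve. all: by end_near. Qed.

(** Truncating slightly below the normalizing level keeps the spectral size
    of the bounded part below it and the variance of the rest negligible. *)
Lemma offdiag_negligible_finvar eps eta : 0 < eps -> 0 < eta -> Ex Z0 = 0 ->
  \forall n \near \oo, exists B : set T, [/\ measurable B, pr B <= eta &
    forall w, ~ B w -> forall v,
      `|qform (S n w - diag_part (S n w)) v| <= eps * a (N n) ^+ 2 * dotc v v].
Proof.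
move=> e0 eta0 hmean.
have [delta [d0 d20 d2 d6]] := slack_exists.
have ra : r * alpha = 1 by rewrite /r mulVf // gt_eqF.
have r0 : 0 < r by rewrite /r invr_gt0.
have r2 : r <= 2^-1 by rewrite /r lef_pV2 ?posrE //; exact: ltW.
pose s := alpha - delta; have hs : 2 < s < alpha by rewrite /s; apply/andP; split; lra.
pose m := Ex (fun w => `|Z0 w| `^ s).
have m0 : 0 <= m by apply: Ex_ge0 => w; exact: powR_ge0.
have sm0 j : 0 <= smom j by exact: smom_ge0.
have V0 : 0 <= V by apply: Ex_ge0 => w; exact: sqr_ge0.
(* [delta * K >= 1]: a saving [N^(- 2 delta)] in each of the [K] factors beats
   the remaining factor [p <= N]. *)
pose j := Num.truncn (delta^-1); pose K := (2 ^ j.+1)%N.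
have hK : 1 <= delta * K%:R.
  rewrite mulrC -ler_pdivrMr // div1r; apply: le_trans (ltW (truncnS_gt _)) _.
  by rewrite ler_nat ltnW // ltn_expl.
have w1 : 0 <= r - 2 * delta by lra.
have w2 : 2^-1 + delta <= 2 * r - 4 * delta by lra.
have w3 : 1 <= (2 * r - 4 * delta) * 2 by lra.
have w4 : 2 * r - 4 * delta <= - (2 * delta) + (r - delta) * 2 by lra.
have w5 : 1 + - (2 * delta) * K%:R <= - delta by lra.
have w6 : 2^-1 + delta + 1 + (r - 2 * delta) * (2 - s) <= - delta + (r - delta) * 4.
  have -> : (r - 2 * delta) * (2 - s) = 2 * r - r * alpha + r * delta - 4 * delta +
     2 * (alpha * delta) - 2 * delta ^+ 2 by rewrite /s; ring.
  have k1 : r * delta <= 2^-1 * delta by rewrite ler_pM2r.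
  have k2 : alpha * delta <= 4 * delta by rewrite ler_pM2r // ltW.
  have k3 : 0 <= delta ^+ 2 by exact: sqr_ge0.
  by rewrite ra; lra.
pose G : R := (1 + (K.*2)%:R * smom K.*2) * Num.max 1 V ^+ K.*2 * (K.+1)`!%:R * K`!%:R.
have G0 : 0 <= G.
  by rewrite !mulr_ge0 ?exprn_ge0 ?addr_ge0 ?mulr_ge0 // le_max ler01.
pose C4 : R := 1 + 4 * smom 4.
have C40 : 0 <= C4 by rewrite addr_ge0 // mulr_ge0.
pose D1 : R := G * (16 / eps) ^+ K; pose D2 : R := 3 * C4 * V * m * 16 / eps ^+ 2.
have D10 : 0 <= D1 by rewrite mulr_ge0 // exprn_ge0 // divr_ge0 // ltW.
have D20 : 0 <= D2 by rewrite divr_ge0 ?mulr_ge0 ?exprn_ge0 // ltW.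
near=> n.
have [[p0 n0] hN hA hC [hC' hpu hpl]] : [/\ (0 < p n)%N /\ (0 < n)%N, (N n)%:R * tail (a (N n)) <= 2,
     (N n)%:R `^ (r - delta) <= a (N n), (D1 + D2) / eta <= a (N n) &
     [/\ (D1 + D2) / eta <= (N n)%:R `^ delta, (p n)%:R <= (N n)%:R `^ (2^-1 + delta) &
         (N n)%:R `^ kappa <= (p n)%:R]].
  by near: n; exact: near_regime.
have n1 : 1 <= n%:R :> R by rewrite ler1n.
have p1 : 1 <= (p n)%:R :> R by rewrite ler1n.
have n0' : 0 < n%:R :> R by rewrite ltr0n.
have p0' : 0 < (p n)%:R :> R by rewrite ltr0n.
have eN : (N n)%:R = n%:R * (p n)%:R :> R by rewrite natrM.
have X1 : 1 <= (N n)%:R :> R by rewrite ler1n muln_gt0 n0.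
set A := a (N n) in hN hA hC *; set X : R := (N n)%:R in hN hA hC' hpu hpl eN X1.
have X0 : 0 < X := lt_le_trans ltr01 X1.
have A0 : 0 < A by apply: lt_le_trans hA; exact: powR_gt0.
pose b := X `^ (r - 2 * delta); pose Q := (2 * b) ^+ 2.
have b1 : 1 <= b by rewrite -[X in X <= _](powRr0 X); exact: powR_mono.
have b0 : 0 < b := lt_le_trans ltr01 b1.
have b2 : b ^+ 2 = X `^ (2 * r - 4 * delta).
  by rewrite -powR_mulrn ?powR_ge0 // -powRrM; congr (_ `^ _); ring.
have eQ : Q = 4 * b ^+ 2 by rewrite /Q exprMn; congr (_ * _); rewrite -natrX.
have b21 : 1 <= b ^+ 2 by rewrite exprn_ege1.
have b4 : b ^+ 2 <= Q by rewrite eQ ler_peMl ?sqr_ge0 ?ler1n.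
have Q1 : 1 <= Q := le_trans b21 b4.
have pQ : (p n)%:R <= Q.
  apply: (le_trans hpu); apply: (@le_trans _ _ (b ^+ 2)) => //.
  by rewrite b2; exact: powR_mono.
have NQ : (p n)%:R * n%:R <= Q ^+ 2.
  rewrite mulrC -eN; apply: (@le_trans _ _ ((b ^+ 2) ^+ 2)).
    rewrite b2 -powR_mulrn ?powR_ge0 // -powRrM -[X in X <= _]powRr1 ?(ltW X0) //.
    exact: powR_mono.
  by rewrite lerXn2r // ?nnegrE ?sqr_ge0 // (le_trans ler01 Q1).
have t0 : 0 < eps * A ^+ 2 / 4 by rewrite divr_gt0 // mulr_gt0 // exprn_gt0.
have [B [mB hB hBv]] := offdiag_bound_finvar hZ hindep hstat hsigma_ge0 hmom integ_square hmean j
   p0 n0 (ltW b0) t0 Q1 pQ NQ (lexx _).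
exists B; split => //; last first.
  by move=> w /hBv h v; have := h v; rewrite [4 * _]mulrC divfK.
apply: (le_trans hB); rewrite -/K -/G -/V -/C4.
have A2 : (X `^ (r - delta)) ^+ 2 <= A ^+ 2 by rewrite lerXn2r // nnegrE ?powR_ge0 // ltW.
have u1 : b ^+ 2 / A ^+ 2 <= X `^ (- (2 * delta)).
  rewrite ler_pdivrMr ?exprn_gt0 //.
  apply: le_trans (ler_wpM2l (powR_ge0 _ _) A2).
  rewrite b2 -powR_mulrn ?powR_ge0 // -powRrM -powR_add //.
  exact: powR_mono.
have q1 : G * ((p n)%:R * Q ^+ K) / (eps * A ^+ 2 / 4) ^+ K <= D1 * X `^ (- delta).
  have -> : G * ((p n)%:R * Q ^+ K) / (eps * A ^+ 2 / 4) ^+ K =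
      D1 * ((p n)%:R * (b ^+ 2 / A ^+ 2) ^+ K).
    have h : Q / (eps * A ^+ 2 / 4) = 16 / eps * (b ^+ 2 / A ^+ 2).
      by rewrite eQ; field; rewrite !gt_eqF.
    apply: (@etrans _ _ (G * ((p n)%:R * (Q / (eps * A ^+ 2 / 4)) ^+ K))).
      by rewrite [(Q / _) ^+ K]expr_div_n !mulrA.
    by rewrite h exprMn /D1 [(p n)%:R * (_ * _)]mulrCA !mulrA.
  rewrite ler_wpM2l //.
  apply: (@le_trans _ _ (X * (X `^ (- (2 * delta))) ^+ K)).
    apply: ler_pM => //; first by rewrite exprn_ge0 // divr_ge0 ?sqr_ge0.
      by rewrite eN ler_peMl.
    by rewrite lerXn2r // nnegrE ?powR_ge0 // divr_ge0 ?sqr_ge0.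
  rewrite -powR_mulrn ?powR_ge0 // -powRrM -{1}[X]powRr1 ?(ltW X0) // -powR_add //.
  exact: powR_mono.
have q2 : 3 * (C4 * ((p n)%:R ^+ 2 * n%:R * (V * (V - cmom 2 b))) / (eps * A ^+ 2 / 4) ^+ 2) <=
    D2 * X `^ (- delta).
  apply: (@le_trans _ _ (3 * (C4 * ((p n)%:R ^+ 2 * n%:R * (V * (b `^ (2 - s) * m))) /
      (eps * A ^+ 2 / 4) ^+ 2))).
    rewrite ler_pM2l // ler_pM2r ?invr_gt0 ?exprn_gt0 // ler_wpM2l //.
    rewrite ler_wpM2l ?mulr_ge0 ?exprn_ge0 // ler_wpM2l //; exact: excess_variance.
  have -> : 3 * (C4 * ((p n)%:R ^+ 2 * n%:R * (V * (b `^ (2 - s) * m))) /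
      (eps * A ^+ 2 / 4) ^+ 2) = D2 * ((p n)%:R * X * b `^ (2 - s) / A ^+ 4).
    by rewrite /D2 eN; field; rewrite !gt_eqF.
  rewrite ler_wpM2l // ler_pdivrMr ?exprn_gt0 //.
  have A4 : (X `^ (r - delta)) ^+ 4 <= A ^+ 4 by rewrite lerXn2r // nnegrE ?powR_ge0 // ltW.
  apply: le_trans (ler_wpM2l (powR_ge0 _ _) A4).
  apply: (@le_trans _ _ (X `^ (2^-1 + delta) * X * b `^ (2 - s))).
    by rewrite ler_wpM2r ?powR_ge0 // ler_wpM2r // ltW.
  rewrite -[X in _ * X * _]powRr1 ?(ltW X0) // /b -powRrM -[in X in _ <= X]powR_mulrn ?powR_ge0 //.
  by rewrite -powRrM -!powR_add //; exact: powR_mono.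
apply: le_trans (lerD q1 q2) _; rewrite -mulrDl powRN ler_pdivrMr ?powR_gt0 //.
by rewrite mulrC -ler_pdivrMr.
Unshelve. all: by end_near. Qed.

End FiniteVariance.

(** * Counting the entries of a nearly banded matrix *)

Section Banding.
Context (R : realType).
Local Open Scope set_scope.

Lemma card_draws_mem (q k : nat) (i : 'I_q) :
  #|[set D : {set 'I_q} | (#|D| == k.+1) && (i \in D)]| = 'C(q.-1, k).
Proof.
case: q i => [[]|q] i //=.
have h1 := card_draws 'I_q.+1 k.+1; have h2 := cards_draws [set~ i] k.+1.
rewrite card_ord cardsC1 card_ord /= in h1 h2.
have hs (D : {set 'I_q.+1}) : (D \subset [set~ i]) = (i \notin D).
  apply/fintype.subsetP/idP => [h|iD x xD]; first by apply/negP => /h; rewrite !inE eqxx.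
  by rewrite !inE; apply: contraNneq iD => <-.
set F := [set D | _]; move: h1; rewrite -(finset.cardsID F) binS -h2 addnC.
have -> : [set D : {set 'I_q.+1} | #|D| == k.+1] :&: F = F.
  by apply/setP => D; rewrite !inE; case: (_ == _).
have -> : [set D : {set 'I_q.+1} | #|D| == k.+1] :\: F = [set D : {set 'I_q.+1} | D \subset [set~ i] & #|D| == k.+1].
  by apply/setP => D; rewrite !inE hs; case: (_ == _); case: (_ \in _).
exact: addnI.
Qed.

Definition entries q k (a : k.-tuple 'I_q) : {set 'I_q} := [set x | x \in a].

Lemma sorted_tuples_sets (q k : nat) :
  let S := [set a : k.-tuple 'I_q | sorted ltn [seq val x | x <- a]] in
  {in S &, injective (@entries q k)} /\
  @entries q k @: S = [set D : {set 'I_q} | #|D| == k].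
Proof.
move=> S.
have inj : {in S &, injective (@entries q k)}.
  move=> a b; rewrite !inE => sa sb /setP e; apply: val_inj => /=.
  apply: (inj_map val_inj); apply: (irr_sorted_eq ltn_trans ltnn sa sb) => x.
  apply/mapP/mapP => -[y ya ->]; exists y => //.
    by have := e y; rewrite !inE ya => /esym.
  by have := e y; rewrite !inE ya.
split=> //; apply/eqP; rewrite finset.eqEcard card_in_imset // card_draws card_ltn_sorted_tuples.
rewrite card_ord leqnn andbT; apply/fintype.subsetP => D /imsetP[a]; rewrite !inE => sa ->.
have ua : uniq a.
  by rewrite -(map_inj_uniq val_inj); apply: (sorted_uniq ltn_trans ltnn).
by rewrite cardsE (card_uniqP ua) size_tuple.
Qed.

(** Averaging over random index sets of size [k]: such a set contains each
    given index with probability [k / q], and meets [B] in at most [k] points. *)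
Lemma hitting_sets (q k : nat) (B : {set 'I_q}) : (0 < k)%N ->
  (#|B| * 'C(q, k) <=
     q * #|[set a : k.-tuple 'I_q | sorted ltn [seq val x | x <- a] & [exists x in a, x \in B]]|)%N.
Proof.
case: k => // k _; set E := [set a | _ & _].
have [inj im] := sorted_tuples_sets q k.+1.
set S := [set a | _] in inj im.
have ES : {subset E <= S} by move=> a; rewrite !inE => /andP[].
have cE : #|E| = #|[set D : {set 'I_q} | (#|D| == k.+1) && [exists x in D, x \in B]]|.
  have injE : {in E &, injective (@entries q k.+1)}.
    by move=> a b /ES aS /ES bS; exact: inj.
  rewrite -(card_in_imset injE); congr #|pred_of_set _|; apply/setP => D.
  have hd (a : k.+1.-tuple 'I_q) : [exists x in entries a, x \in B] = [exists x in a, x \in B].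
    by apply: eq_existsb => x; rewrite inE.
  apply/imsetP/idP => [[a aE ->]|].
    have : entries a \in @entries q k.+1 @: S by apply: imset_f; exact: ES.
    by rewrite im !inE => -> /=; rewrite hd; move: aE; rewrite inE => /andP[].
  rewrite inE => /andP[cD hD].
  have : D \in @entries q k.+1 @: S by rewrite im inE.
  case/imsetP => a aS eD; exists a => //; rewrite inE -hd -eD hD andbT.
  by move: aS; rewrite inE.
rewrite cE; set F := [set D | _ && _].
have dc : (#|B| * 'C(q.-1, k) <= k.+1 * #|F|)%N.
  have e : (\sum_(i in B) \sum_(D : {set 'I_q} | #|D| == k.+1) (i \in D) = #|B| * 'C(q.-1, k))%N.
    rewrite -sum_nat_const; apply: eq_bigr => i _; rewrite -(card_draws_mem k i).
    rewrite -sum1_card big_mkcond [RHS]big_mkcond; apply: eq_bigr => D _.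
    by rewrite inE; case: (_ == _); case: (_ \in _).
  rewrite -e exchange_big /= mulnC -sum_nat_const [leqRHS]big_mkcond [leqLHS]big_mkcond /=.
  apply: leq_sum => D _; rewrite inE; case: ifP => //= /eqP cD.
  case: ifP => [_|/existsP dD].
    rewrite -cD -sum1_card [leqRHS]big_mkcond [leqLHS]big_mkcond /=; apply: leq_sum => i _.
    by case: (i \in B); case: (i \in D).
  rewrite big1 // => i iB; apply/eqP; rewrite eqb0; apply/negP => iD.
  by case: dD; exists i; rewrite iD.
rewrite -(leq_pmul2l (ltn0Sn k)) mulnCA -mul_bin_diag mulnCA [leqRHS]mulnCA.
by rewrite leq_mul2l dc orbT.
Qed.

Definition offband_rows q (C : 'M[R]_q) k :=
  [set i : 'I_q | [exists j : 'I_q, (k < `|j - i|)%N && (C i j != 0)]].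

Lemma offband_indicator_hit q k (a : k.-tuple 'I_q) (C : 'M[R]_q) :
  [exists i in a, i \in offband_rows C k] -> offband_indicator a C = 1.
Proof.
move=> /existsP[i /andP[/tnthP[l ->]]]; rewrite inE => /existsP[j /andP[kj Cj]].
rewrite /offband_indicator ifT // (bigD1 l) //= (bigD1 j) //=.
have s0 (Q : pred 'I_q) f : 0 <= \sum_(j | Q j) `|f j| :> R by apply: sumr_ge0.
apply: ltr_pwDl; last by apply: sumr_ge0 => x _; exact: s0.
by apply: ltr_pwDl => //; rewrite normr_gt0.
Qed.

Lemma card_offband_rows q (C : 'M[R]_q) k : (0 < k <= q)%N ->
  #|offband_rows C k|%:R <= q%:R * offband_frac C k.
Proof.
move=> /andP[k0 kq]; have C0 : 0 < 'C(q, k)%:R :> R by rewrite ltr0n bin_gt0.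
rewrite /offband_frac mulrCA mulrC ler_pdivlMr //.
have := hitting_sets (offband_rows C k) k0; set E := [set a | _ & _] => h.
rewrite -natrM; apply: (@le_trans _ _ (q * #|E|)%:R); first by rewrite ler_nat.
rewrite natrM ler_wpM2l // -sum1_card natr_sum [leRHS]big_mkcond [leLHS]big_mkcond /=.
apply: ler_sum => a _; rewrite inE; case: (sorted _ _) => //=.
case: ifP => [/offband_indicator_hit -> //|_].
by rewrite /offband_indicator; case: ifP.
Qed.

Lemma card_band q k (i : 'I_q) : (#|[set j : 'I_q | (`|j - i| <= k)%N]| <= k.*2.+1)%N.
Proof.
rewrite cardE -(size_map val) -(size_iota (i - k) k.*2.+1).
apply: uniq_leq_size; first by rewrite map_inj_uniq ?enum_uniq //; exact: val_inj.
move=> x /mapP[j]; rewrite mem_enum inE => hj ->; rewrite mem_iota.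
by move: hj => /=; lia.
Qed.

(** Nonzero entries lie either in one of the exceptional rows or in the band. *)
Lemma card_offdiag_nonzero q (C : 'M[R]_q) k : (0 < k <= q)%N ->
  #|[set e : 'I_q * 'I_q | (e.1 != e.2) && (C e.1 e.2 != 0)]|%:R <=
  q%:R ^+ 2 * offband_frac C k + q%:R * (3 * k)%:R.
Proof.
move=> hk; have [k0 kq] := andP hk.
apply: (@le_trans _ _ (#|offband_rows C k| * q + q * (3 * k))%N%:R); last first.
  rewrite natrD lerD //; last by rewrite natrM.
  by rewrite natrM expr2 -mulrA mulrC ler_wpM2l //; exact: card_offband_rows.
rewrite ler_nat -sum1_card.
apply: (@leq_trans (\sum_(i : 'I_q) ((i \in offband_rows C k) * q + 3 * k))%N); last first.
  rewrite big_split /= sum_nat_const card_ord leq_add2r -big_distrl /= leq_mul2r.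
  by rewrite -sum1_card [X in (_ <= X)%N]big_mkcond /= leqnn orbT.
rewrite big_mkcond /=.
rewrite (eq_bigr (fun e : 'I_q * 'I_q => nat_of_bool ((e.1 != e.2) && (C e.1 e.2 != 0)))); last first.
  by move=> e _; rewrite inE; case: (_ && _).
rewrite -(pair_bigA _ (fun i j : 'I_q => nat_of_bool ((i != j) && (C i j != 0)))) /=.
apply: leq_sum => i _; case: (boolP (i \in _)) => iB.
  apply: (@leq_trans q); last by rewrite mul1n leq_addr.
  apply: (@leq_trans (\sum_(j : 'I_q) 1)%N); first by apply: leq_sum => j _; case: (_ && _).
  by rewrite sum_nat_const card_ord muln1.
rewrite mul0n add0n; apply: (@leq_trans k.*2.+1); last by lia.
apply: leq_trans (card_band k i); rewrite -sum1_card [leqRHS]big_mkcond /=.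
apply: leq_sum => j _; rewrite inE; have [_|kj] := leqP `|j - i|%N k; first by case: (_ && _).
rewrite leqn0 eqb0; apply: contra iB => /andP[_ Cij].
by rewrite inE; apply/existsP; exists j; rewrite kj.
Qed.

(** The band itself is sparse because [k <= k^3 = o(q)]. *)
Lemma nearly_banded_sparse (p : nat -> nat) (A : forall n, 'M[R]_(p n)) (eps : R) :
  p n @[n --> \oo] --> \oo -> nearly_banded A -> 0 < eps ->
  \forall n \near \oo,
    #|[set e : 'I_(p n) * 'I_(p n) | (e.1 != e.2) && (A n e.1 e.2 != 0)]|%:R <=
    eps * (p n)%:R ^+ 2.
Proof.
move=> hp [k [koo k3 hfrac]] e0.
have e60 : 0 < Num.min (eps / 6) (2^-1) by rewrite lt_min divr_gt0 //= invr_gt0.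
near=> n.
have p0 : (0 < p n)%N by near: n; apply: (near_comp (Q := fun k => (0 < k)%N) hp); exists 1%N.
have k0 : (0 < k (p n))%N.
  near: n; apply: (near_comp (Q := fun q => (0 < k q)%N) hp).
  by apply: (near_comp (Q := fun q => (0 < q)%N) koo); exists 1%N.
have h3 : `|0 - (k (p n) ^ 3)%N%:R / (p n)%:R| < Num.min (eps / 6) (2^-1) :> R.
  near: n; apply: (near_comp (Q := fun q => `|0 - (k q ^ 3)%N%:R / q%:R| < _ :> R) hp).
  by move/cvgrPdist_lt: k3; apply.
have hf : `|0 - offband_frac (A n) (k (p n))| < eps / 2.
  by near: n; move/cvgrPdist_lt: hfrac; apply; rewrite divr_gt0.
have p0' : 0 < (p n)%:R :> R by rewrite ltr0n.
have k3' : (k (p n) <= k (p n) ^ 3)%N by rewrite -{1}[k _]expn1 leq_pexp2l.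
move: h3; rewrite sub0r normrN ger0_norm ?divr_ge0 // lt_min => /andP[h3 h3'].
have kp : (k (p n) <= p n)%N.
  apply: (leq_trans k3'); rewrite -(ler_nat R); move: h3'.
  rewrite ltr_pdivrMr // => /ltW /le_trans; apply.
  by rewrite ler_piMl // invf_le1 // ler1n.
have hk : (0 < k (p n) <= p n)%N by rewrite k0.
apply: le_trans (card_offdiag_nonzero (A n) hk) _.
have -> : eps * (p n)%:R ^+ 2 = (p n)%:R ^+ 2 * (eps / 2) + (p n)%:R * (3 * (eps / 6 * (p n)%:R)).
  by field.
apply: lerD.
  rewrite ler_pM2l ?exprn_gt0 //; move: hf; rewrite sub0r normrN => /ltW.
  by apply: le_trans; exact: ler_norm.
rewrite ler_pM2l // natrM ler_pM2l // -ler_pdivrMr //.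
apply: le_trans (ltW h3); rewrite ler_pM2r ?invr_gt0 // ler_nat //.
Unshelve. all: by end_near. Qed.

End Banding.

(** * Convergence of the eigenvalue gap *)

Section GapConvergence.
Context (R : realType) d (T : measurableType d) (P : probability T R).
Context (sigma Z : nat * nat -> {RV P >-> R}) (a c : nat -> R) (p : nat -> nat).
Context (A : forall n, 'M[R]_(p n)).
Local Notation N n := (n * p n)%N.
Local Notation pr := (pr P).
Local Notation S n w := (sample_cov sigma Z (p n) n w).
Local Notation dev n i w :=
  (\sum_(0 <= t < n) (sigma (i, t) w * Z (i, t) w) ^+ 2 - c n).

Local Notation coupled n :=
  ([set e : 'I_(p n) * 'I_(p n) | (e.1 != e.2) && (A n e.1 e.2 != 0)]%SET).

Lemma sample_cov_diag q n w (i : 'I_q) :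
  sample_cov sigma Z q n w i i = \sum_(0 <= t < n) (sigma (val i, t) w * Z (val i, t) w) ^+ 2.
Proof. by rewrite sample_covE. Qed.

Lemma centred_sample_cov q n w b :
  sample_cov sigma Z q n w - b%:M = (sample_cov sigma Z q n w - diag_part (sample_cov sigma Z q n w)) +
    diag_mx (\row_i (sample_cov sigma Z q n w i i - b)).
Proof.
apply/matrixP => i j; rewrite !mxE; case: (eqVneq i j) => [->|ij].
  by rewrite !mulr1n addrA subrK.
by rewrite !mulr0n !subr0 addr0.
Qed.

Lemma centred_sample_cov_diag q n w b :
  diag_part (sample_cov sigma Z q n w - b%:M) = diag_mx (\row_i (sample_cov sigma Z q n w i i - b)).
Proof. by congr diag_mx; apply/rowP => i; rewrite !mxE eqxx mulr1n. Qed.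

Lemma sample_cov_sym q n w : (sample_cov sigma Z q n w)^T = sample_cov sigma Z q n w.
Proof. by rewrite trmx_mul trmxK. Qed.

Lemma diag_part_sym m (C : 'M[R]_m) : (diag_part C)^T = diag_part C.
Proof. exact: tr_diag_mx. Qed.

Lemma measurable_sample_cov q n (i j : 'I_q) :
  measurable_fun setT (fun w => sample_cov sigma Z q n w i j).
Proof.
rewrite (_ : (fun w => _) = fun w => \sum_(0 <= t < n)
    (sigma (val i, t) w * Z (val i, t) w) * (sigma (val j, t) w * Z (val j, t) w)).
  by apply: measurable_sum => t; apply: measurable_funM; exact: measurable_funM.
by apply/funext => w; rewrite sample_covE.
Qed.

Lemma measurable_gap n : posdefmx (A n) -> measurable_fun setT (fun w =>
  max_eigen_gap (sqrtmx (A n) *m (S n w - (c n)%:M) *m sqrtmx (A n))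
                (diag_part (S n w - (c n)%:M) *m diag_part (A n))).
Proof.
move=> pA; have [[sQ _] _] := sqrtmxP pA.
have sD w : (S n w - (c n)%:M)^T = S n w - (c n)%:M.
  by rewrite linearB /= sample_cov_sym tr_scalar_mx.
have mD k l : measurable_fun setT (fun w => (S n w - (c n)%:M) k l).
  rewrite (_ : (fun w => _) = fun w => S n w k l - (c n)%:M k l).
    by apply: measurable_funB => //; exact: measurable_sample_cov.
  by apply/funext => w; rewrite !mxE.
apply: measurable_max_eigen_gap.
- by move=> w; rewrite !trmx_mul sQ sD mulmxA.
- by move=> w; rewrite trmx_mul !diag_part_sym /diag_part diag_mxC.
- by move=> k l; do 2 (apply: measurable_mulmx => //).
- move=> k l; apply: measurable_mulmx => // i j.
  rewrite (_ : (fun w => _) = fun w => ((S n w - (c n)%:M) i i) *+ (i == j)).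
    by case: (i == j); [exact: mD|exact: measurable_cst].
  by apply/funext => w; rewrite /diag_part !mxE.
Qed.

Hypothesis hZ : iid Z.
Hypothesis hindep : independent_fields sigma Z.
Hypothesis hrows : iid_rows sigma.
Hypothesis hp_oo : p n @[n --> \oo] --> \oo.
Hypothesis ha_gt0 : forall k, (0 < k)%N -> 0 < a k.
Hypothesis hA : forall n, posdefmx (A n).
Hypothesis hA_bnd : exists M : R, forall n, spectral_norm (A n) <= M.
Hypothesis hA_band : nearly_banded A.
Hypothesis hrow : forall eps, 0 < eps -> exists2 C : R, 0 <= C &
  \forall n \near \oo, forall i,
    pr [set w | eps * a (N n) ^+ 2 < `|dev n i w|] <= C / (p n)%:R.
Hypothesis hoff : forall eps eta, 0 < eps -> 0 < eta ->
  \forall n \near \oo, exists B : set T, [/\ measurable B, pr B <= eta &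
    forall w, ~ B w -> forall v,
      `|qform (S n w - diag_part (S n w)) v| <= eps * a (N n) ^+ 2 * dotc v v].

Let gmeas_dev n i : gmeas (row_events sigma Z i) (fun w => `|dev n i w|).
Proof.
apply: (gmeas_comp (g := fun x => `|x - c n|)).
  by apply: measurableT_comp => //; exact: measurable_funB.
apply: gmeas_sum => t; apply: (gmeas_comp (g := fun x => x ^+ 2)); first exact: exprn_measurable.
by apply: gmeasM; [exact: gmeas_row_sigma|exact: gmeas_row_Z].
Qed.

Let measurable_dev n i x : measurable [set w | x < `|dev n i w|].
Proof.
by apply: measurable_gt; exact: (gmeas_measurable (@row_events_measurable _ _ _ P sigma Z i) (@gmeas_dev n i)).
Qed.

(** Two rows exceed the level simultaneously only with squared probability, and
    the sparsity of [A] leaves few pairs of rows to consider. *)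
Lemma joint_exceedance n x q : 0 <= q ->
  (forall i, pr [set w | x < `|dev n i w|] <= q) ->
  pr [set w | exists2 e, e \in enum (coupled n) & x < `|dev n (val e.1) w| /\ x < `|dev n (val e.2) w|] <=
  #|coupled n|%:R * q ^+ 2.
Proof.
move=> q0 hq.
have me (e : 'I_(p n) * 'I_(p n)) :
    measurable [set w | x < `|dev n (val e.1) w| /\ x < `|dev n (val e.2) w|].
  by apply: (measurableI _ _ (measurable_dev n (val e.1) x) (measurable_dev n (val e.2) x)).
apply: le_trans (pr_exists P (fun e _ => me e)) _.
apply: (@le_trans _ _ (\sum_(e <- enum (coupled n)) q ^+ 2)); last first.
  by rewrite big_const_seq count_predT -cardE iter_addr addr0 mulr_natl.
rewrite big_seq [leRHS]big_seq; apply: ler_sum => e; rewrite mem_enum inE => /andP[e12 _].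
have h := independent_rows_prob hZ hindep x hrows e12 (@gmeas_dev n (val e.1)) (@gmeas_dev n (val e.2)).
have -> : pr [set w | x < `|dev n (val e.1) w| /\ x < `|dev n (val e.2) w|] =
    pr [set w | x < `|dev n (val e.1) w|] * pr [set w | x < `|dev n (val e.2) w|].
  by apply: EFin_inj; rewrite EFinM -!prE // -h.
by rewrite expr2; apply: ler_pM => //; exact: pr_ge0.
Qed.

(** Outside two events of small probability, the off-diagonal part is small and
    no nonzero entry of [A] links two rows with large deviations, so that the
    deterministic bound applies. The second event is unlikely because there are
    [o(p^2)] such pairs, each of probability [O(p^-2)]. *)
Lemma gap_convergence : cvg_in_probability_to0 P (fun n w =>
  a (N n) ^- 2 *
  max_eigen_gap (sqrtmx (A n) *m (S n w - (c n)%:M) *m sqrtmx (A n))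
                (diag_part (S n w - (c n)%:M) *m diag_part (A n))).
Proof.
move=> e e0; have [M0 hM0] := hA_bnd.
pose M := Num.max M0 1; have M1 : 0 < M by rewrite lt_max ltr01 orbT.
have hM n : spectral_norm (A n) <= M by rewrite le_max hM0.
(* the deterministic bound [M * (x + 2 x)] at [x = eps a^2] is then [3/4 e a^2] *)
pose eps := e / (4 * M); have eps0 : 0 < eps by rewrite divr_gt0 // mulr_gt0.
have [C C0 hC] := hrow eps0.
pose G n w := a (N n) ^- 2 *
  max_eigen_gap (sqrtmx (A n) *m (S n w - (c n)%:M) *m sqrtmx (A n))
                (diag_part (S n w - (c n)%:M) *m diag_part (A n)).
have mG n : measurable [set w | e < `|G n w|].
  apply: measurable_gt; apply: measurableT_comp => //; apply: measurable_funM => //.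
  exact: measurable_gap.
suff h eta : 0 < eta -> \forall n \near \oo, pr [set w | e < `|G n w|] <= eta.
  have -> : (fun n => P [set w | e < `|G n w|]) = fun n => (pr [set w | e < `|G n w|])%:E.
    by apply/funext => n; exact: prE.
  apply/fine_cvgP; split; first by near=> n.
  apply/cvgrPdist_le => eta eta0; have := h eta eta0; apply: filterS => n /=.
  by rewrite sub0r normrN ger0_norm //; exact: pr_ge0.
move=> eta0.
have eta20 : 0 < eta / 2 by rewrite divr_gt0.
have C1 : 0 < C ^+ 2 + 1 by rewrite ltr_wpDl // sqr_ge0.
have nu0 : 0 < eta / 2 / (C ^+ 2 + 1) by rewrite divr_gt0.
have hoff' := hoff eps0 eta20.
have hband := nearly_banded_sparse hp_oo hA_band nu0.
near=> n.
have [p0 n0] : (0 < p n)%N /\ (0 < n)%N by near: n; exact: near_dim_gt0.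
have p0' : 0 < (p n)%:R :> R by rewrite ltr0n.
have N0 : (0 < N n)%N by rewrite muln_gt0 n0.
have a0 : 0 < a (N n) by exact: ha_gt0.
have [B [mB hB hBv]] : exists B : set T, [/\ measurable B, pr B <= eta / 2 &
    forall w, ~ B w -> forall v,
      `|qform (S n w - diag_part (S n w)) v| <= eps * a (N n) ^+ 2 * dotc v v].
  by near: n.
have hCn : forall i, pr [set w | eps * a (N n) ^+ 2 < `|dev n i w|] <= C / (p n)%:R.
  by near: n.
have hE : #|coupled n|%:R <= eta / 2 / (C ^+ 2 + 1) * (p n)%:R ^+ 2.
  by near: n.
set x := eps * a (N n) ^+ 2 in hCn hBv.
have x0 : 0 <= x by rewrite mulr_ge0 ?sqr_ge0 // ltW.
have q0 : 0 <= C / (p n)%:R by rewrite divr_ge0.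
have hF := joint_exceedance q0 hCn.
set F := [set w | exists2 e, e \in enum _ & _] in hF.
have mF : measurable F.
  apply: measurable_exists => k _.
  by apply: (measurableI _ _ (measurable_dev n (val k.1) x) (measurable_dev n (val k.2) x)).
have hF2 : pr F <= eta / 2.
  apply: (le_trans hF); rewrite expr_div_n.
  apply: (@le_trans _ _ (eta / 2 / (C ^+ 2 + 1) * (p n)%:R ^+ 2 * (C ^+ 2 / (p n)%:R ^+ 2))).
    by rewrite ler_wpM2r // divr_ge0 ?sqr_ge0.
  have -> : eta / 2 / (C ^+ 2 + 1) * (p n)%:R ^+ 2 * (C ^+ 2 / (p n)%:R ^+ 2) =
    eta / 2 / (C ^+ 2 + 1) * C ^+ 2 by field; rewrite !gt_eqF.
  by rewrite mulrAC ler_pdivrMr // ler_pM2l // lerDl.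
apply: (@le_trans _ _ (pr B + pr F)); last first.
  by rewrite [eta]splitr; exact: lerD.
apply: le_trans (pr_setU P mB mF); apply: pr_le => //; first exact: measurableU.
move=> w /= hw; have [b|nb] := pselect (B w); [by left|right].
apply: contrapT => nF; move: hw; apply/negP; rewrite -leNgt.
have g0 := max_eigen_gap_ge0 (sqrtmx (A n) *m (S n w - (c n)%:M) *m sqrtmx (A n))
                (diag_part (S n w - (c n)%:M) *m diag_part (A n)).
rewrite /G ger0_norm ?mulr_ge0 ?invr_ge0 ?sqr_ge0 //.
rewrite mulrC ler_pdivrMr ?exprn_gt0 //.
rewrite centred_sample_cov_diag centred_sample_cov.
apply: le_trans (max_eigen_gap_bound (hA n) (hM n) _ x0 x0 (ltW M1) (hBv w nb) _) _.
- by rewrite linearB /= sample_cov_sym diag_part_sym.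
- have hh (k : 'I_(p n)) : (\row_i (S n w i i - c n)) 0 k = dev n (val k) w.
    by rewrite [LHS]mxE sample_cov_diag.
  move=> i j ij Aij; rewrite !hh.
  case: (leP `|dev n (val i) w| x) => [h|h1]; first by left.
  case: (leP `|dev n (val j) w| x) => [h|h2]; first by right.
  by exfalso; apply: nF; exists (i, j); rewrite // mem_enum inE /= ij.
have -> : M * (x + x *+ 2) = 3 / 4 * (e * a (N n) ^+ 2).
  by rewrite /x /eps; field; rewrite gt_eqF.
have ea0 : 0 <= e * a (N n) ^+ 2 by rewrite mulr_ge0 ?sqr_ge0 // ltW.
by rewrite ler_piMl // ler_pdivrMr // mul1r ler_nat.
Unshelve. all: by end_near. Qed.

End GapConvergence.

Section Moments.
Context (R : realType) d (T : measurableType d) (P : probability T R).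

Lemma Ex_expectation (f : T -> R) : Ex P f = fine ('E_P[f])%E.
Proof. by rewrite unlock. Qed.

Lemma integ_powers (f : T -> R) : measurable_fun setT f -> (forall w, 0 <= f w) ->
  (forall r : R, 0 < r -> ('E_P[fun w => (f w `^ r)%R] < +oo)%E) ->
  forall k, integ P (fun w => f w ^+ k).
Proof.
move=> mf f0 h [|k]; first exact: integ_cst.
have := h k.+1%:R (ltr0Sn _ _).
rewrite (_ : (fun w => f w `^ k.+1%:R) = fun w => f w ^+ k.+1); last first.
  by apply/funext => w; rewrite powR_mulrn.
rewrite unlock => hk; apply/integrableP; split.
  by apply/measurable_EFinP; exact: measurable_funX.
apply: le_lt_trans hk; rewrite le_eqVlt; apply/orP; left; apply/eqP.
by apply: eq_integral => w _ /=; rewrite ger0_norm // exprn_ge0.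
Qed.

End Moments.

Unset Implicit Arguments.
Set Strict Implicit.
Set Printing Implicit Defensive.

Theorem theorem3p4 (R : realType) (d : measure_display) (T : measurableType d)
    (P : probability T R)
    (sigma Z : nat * nat -> {RV P >-> R})
    (a : nat -> R)
    (p : nat -> nat) (beta : R) (ell : R -> R)
    (alpha qp qm : R) (L : R -> R)
    (A : forall n : nat, 'M[R]_(p n))
    (* stochastic volatility model *)
    (hZ : iid Z)
    (hsigma_stat : stationary_field sigma)
    (hsigma_ge0 : forall it w, 0 <= sigma it w)
    (hindep : independent_fields sigma Z)
    (* normalizing sequence *)
    (ha_gt0 : forall k, (0 < k)%N -> 0 < a k)
    (ha : (k%:R%:E * P [set w | (a k < `|Z (0%N, 0%N) w|)%R])%E
            @[k --> \oo] --> 1%E)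
    (* growth of the dimension *)
    (hp_oo : p n @[n --> \oo] --> \oo)
    (hell : slowly_varying ell)
    (hbeta : 0 < beta <= 1)
    (hp : forall n, (0 < n)%N -> (p n)%:R = n%:R `^ beta * ell n%:R)
    (* regularly varying tails and centering *)
    (halpha : 0 < alpha < 4) (halpha2 : alpha != 2)
    (hqp : 0 <= qp) (hqm : 0 <= qm) (hq : qp + qm = 1)
    (hL : slowly_varying L)
    (htailp : right_tail P (fun w => Z (0%N, 0%N) w) qp L alpha)
    (htailm : right_tail P (fun w => - Z (0%N, 0%N) w) qm L alpha)
    (hZ0 : P.-integrable setT (fun w => (Z (0%N, 0%N) w)%:E) ->
           ('E_P[Z (0%N, 0%N)] = 0)%E)
    (* moments of the volatility *)
    (hmom : forall r : R, 0 < r ->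
       ('E_P[fun w => (sigma (0%N, 0%N) w `^ r)%R] < +oo)%E)
    (* bounded positive definite matrices *)
    (hA : forall n, posdefmx (A n))
    (hA_bnd : exists M : R, forall n, spectral_norm (A n) <= M)
    (* near bandedness *)
    (hA_band : nearly_banded A)
    (* iid stationary ergodic rows with polynomial mixing rate *)
    (hrows : iid_rows sigma)
    (hrows_stat : forall i, stationary_sequence (fun t => sigma (i, t)))
    (hrows_erg : forall i, ergodic_sequence (fun t => sigma (i, t)))
    (hrows_mix : exists c b : R, [/\ 0 < c, 1 < b &
       forall i j : nat, (0 < j)%N ->
         mixing_coef (fun t => sigma (i, t)) j <= c * j%:R `^ (- b)]) :
  let S n w := sample_cov sigma Z (p n) n w in
  let c n := n%:R * fine ('E_P[fun w => (sv_field sigma Z (0%N, 0%N) w ^+ 2)%R])%E in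
  (alpha < 2 ->
     cvg_in_probability_to0 P (fun n w =>
       a (n * p n)%N ^- 2 *
       max_eigen_gap (sqrtmx (A n) *m S n w *m sqrtmx (A n))
                     (diag_part (S n w) *m diag_part (A n))))
  /\
  (2 < alpha ->
     cvg_in_probability_to0 P (fun n w =>
       a (n * p n)%N ^- 2 *
       max_eigen_gap
         (sqrtmx (A n) *m (S n w - (c n)%:M) *m sqrtmx (A n))
         (diag_part (S n w - (c n)%:M) *m diag_part (A n)))).
Proof.
move=> S c.
have hmom' := integ_powers (f := sigma (0%N, 0%N)) (measurable_funPT _) (hsigma_ge0 (0%N, 0%N)) hmom.
have /andP[a0 a4] := halpha.
have [c0 [b [c00 b1 hmix]]] := hrows_mix.
split => ha2.
  have E n w : S n w = S n w - (0 : R)%:M by rewrite raddf0 subr0.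
  have -> : (fun n w => a (n * p n)%N ^- 2 *
       max_eigen_gap (sqrtmx (A n) *m S n w *m sqrtmx (A n))
                     (diag_part (S n w) *m diag_part (A n))) =
    fun n w => a (n * p n)%N ^- 2 *
       max_eigen_gap (sqrtmx (A n) *m (S n w - (0 : R)%:M) *m sqrtmx (A n))
                     (diag_part (S n w - (0 : R)%:M) *m diag_part (A n)).
    by apply/funext => n; apply/funext => w; rewrite -E.
  apply: (gap_convergence (c := fun=> 0)) => //.
    move=> eps e0.
    have [C C0 hC] := row_exceedance_infvar hZ hindep hsigma_stat hsigma_ge0 hmom' hp_oo a0 ha2 hq hL
      htailp htailm ha e0.
    by exists C => //; apply: filterS hC => n h i; under eq_set do rewrite subr0.
  exact: (offdiag_negligible_infvar hZ hindep hsigma_stat hsigma_ge0 hmom' hp_oo a0 ha2 hq hL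
    htailp htailm ha).
have iZ2 := integ_square ha2 hq hL htailp htailm.
have iZ : integ P (Z (0%N, 0%N)) by apply: integ_of_sq iZ2.
have mean0 : Ex P (Z (0%N, 0%N)) = 0 by rewrite Ex_expectation hZ0.
have ec n : c n = n%:R * (smom sigma 2 * Ex P (fun w => Z (0%N, 0%N) w ^+ 2)).
  rewrite /c -Ex_expectation; congr (_ * _).
  have msq : measurable_fun setT (fun x : R => x ^+ 2) by exact: measurable_funX.
  have [_ <-] := sigma_Z_expectation hZ hindep hsigma_stat hmom' (0%N, 0%N) 2 msq iZ2.
  by apply: Ex_eq => w; rewrite /sv_field exprMn.
apply: (gap_convergence (c := c)) => //.
  move=> eps e0.
  have [C C0 hC] := row_exceedance_finvar hZ hindep hsigma_stat hsigma_ge0 hmom' hp_oo hell hbeta hp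
    ha2 a4 hq hL htailp htailm ha e0 c00 b1 hmix.
  by exists C => //; apply: filterS hC => n h i; under eq_set do rewrite ec.
move=> eps eta e0 eta0.
exact: (offdiag_negligible_finvar hZ hindep hsigma_stat hsigma_ge0 hmom' hp_oo hell hbeta hp
  ha2 a4 hq hL htailp htailm ha e0 eta0 mean0).
Qed.
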